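(* Let $\pi\colon\mathbb{R}\to\mathbb{R}$ be a minimal valid function (for a fixed $f\in\mathbb{R}\setminus\mathbb{Z}$) such that (1) $\pi$ is piecewise linear and continuous from at least one side of the origin; (2) its breakpoint set $B$ is minimal; (3) the moves closure $\mathrm{clsemi}_A(\Omega^0)$ of its initial move ensemble has a finite presentation $(\Omega,\mathcal{C})$ in reduced form. Let $U_i=\bigcup_{j=1}^p\gamma_j(D)$ be a connected uncovered component, where $D$ is the fundamental domain for $U_i$ and $\gamma_j|_D\in\Omega|_{U'}$ for $j=1,\dots,p$. Let $\tilde\pi_i\colon\mathbb{R}\to\mathbb{R}$ be a $\mathbb{Z}$-periodic function such that $\tilde\pi_i(x)=0$ for $x\in[0,1]\setminus U_i$. Then $\tilde\pi_i\in\tilde\Pi^\pi_{\mathrm{zero}(\mathcal{T})}$ if and only if (i) $\tilde\pi_i$ is Lipschitz continuous on $D$; (ii) $\tilde\pi_i(x)=\tilde\pi_i(x^-)=\tilde\pi_i(x^+)=0$ for $x\in\partial D$, where $\tilde\pi_i(x^-)$, $\tilde\pi_i(x^+)$ denote the left and right limits at $x$; (iii) $\tilde\pi_i(x)=\chi(\gamma_j)\,\tilde\pi_i(\gamma_j(x))$ for $x\in D$, $j=1,\dots,p$.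
   Context: **Moves.** For $t,r\in\mathbb{R}$ let $\tau_t(x)=x+t$ (translation, character $\chi(\tau_t)=+1$) and $\rho_r(x)=r-x$ (reflection, $\chi(\rho_r)=-1$). A move $\gamma|_D$ is the restriction of a translation or reflection $\gamma$ to a set $D\subseteq\mathbb{R}$ that is an open interval or empty, viewed as a partial bijection $D\to\gamma(D)$ (all empty translations are identified to one object, all empty reflections to another, distinct object). Composition: $\gamma_2|_{D_2}\circ\gamma_1|_{D_1}=(\gamma_2\circ\gamma_1)|_{D_1\cap\gamma_1^{-1}(D_2)}$; inverse: $(\gamma|_D)^{-1}=\gamma^{-1}|_{\gamma(D)}$. A move ensemble is a set of moves. For $O\subseteq\mathbb{R}^2$, $\mathrm{moves}_+(O)$ (resp. $\mathrm{moves}_-(O)$) is the set of translation (resp. reflection) moves whose graph $\{(x,\gamma(x)):x\in D\}$ is contained in $O$, and $\mathrm{moves}(O)=\mathrm{moves}_+(O)\cup\mathrm{moves}_-(O)$. **Closed move semigroups.** Let $A\subseteq\mathbb{R}$ be open. A closed move semigroup (with respect to $A$) is a move ensemble $\Gamma$ closed under composition and inverse such that: (restrict) if $\gamma|_D\in\Gamma$ and $D'\subseteq D$ is an open interval or empty then $\gamma|_{D'}\in\Gamma$; (continuation) if $\gamma|_I\in\Gamma$ for all $I$ in a family whose union $D$ is an interval, then $\gamma|_D\in\Gamma$; (extend$_A$) if $\gamma|_{D^i}\in\Gamma$ for all $i$ in an index set and $D$, empty or an open interval, satisfies $D\subseteq\mathrm{cl}(\bigcup_i D^i)\cap A\cap\gamma^{-1}(A)$,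 then $\gamma|_D\in\Gamma$; (lim) if $D$ is an open interval, $\gamma^i|_D\in\Gamma$ for all $i\in\mathbb{N}$ and $\gamma^i\to\gamma$ (all but finitely many $\gamma^i$ are of the same type as $\gamma$, and their parameters $t$ resp. $r$ converge to that of $\gamma$), then $\gamma|_D\in\Gamma$; (kaleido) for open intervals $D,I$: $\mathrm{moves}_+(D\times I)\subseteq\Gamma$ iff $\mathrm{moves}_-(D\times I)\subseteq\Gamma$. For an ensemble $\Omega'$ all of whose domains and images lie in $A$, the moves closure $\mathrm{clsemi}_A(\Omega')$ is the smallest closed move semigroup containing $\Omega'$. **Finite presentations.** $\mathrm{join}(\Omega')$ is the smallest ensemble containing $\Omega'$ satisfying (restrict) and (continuation). For a finite list $\mathcal{C}=\{C_1,\dots,C_k\}$ where each $C_i$ is a finite union of disjoint open intervals, $\mathrm{moves}(\mathcal{C})=\bigcup_i\mathrm{moves}(C_i\times C_i)$. A finite presentation of an ensemble $\Gamma$ satisfying (restrict), (continuation), (kaleido) is a pair $(\Omega,\mathcal{C})$ with $\Omega$ a finite ensemble and $\Gamma=\mathrm{join}(\Omega\cup\mathrm{moves}(\mathcal{C}))$. It is in reduced form if every move of $\Omega$ is maximal in $\Gamma$ with respect to restriction and is not in $\mathrm{join}(\mathrm{moves}(\mathcal{C}))$. **Minimal valid functions.** Fix $f\in\mathbb{R}\setminus\mathbb{Z}$. Write $\Delta\theta(x,y)=\theta(x)+\theta(y)-\theta(x+y)$. A function $\pi\colon\mathbb{R}\to\mathbb{R}$ is minimal valid iff $\pi\ge0$,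 $\pi$ is $\mathbb{Z}$-periodic, $\pi(0)=0$, $\pi(f)=1$, $\Delta\pi(x,y)\ge0$ and $\Delta\pi(x,f-x)=0$ for all $x,y\in\mathbb{R}$. The space of effective perturbations is $\tilde\Pi^\pi=\{\tilde\pi\colon\mathbb{R}\to\mathbb{R}\mid\exists\epsilon>0:\ \pi\pm\epsilon\tilde\pi\text{ are minimal valid}\}$. **Piecewise linearity.** For $0=x_0<\dots<x_n=1$ let $B=\{x_0,\dots,x_{n-1}\}+\mathbb{Z}$, and let $\mathcal{P}_B$ be the complex consisting of the empty face, the singletons $\{x\}$, $x\in B$, and the closed intervals between consecutive points of $B$. A function is piecewise linear over $\mathcal{P}_B$ if on the relative interior of each face it agrees with an affine function (jumps at points of $B$ are allowed). $B$ is minimal if $\mathcal{P}_B$ is the coarsest such complex over which $\pi$ is piecewise linear. $\Delta\mathcal{P}_B$ is the complex of faces $F(I,J,K)=\{(x,y):x\in I,y\in J,x+y\in K\}$, $I,J,K\in\mathcal{P}_B$. For a face $F$ and $(x,y)\in F$, $\Delta\pi_F(x,y)$ is the limit of $\Delta\pi(u,v)$ as $(u,v)\to(x,y)$ with $(u,v)\in\mathrm{relint}(F)$. A vertex $(x,y)$ of the complex is additive if $\Delta\pi_F(x,y)=0$ for some face $F\ni(x,y)$ of the complex. **Initial moves.** $A$ is the maximal open subset of $(0,1)$ on which $\pi$ is continuous. $\Omega^0$ consists of the empty moves, of all the following moves with $D,\gamma(D)\subseteq A$, $D$ an open interval, and of their inverses: $\tau_t|_D$, $t\in(-1,1)$,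 with $\Delta\pi(x,t)=0$ for all $x\in D$; $\rho_r|_D$, $r\in(0,2)$, with $\Delta\pi(x,r-x)=0$ for all $x\in D$; $\tau_{\bar t}|_D$, $\bar t\in(-1,1)$, such that for all $x\in D$, $\lim_{t\to\bar t^+}\Delta\pi(x,t)=0$ or $\lim_{t\to\bar t^-}\Delta\pi(x,t)=0$; $\rho_{\bar r}|_D$, $\bar r\in(0,2)$, such that for all $x\in D$, $\lim_{r\to\bar r^+}\Delta\pi(x,r-x)=0$ or $\lim_{r\to\bar r^-}\Delta\pi(x,r-x)=0$. **Refined complex.** With $(\Omega,\mathcal{C})$ the reduced finite presentation of $\mathrm{clsemi}_A(\Omega^0)$, let $C=C_1\cup\dots\cup C_k$ (covered points), $U=(0,1)\setminus\mathrm{cl}(C)$ (uncovered points), $X=\{0\}\cup\partial C\cup\{1\}$; $V=\{x,y,x+y: (x,y)\text{ additive vertex of }\Delta\mathcal{P}_B\}\cap[0,1]$; $Y=(V\cap U)\cup\{\gamma(x):x\in V\cap U,\ x\in D,\ \gamma|_D\in\Omega\}$; $Z=\{x\in U: x=\rho|_D(x)\text{ for some reflection move }\rho|_D\in\Omega \text{ with } x\in D\}$; $B'=(X\cup Y\cup Z)+\mathbb{Z}$; $\mathcal{T}=\mathcal{P}_{B'}$, whose vertex set is $B'$. **Connected uncovered components.** Let $U'=U\setminus B'$. $\Omega|_{U'}$ is the set of moves $\gamma|_{D\cap R}$ with $\gamma|_D\in\Omega$, $R$ a maximal open interval of $U'$, $D\cap R\ne\emptyset$ (or $D=\emptyset$).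 (Each nonempty move of $\Omega|_{U'}$ has as domain and as image a maximal open interval of $U'$.) Call maximal intervals $I,J$ of $U'$ connected if there is $\gamma|_I\in\Omega|_{U'}$ with $\gamma(I)=J$. A connected uncovered component $U_i$ is the disjoint union of all intervals $I_1,\dots,I_p$ in a maximal class of pairwise connected maximal intervals of $U'$. One of these intervals, chosen arbitrarily, is the fundamental domain $D$, and $\gamma_j|_D\in\Omega|_{U'}$ is a move with $\gamma_j(D)=I_j$, $j=1,\dots,p$. **Equivariant perturbations.** $\tilde\Pi^\pi_{\mathrm{zero}(\mathcal{T})}$ is the set of $\tilde\pi\in\tilde\Pi^\pi$ such that for every vertex $t$ of $\mathcal{T}$ the value $\tilde\pi(t)$ and the one-sided limits $\lim_{x\to t^-}\tilde\pi(x)$, $\lim_{x\to t^+}\tilde\pi(x)$ are all $0$. *)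

(* Defs.v *)
From HB Require Import structures.
From mathcomp Require Export all_boot all_order all_algebra.
From mathcomp Require Import ring.
From mathcomp Require Export all_classical all_reals all_analysis.

Set Implicit Arguments.
Unset Strict Implicit.
Unset Printing Implicit Defensive.

Export Order.TTheory GRing.Theory Num.Theory.
Export numFieldNormedType.Exports.

#[global] Open Scope classical_set_scope.
#[global] Open Scope ring_scope.

(* A bare transformation of the line; restricting it to a set gives a move. *)
Inductive isom (R : realType) := Transl of R | Refl of R.

Definition isom_fun (R : realType) (g : isom R) : R -> R :=
  match g with Transl t => fun x => x + t | Refl r => fun x => r - x end.
Coercion isom_fun : isom >-> Funclass.

Section Moves.
Variable R : realType.
Implicit Types (g : isom R) (D I : set R).

Definition par g : R := match g with Transl t => t | Refl r => r end.

Definition chi g : R := match g with Transl _ => 1 | Refl _ => -1 end.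

Definition icomp (g2 g1 : isom R) : isom R :=
  match g2, g1 with
  | Transl t2, Transl t1 => Transl (t1 + t2)
  | Transl t2, Refl r1 => Refl (r1 + t2)
  | Refl r2, Transl t1 => Refl (r2 - t1)
  | Refl r2, Refl r1 => Transl (r2 - r1)
  end.

Definition iinv g : isom R :=
  match g with Transl t => Transl (- t) | Refl r => Refl r end.

Lemma icompE g2 g1 x : icomp g2 g1 x = g2 (g1 x).
Proof. by case: g2 g1 => [t2|r2] [t1|r1] /=; ring. Qed.

Lemma iinvK g : cancel g (iinv g).
Proof. by case: g => [t|r] x /=; ring. Qed.

(* Open intervals are nonempty and possibly unbounded. *)
Definition open_itv D := [/\ open D, is_interval D & D !=set0].
Definition open_itv0 D := open_itv D \/ D = set0.

(* A partial map, as its character and graph.  Recording the pair rather than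
   the isometry and the domain makes Leibniz equality the intended one: all
   empty translations coincide, all empty reflections coincide, and the two
   empty moves differ. *)
Record move := Move { mchi : R; mgraph : set (R * R) }.

Definition restr g D : move :=
  Move (chi g) [set p | D p.1 /\ p.2 = g p.1].

(* Not every inhabitant of [move] is a move: [ensemble] below selects them. *)
Definition is_move (m : move) :=
  exists g D, open_itv0 D /\ m = restr g D.

Definition ensemble (G : set move) := G `<=` is_move.

Definition moves_plus (O : set (R * R)) : set move :=
  [set m | exists t D, [/\ open_itv0 D, m = restr (Transl t) D & mgraph m `<=` O]].
Definition moves_minus (O : set (R * R)) : set move :=
  [set m | exists r D, [/\ open_itv0 D, m = restr (Refl r) D & mgraph m `<=` O]].
Definition moves (O : set (R * R)) := moves_plus O `|` moves_minus O.

Implicit Type G : set move.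

Definition comp_closed G := forall g1 D1 g2 D2,
  G (restr g1 D1) -> G (restr g2 D2) ->
  G (restr (icomp g2 g1) (D1 `&` g1 @^-1` D2)).

Definition inv_closed G := forall g D,
  G (restr g D) -> G (restr (iinv g) (g @` D)).

Definition ax_restrict G := forall g D D',
  G (restr g D) -> D' `<=` D -> open_itv0 D' -> G (restr g D').

(* The union is required to be nonempty, so that an empty family does not put
   the empty moves into every ensemble. *)
Definition ax_continuation G := forall g (F : set (set R)),
  (forall I, F I -> G (restr g I)) ->
  open_itv (\bigcup_(I in F) I) -> G (restr g (\bigcup_(I in F) I)).

Definition ax_extend (A : set R) G := forall g (F : set (set R)) D,
  (forall I, F I -> G (restr g I)) -> open_itv0 D ->
  D `<=` closure (\bigcup_(I in F) I) `&` A `&` g @^-1` A ->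
  G (restr g D).

Definition ax_lim G := forall (gs : nat -> isom R) g D,
  open_itv D -> (forall i, G (restr (gs i) D)) ->
  (\forall i \near \oo, chi (gs i) = chi g) ->
  par (gs i) @[i --> \oo] --> par g ->
  G (restr g D).

Definition ax_kaleido G := forall D I, open_itv D -> open_itv I ->
  (moves_plus (D `*` I) `<=` G <-> moves_minus (D `*` I) `<=` G).

Record closed_semigroup (A : set R) G : Prop := ClosedSemigroup {
  cs_ensemble : ensemble G;
  cs_comp : comp_closed G;
  cs_inv : inv_closed G;
  cs_restrict : ax_restrict G;
  cs_continuation : ax_continuation G;
  cs_extend : ax_extend A G;
  cs_lim : ax_lim G;
  cs_kaleido : ax_kaleido G }.

Definition clsemi (A : set R) (Om : set move) : set move :=
  smallest (closed_semigroup A) Om.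

Definition join (Om : set move) : set move :=
  smallest [set G | [/\ ensemble G, ax_restrict G & ax_continuation G]] Om.

Definition disjoint_open_itvs (C : set R) := exists F : set (set R),
  [/\ finite_set F, F `<=` open_itv, trivIset F id & C = \bigcup_(I in F) I].

Definition moves_list k (C : 'I_k -> set R) : set move :=
  \bigcup_i moves (C i `*` C i).

Record finite_presentation G (Om : set move) k (C : 'I_k -> set R) : Prop :=
  FinitePresentation {
    fp_restrict : ax_restrict G;
    fp_continuation : ax_continuation G;
    fp_kaleido : ax_kaleido G;
    fp_ensemble : ensemble Om;
    fp_finite : finite_set Om;
    fp_itvs : forall i, disjoint_open_itvs (C i);
    fp_join : G = join (Om `|` moves_list C) }.

Definition restriction_of (m m' : move) :=
  mchi m = mchi m' /\ mgraph m `<=` mgraph m'.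

Definition maximal_move G (m : move) :=
  G m /\ forall m', G m' -> restriction_of m m' -> m' = m.

Definition reduced_form G (Om : set move) k (C : 'I_k -> set R) :=
  forall m, Om m -> maximal_move G m /\ ~ join (moves_list C) m.

End Moves.

Section MinimalValid.
Variable R : realType.
Implicit Types (f : R) (th pi pt : R -> R).

Definition slack th (x y : R) : R := th x + th y - th (x + y).

Record minimal_valid f pi : Prop := MinimalValid {
  mv_ge0 : forall x, 0 <= pi x;
  mv_periodic : periodic pi 1;
  mv_0 : pi 0 = 0;
  mv_f : pi f = 1;
  mv_subadditive : forall x y, 0 <= slack pi x y;
  mv_symmetric : forall x, slack pi x (f - x) = 0 }.

Definition effective_perturbation f pi pt := exists2 e : R, 0 < e &
  minimal_valid f (fun x => pi x + e * pt x) /\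
  minimal_valid f (fun x => pi x - e * pt x).

End MinimalValid.

Section RelInt.
Variables (R : realType) (V : normedModType R).

Definition affine_set (M : set V) :=
  forall u v, M u -> M v -> forall l : R, M (u + l *: (v - u)).

Definition affine_hull (S : set V) : set V := smallest affine_set S.

Definition relint (S : set V) : set V :=
  [set u | S u /\ \forall v \near u, affine_hull S v -> S v].

End RelInt.

Section PiecewiseLinear.
Variable R : realType.
Implicit Types (B F I J K : set R) (pi : R -> R).

Definition plusZ (S : set R) : set R :=
  [set z | exists2 x, S x & exists k : int, z = x + k%:~R].

Definition breakpoints B := exists (n : nat) (x : nat -> R),
  [/\ x 0%N = 0, x n = 1, forall i, (i < n)%N -> x i < x i.+1
    & B = plusZ [set x i | i in [set i | (i < n)%N]]].

Definition consecutive B (a b : R) :=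
  [/\ B a, B b, a < b & forall x, a < x < b -> ~ B x].

Definition face B F :=
  [\/ F = set0, exists2 x, B x & F = [set x]
    | exists a b, consecutive B a b /\ F = `[a, b]%classic].

Definition piecewise_linear B pi := forall F, face B F ->
  exists c d : R, forall x, relint (F : set R^o) x -> pi x = c * x + d.

(* The complex of B1 refines (is finer than) the complex of B2. *)
Definition refines (B1 B2 : set R) :=
  forall F1, face B1 F1 -> exists2 F2, face B2 F2 & F1 `<=` F2.

Definition minimal_breakpoints B pi :=
  piecewise_linear B pi /\
  forall B1, breakpoints B1 -> piecewise_linear B1 pi -> refines B1 B.

Definition face3 I J K : set (R^o * R^o) :=
  [set u | [/\ I u.1, J u.2 & K (u.1 + u.2)]].

Definition delta_face B (F : set (R^o * R^o)) :=
  exists I J K, [/\ face B I, face B J, face B K & F = face3 I J K].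

Definition delta_vertex B (u : R^o * R^o) := delta_face B [set u].

(* The limit is that of [slack pi] at u taken from the relative interior of F. *)
Definition additive_vertex B pi (u : R^o * R^o) :=
  delta_vertex B u /\
  exists F : set (R^o * R^o), [/\ delta_face B F, F u &
    slack pi v.1 v.2 @[v --> within (relint F) (nbhs u)] --> (0 : R)].

End PiecewiseLinear.

Section InitialMoves.
Variable R : realType.
Variable pi : R -> R.

(* The union of all these open sets is the largest of them. *)
Definition contA : set R :=
  \bigcup_(O in [set O : set R | [/\ open O, O `<=` `]0, 1[%classic
                                   & {within O, continuous pi}]]) O.

Definition tau_move (m : move R) := exists (t : R) (D : set R),
  [/\ m = restr (Transl t) D, -1 < t < 1, open_itv D,
      D `<=` contA /\ Transl t @` D `<=` contA
    & forall x, D x -> slack pi x t = 0].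

Definition rho_move (m : move R) := exists (r : R) (D : set R),
  [/\ m = restr (Refl r) D, 0 < r < 2, open_itv D,
      D `<=` contA /\ Refl r @` D `<=` contA
    & forall x, D x -> slack pi x (r - x) = 0].

Definition tau_lim_move (m : move R) := exists (t : R) (D : set R),
  [/\ m = restr (Transl t) D, -1 < t < 1, open_itv D,
      D `<=` contA /\ Transl t @` D `<=` contA
    & forall x, D x ->
        slack pi x s @[s --> t^'+] --> (0 : R) \/
        slack pi x s @[s --> t^'-] --> (0 : R)].

Definition rho_lim_move (m : move R) := exists (r : R) (D : set R),
  [/\ m = restr (Refl r) D, 0 < r < 2, open_itv D,
      D `<=` contA /\ Refl r @` D `<=` contA
    & forall x, D x ->
        slack pi x (s - x) @[s --> r^'+] --> (0 : R) \/
        slack pi x (s - x) @[s --> r^'-] --> (0 : R)].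

Definition initial_moves : set (move R) :=
  let M := tau_move `|` rho_move `|` tau_lim_move `|` rho_lim_move in
  [set m | exists g : isom R, m = restr g set0] `|` M `|`
  [set m | exists g D, M (restr g D) /\ m = restr (iinv g) (g @` D)].

End InitialMoves.

Section RefinedComplex.
Variable R : realType.
Variables (pi : R -> R) (B : set R) (Om : set (move R)).
Variables (k : nat) (C : 'I_k -> set R).

Definition boundary (S : set R) : set R := closure S `\` interior S.

Definition covered : set R := \bigcup_i C i.
Definition uncovered : set R := `]0, 1[%classic `\` closure covered.

Definition Xset : set R := [set 0] `|` boundary covered `|` [set 1].

Definition Vset : set R :=
  [set v | exists2 u, additive_vertex B pi u &
             [\/ v = u.1, v = u.2 | v = u.1 + u.2]] `&` `[0, 1]%classic.

Definition Yset : set R :=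
  (Vset `&` uncovered) `|`
  [set y | exists (g : isom R) D x,
     [/\ Om (restr g D), (Vset `&` uncovered) x, D x & y = g x]].

Definition Zset : set R :=
  [set x | uncovered x /\ exists r D, [/\ Om (restr (Refl r) D), D x & x = Refl r x]].

Definition refined_breakpoints : set R := plusZ (Xset `|` Yset `|` Zset).

Definition uncovered' : set R := uncovered `\` refined_breakpoints.

Definition maximal_itv (S I : set R) :=
  [/\ open_itv I, I `<=` S &
      forall J, open_itv J -> J `<=` S -> I `<=` J -> J = I].

Definition Omega_uncovered : set (move R) :=
  [set m | exists (g : isom R) D I,
     [/\ Om (restr g D), maximal_itv uncovered' I,
         D `&` I !=set0 \/ D = set0 & m = restr g (D `&` I)]].

Definition connected_itvs (I J : set R) :=
  exists g : isom R, Omega_uncovered (restr g I) /\ g @` I = J.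

Definition connected_class (cl : set (set R)) :=
  cl `<=` maximal_itv uncovered' /\
  forall I J, cl I -> cl J -> connected_itvs I J.

(* I lists, without repetition, the members of a maximal class. *)
Definition uncovered_component p (I : 'I_p -> set R) :=
  [/\ injective I, connected_class (range I) &
      forall cl, connected_class cl -> range I `<=` cl -> cl = range I].

Definition zero_perturbation (f : R) (pt : R -> R) :=
  effective_perturbation f pi pt /\
  forall t, refined_breakpoints t ->
    [/\ pt t = 0, pt x @[x --> t^'-] --> (0 : R)
      & pt x @[x --> t^'+] --> (0 : R)].

End RefinedComplex.

(* Main.v *)
(* An additive point in the interior of a two-dimensional face yields infinitely
   many moves near it, whereas the finite presentation allows only finitely many at
   an uncovered point.  Hence on the uncovered set every initial move comes from an
   additive edge of the complex, whose endpoints are additive vertices and therefore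
   lie outside the components of U'; so an initial move that meets a component is
   defined, and respected by every effective perturbation up to a constant, on the
   whole component.  This property is stable under the closure axioms (the limit
   axiom because there are finitely many moves, the kaleidoscope axiom because it
   concerns no uncovered point), so it holds for the whole moves closure, and the
   vanishing limits at the ends of the component make the constants 0.

   Conversely, an equivariant Lipschitz function that vanishes outside the component
   has zero slack wherever the slack of pi vanishes in the limit along some face.
   Since the slack of pi is affine on each of the finitely many types of faces,
   descending from a point to an edge and then to a vertex bounds the slack of the
   Lipschitz function by a multiple of the slack of pi. *)
From mathcomp Require Import ring lra zify.
Require Import Defs.

Set Implicit Arguments.
Unset Strict Implicit.
Unset Printing Implicit Defensive.

(** * Isometries, moves and open intervals *)

Section Basics.
Variable R : realType.
Implicit Types (g : isom R) (D E J : set R) (x y : R).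

(** The obstacle throughout is that [pi] may jump at breakpoints. Slack is therefore measured by
    [gext], its affine continuation from the relative interior of a face to the closed face, and the
    parameter of a move may sit at an endpoint of its cell, where only a one-sided limit of the
    slack vanishes. Uniform constants come from finiteness modulo 1: the cells form finitely many
    translation classes, so the positive limits of the slack at vertices and the nonzero slope
    differences are bounded away from 0. Continuity at one side of the origin bounds [pi] there by a
    linear function, which makes effective perturbations Lipschitz inside each cell. Domination of
    the slacks says nothing directly on the sign of [pi + u * pt]; nonnegativity comes from
    iterating the subadditivity of a function that is bounded below. The perturbation must also
    vanish at [f], and it does because [f] is forced to be a breakpoint. *)

Lemma iinvKV g : cancel (iinv g) g.
Proof. by case: g => [t|r] x /=; ring. Qed.

Lemma chi_icomp g2 g1 : chi (icomp g2 g1) = chi g2 * chi g1.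
Proof. by case: g2 g1 => [?|?] [?|?] /=; ring. Qed.

Lemma chi_iinv g : chi (iinv g) = chi g.
Proof. by case: g. Qed.

Lemma chi_sqr g : chi g * chi g = 1.
Proof. by case: g => ? /=; ring. Qed.

Lemma isom_dist g x y : `|g x - g y| = `|x - y|.
Proof.
case: g => t /=; first by congr `|_|; ring.
by rewrite distrC; congr `|_|; ring.
Qed.

Lemma isom_eq g g' x : chi g = chi g' -> g x = g' x -> g = g'.
Proof.
case: g g' => t [] t' //= => [_ /addrI-> //|h|h|_ /addIr -> //].
all: by exfalso; lra.
Qed.

Lemma image_isomE g D : g @` D = iinv g @^-1` D.
Proof.
apply/seteqP; split => y /=; first by move=> [x Dx <-]; rewrite iinvK.
by move=> Dy; exists (iinv g y) => //; rewrite iinvKV.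
Qed.

Lemma open_ballP D :
  open D <-> forall x, D x -> exists2 e, 0 < e & forall y, `|y - x| < e -> D y.
Proof.
rewrite openE; split => [oD x /oD /nbhs_ballP [e e0 h]|h x /h [e e0 he]].
  by exists e => // y; rewrite distrC => yx; apply: h.
by apply/nbhs_ballP; exists e => // y /=; rewrite /ball/= distrC => /he.
Qed.

Lemma restr_dom g g' D D' : restr g D = restr g' D' -> D = D'.
Proof.
have sub (h h' : isom R) (E E' : set R) : restr h E = restr h' E' -> E `<=` E'.
  move=> [_ /seteqP[+ _]] x Ex => /(_ (x, h x)) /=.
  by move=> H; have [//|] := H.
by move=> e; apply/seteqP; split; [exact: (sub _ _ _ _ e)|exact: (sub _ _ _ _ (esym e))].
Qed.

Lemma restr_isom g g' D D' x : restr g D = restr g' D' -> D x -> g = g'.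
Proof.
move=> [hc /seteqP[+ _]] Dx => /(_ (x, g x)) /= [//|_ e].
exact: (isom_eq hc e).
Qed.

Lemma restr_eq g D D' : D = D' -> restr g D = restr g D'.
Proof. by move->. Qed.

Lemma open_itv_image g D : open_itv D -> open_itv (g @` D).
Proof.
move=> [oD iD [x0 Dx0]]; split; last by exists (g x0), x0.
  rewrite image_isomE; apply/open_ballP => x /= Dx.
  have [e e0 he] := (open_ballP D).1 oD _ Dx.
  by exists e => // y yx; apply: he; rewrite isom_dist.
rewrite image_isomE => x y /= Dx Dy z /andP[xz zy].
case: g Dx Dy => t /= Dx Dy.
- by apply: (iD _ _ Dx Dy); apply/andP; split; lra.
- by apply: (iD _ _ Dy Dx); apply/andP; split; lra.
Qed.

Lemma open_itv0_image g D : open_itv0 D -> open_itv0 (g @` D).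
Proof.
by case=> [/(open_itv_image g)|->]; [left|right; rewrite image_set0].
Qed.

Lemma open_itv0P D : open D -> is_interval D -> open_itv0 D.
Proof.
move=> oD iD; have [->|/set0P D0] := eqVneq D set0; first by right.
by left.
Qed.

Lemma open_itv0_oi D : open_itv0 D -> open D /\ is_interval D.
Proof. by case=> [[]//|->]; split => //; exact: open0. Qed.

Lemma open_itv0I D E : open_itv0 D -> open_itv0 E -> open_itv0 (D `&` E).
Proof.
move=> /open_itv0_oi[oD iD] /open_itv0_oi[oE iE].
apply: open_itv0P; first exact: openI.
by move=> x y [Dx Ex] [Dy Ey] z h; split; [exact: (iD x y)|exact: (iE x y)].
Qed.

Lemma open_itv0_preimage g D : open_itv0 D -> open_itv0 (g @^-1` D).
Proof.
by move=> hD; have := open_itv0_image (iinv g) hD;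
  rewrite image_isomE; case: (g) => t //=; rewrite opprK.
Qed.

Lemma open_itv_bigcup (F : set (set R)) x :
  F !=set0 -> (forall E, F E -> open_itv E /\ E x) ->
  open_itv (\bigcup_(E in F) E).
Proof.
move=> [E0 FE0] hF; split.
- by apply: bigcup_open => E /hF [[]].
- move=> y z [E FE Ey] [E' FE' E'z] w /andP[yw wz].
  have [[_ iE _] Ex] := hF _ FE; have [[_ iE' _] E'x] := hF _ FE'.
  have [xw|wx] := leP x w.
    by exists E' => //; apply: (iE' x z) => //; apply/andP.
  by exists E => //; apply: (iE y x) => //; apply/andP; split => //; exact: ltW.
- by have [_ ?] := hF _ FE0; exists x, E0.
Qed.

Lemma open_itvU D E x : open_itv D -> open_itv E -> D x -> E x ->
  open_itv (D `|` E).
Proof.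
move=> oD oE Dx Ex.
have -> : D `|` E = \bigcup_(G in [set D; E]) G by rewrite bigcup_setU1 bigcup_set1.
apply: (@open_itv_bigcup _ x); first by exists D; left.
by move=> G [] ->.
Qed.

Lemma open_itv_oo (a b : R) : a < b -> open_itv `]a, b[%classic.
Proof.
move=> ab; split; first exact: interval_open.
- exact: interval_is_interval.
- by exists ((a + b) / 2); rewrite /= in_itv /=; apply/andP; split; lra.
Qed.

Lemma ball_itvE x e : [set y | `|y - x| < e] = `]x - e, x + e[%classic.
Proof.
by apply/seteqP; split => y /=; rewrite in_itv /= ltr_distl.
Qed.

Lemma open_itv_ball x e : 0 < e -> open_itv [set y : R | `|y - x| < e].
Proof. by move=> e0; rewrite ball_itvE; apply: open_itv_oo; lra. Qed.

Lemma maximal_itv_ex (S O : set R) : open_itv O -> O `<=` S ->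
  exists2 J, maximal_itv S J & O `<=` J.
Proof.
move=> oO OS; have [_ _ [x Ox]] := oO.
pose F := [set E : set R | [/\ open_itv E, E `<=` S & E x]].
have FO : F O by [].
have iF : open_itv (\bigcup_(E in F) E).
  by apply: (@open_itv_bigcup _ x); [exists O|move=> E []].
exists (\bigcup_(E in F) E); last exact: bigcup_sup.
split=> //; first by move=> y [E [_ ES _] /ES].
move=> J oJ JS FJ; apply/seteqP; split => //.
apply: (@bigcup_sup _ _ J F id); split => //.
by apply: FJ; exists O.
Qed.

Lemma open_itv_bounded D l u : open_itv D -> D `<=` `[l, u]%classic ->
  exists a b, a < b /\ D = `]a, b[%classic.
Proof.
move=> [oD iD [x0 Dx0]] DA.
have hl : has_lbound D by exists l => y /DA; rewrite /= in_itv /= => /andP[].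
have hu : has_ubound D by exists u => y /DA; rewrite /= in_itv /= => /andP[].
have DE : D = `]inf D, sup D[%classic.
  apply/seteqP; split => x /=; rewrite in_itv /=.
    move=> Dx; have [e e0 he] := (open_ballP D).1 oD _ Dx.
    have h1 : D (x - e / 2).
      by apply: he; rewrite addrAC subrr sub0r normrN gtr0_norm; lra.
    have h2 : D (x + e / 2).
      by apply: he; rewrite addrAC subrr add0r gtr0_norm; lra.
    apply/andP; split.
      by apply: le_lt_trans (ge_inf hl h1) _; lra.
    by apply: lt_le_trans (ub_le_sup hu h2); lra.
  move=> /andP[ix xs].
  have [y Dy yx] := inf_lt (ex_intro _ x0 Dx0) ix.
  have [z Dz xz] := sup_gt (ex_intro _ x0 Dx0) xs.
  by apply: (iD y z Dy Dz); apply/andP; split; exact: ltW.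
exists (inf D), (sup D); split=> //.
have : `]inf D, sup D[%classic x0 by rewrite -DE.
by rewrite /= in_itv /= => /andP[]; exact: lt_trans.
Qed.

(** Source of the uniform gaps used below: slack values at vertices, slope differences and
    differences of move parameters each range over a finite set. *)
Lemma finite_pos_lb (S : set R) : finite_set S ->
  exists2 c, 0 < c & forall s, S s -> 0 < s -> c <= s.
Proof.
move=> /finite_seqP[s ->]; elim: s => [|a s [c c0 IH]]; first by exists 1.
have [a0|a0] := ltP 0 a.
  exists (Num.min a c); first by rewrite lt_min a0 c0.
  move=> b /=; rewrite inE => /orP[/eqP->|bs] b0; first by rewrite ge_min lexx.
  by rewrite ge_min IH ?orbT.
exists c => // b /=; rewrite inE => /orP[/eqP->|bs] b0; last exact: IH.
by move: (lt_le_trans b0 a0); rewrite ltxx.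
Qed.

Lemma closure_ballP (S : set R) x :
  closure S x <-> forall e, 0 < e -> exists2 y, S y & `|y - x| < e.
Proof.
split=> [cS e e0|h U /nbhs_ballP[e /= e0 eU]].
  have [y [Sy /= yx]] := cS _ (nbhsx_ballx x e e0).
  by exists y => //; rewrite distrC.
have [y Sy yx] := h _ e0; exists y; split => //.
by apply: eU; rewrite /= /ball /= distrC.
Qed.

Lemma boundary_oo (a b x : R) : a < b ->
  boundary `]a, b[%classic x <-> x = a \/ x = b.
Proof.
move=> ab; rewrite /boundary (interior_id _).1; last exact: interval_open.
split=> [[/itv_closure /=]|].
  rewrite !in_itv /= => /andP[ax xb] /negP; rewrite negb_and -!leNgt.
  by move=> /orP[xa|bx]; [left|right]; apply/eqP; rewrite eq_le ?ax ?xa ?xb ?bx.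
have nS : x = a \/ x = b -> ~ `]a, b[%classic x.
  by rewrite /= in_itv /= => -[]->; rewrite ltxx ?andbF.
move=> h; split; last exact: nS.
apply/closure_ballP => e e0.
have m0 : 0 < Num.min e (b - a) by rewrite lt_min e0 subr_gt0 ab.
have [me mb] : Num.min e (b - a) <= e /\ Num.min e (b - a) <= b - a.
  by rewrite !ge_min !lexx orbT.
case: h => ->.
  exists (a + Num.min e (b - a) / 2); first by rewrite /= in_itv /=; apply/andP; split; lra.
  by rewrite addrAC subrr add0r gtr0_norm; lra.
exists (b - Num.min e (b - a) / 2); first by rewrite /= in_itv /=; apply/andP; split; lra.
by rewrite addrAC subrr sub0r normrN gtr0_norm; lra.
Qed.

End Basics.

(** * Cells of the complex of a breakpoint set *)

Section Cells.
Variable R : realType.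
Implicit Types (B : set R) (pi : R -> R) (c : R * R) (x y z : R) (k : int).

(** A nonempty face is encoded by its pair of endpoints, which coincide for a vertex, so that
    vertices and edges share most arguments. *)
Definition cell B c := consecutive B c.1 c.2 \/ (c.1 = c.2 /\ B c.1).
Definition cell_in c x := c.1 <= x <= c.2.
Definition cell_relint c x := c.1 < x < c.2 \/ (x = c.1 /\ x = c.2).
Definition cell_shift c k : R * R := (c.1 + k%:~R, c.2 + k%:~R).

(* The affine function that agrees with [pi] on the open cell is recovered from
   the values at two inner points; when [c.1 = c.2] the slope is [0 / 0 = 0] and
   the formula still returns [pi c.1]. *)
Definition cell_slope pi c :=
  3 * (pi (c.2 - (c.2 - c.1) / 3) - pi (c.1 + (c.2 - c.1) / 3)) / (c.2 - c.1).
Definition cell_ext pi c x :=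
  2 * pi (c.1 + (c.2 - c.1) / 3) - pi (c.2 - (c.2 - c.1) / 3)
  + (x - c.1) * cell_slope pi c.

Lemma cell_relintW c x : cell_relint c x -> cell_in c x.
Proof.
by rewrite /cell_in => -[/andP[/ltW-> /ltW->]//|[-> <-]]; rewrite lexx.
Qed.

Lemma cell_le B c : cell B c -> c.1 <= c.2.
Proof. by case=> [[_ _ /ltW]|[->]]. Qed.

Lemma cell_endpoints B c : cell B c -> B c.1 /\ B c.2.
Proof. by case=> [[]|[<-]]. Qed.

Lemma cell_in_cases c x : cell_in c x -> [\/ x = c.1, x = c.2 | c.1 < x < c.2].
Proof.
case/andP; rewrite le_eqVlt => /orP[/eqP->|h]; first by constructor 1.
rewrite le_eqVlt => /orP[/eqP->|h']; first by constructor 2.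
by constructor 3; rewrite h.
Qed.

Lemma cell_in_notB B c x : cell B c -> cell_in c x -> ~ B x -> c.1 < x < c.2.
Proof.
by move=> Bc cx nx; have [B1 B2] := cell_endpoints Bc;
  case: (cell_in_cases cx) => // e; case: nx; rewrite e.
Qed.

Lemma cell_notB B c x : cell B c -> c.1 < x < c.2 -> ~ B x.
Proof.
move=> [[_ _ _]|[-> _]]; first by apply.
by move=> /andP[h1 h2]; have := lt_trans h1 h2; rewrite ltxx.
Qed.

Lemma set1_itv x : [set x] = `[x, x]%classic.
Proof.
apply/seteqP; split => z /=; first by move->; rewrite in_itv /= lexx.
by rewrite in_itv /= -eq_le eq_sym => /eqP.
Qed.

Lemma cell_face B c : cell B c -> face B `[c.1, c.2]%classic.
Proof.
case=> [h|[e h]]; first by constructor 3; exists c.1, c.2.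
constructor 2; exists c.1 => //; rewrite -e.
by rewrite -set1_itv.
Qed.

Lemma cell_ext_affine pi c x y l :
  cell_ext pi c (x + l * (y - x))
  = cell_ext pi c x + l * (cell_ext pi c y - cell_ext pi c x).
Proof. by rewrite /cell_ext; ring. Qed.

Lemma cell_extB pi c x y :
  cell_ext pi c x = cell_ext pi c y + (x - y) * cell_slope pi c.
Proof. by rewrite /cell_ext; ring. Qed.

Lemma cell_relint_conv c x y l :
  cell_in c x -> cell_relint c y -> 0 < l <= 1 -> cell_relint c (x + l * (y - x)).
Proof.
move=> /andP[x1 x2] + /andP[l0 l1]; case=> [/andP[y1 y2]|[y1 y2]].
  by left; apply/andP; split; nra.
by right; have -> : x = y; [apply/eqP; rewrite eq_le {1}y2 x2 y1 x1|rewrite subrr mulr0 addr0].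
Qed.

(** Going past a relative boundary point, away from a relative interior point, leaves the cell at
    once. Read backwards, this detects relative interior points in [relint_face3]. *)
Lemma cell_exit c x y l :
  cell_in c x -> ~ cell_relint c x -> cell_relint c y -> 0 < l ->
  ~ cell_in c (x + l * (x - y)).
Proof.
move=> cx nx cy l0.
have := cell_in_cases cx; case=> [e|e|h]; last by case: nx; left.
- case: cy => [/andP[y1 y2]|[y1 y2]]; last first.
    by case: nx; right; rewrite -y2 y1.
  have : 0 < l * (y - c.1) by rewrite mulr_gt0 // subr_gt0.
  by move=> h /andP[h1 _]; move: h1 h; rewrite e; lra.
- case: cy => [/andP[y1 y2]|[y1 y2]]; last first.
    by case: nx; right; rewrite -y1 y2.
  have : 0 < l * (c.2 - y) by rewrite mulr_gt0 // subr_gt0.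
  by move=> h /andP[_ h1]; move: h1 h; rewrite e; lra.
Qed.

Lemma relint_cell c x : cell_relint c x -> relint (`[c.1, c.2]%classic : set R^o) x.
Proof.
move=> cx; split; first exact: (cell_relintW cx).
case: cx => [/andP[h1 h2]|[h1 h2]].
  have : open (`]c.1, c.2[%classic : set R^o) by exact: interval_open.
  rewrite openE => /(_ x); rewrite /= in_itv /= h1 h2 => /(_ isT).
  apply: filterS => y /=; rewrite !in_itv /= => /andP[/ltW-> /ltW->] //.
(* For a degenerate cell the singleton is itself an affine set, so the affine hull adds no point. *)
near=> y => /(_ [set x : R^o]) -> //=; first by rewrite in_itv /= -h1 h2 lexx.
split; last by rewrite -h1 -h2 -set1_itv.
by move=> u v -> -> l; rewrite subrr scaler0 addr0.
Unshelve. all: by end_near. Qed.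

Lemma cell_ext_eq B pi c x : piecewise_linear B pi -> cell B c ->
  cell_relint c x -> pi x = cell_ext pi c x.
Proof.
move=> plB Bc cx; have [s [d h]] := plB _ (cell_face Bc).
have cle := cell_le Bc.
have H y : cell_relint c y -> pi y = s * y + d by move=> cy; apply/h/relint_cell.
rewrite /cell_ext /cell_slope; case: cx => [/andP[h1 h2]|[h1 h2]].
  have n0 : c.2 - c.1 != 0 by rewrite subr_eq0 gt_eqF //; apply: lt_trans h2.
  have -> := H x; last by left; rewrite h1.
  have -> := H (c.2 - (c.2 - c.1) / 3); last by left; apply/andP; split; lra.
  have -> := H (c.1 + (c.2 - c.1) / 3); last by left; apply/andP; split; lra.
  by field.
by rewrite -h1 -h2 subrr !mul0r addr0 subr0 addr0; ring.
Qed.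

Lemma periodicz pi : periodic pi 1 -> forall x k, pi (x + k%:~R) = pi x.
Proof.
move=> ppi x; have pn n y : pi (y + n%:R) = pi y.
  by elim: n y => [|n IH] y; [rewrite addr0|rewrite -natr1 addrA ppi IH].
case=> n; first by rewrite -pmulrn pn.
by rewrite -[in RHS](subrK n.+1%:R x) pn NegzE mulrNz -pmulrn.
Qed.

Lemma addrKAr (a b t : R) : a + t - (b + t) = a - b.
Proof. by ring. Qed.

Lemma cell_slope_shift pi c k : periodic pi 1 ->
  cell_slope pi (cell_shift c k) = cell_slope pi c.
Proof.
move=> ppi; rewrite /cell_slope /= addrKAr.
by rewrite addrAC periodicz // addrAC periodicz.
Qed.

Lemma cell_ext_shift pi c k x : periodic pi 1 ->
  cell_ext pi (cell_shift c k) (x + k%:~R) = cell_ext pi c x.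
Proof.
move=> ppi; rewrite /cell_ext cell_slope_shift //= !addrKAr.
by rewrite (addrAC c.1) periodicz // (addrAC c.2) periodicz.
Qed.

Lemma cell_in_shift c x k : cell_in c x -> cell_in (cell_shift c k) (x + k%:~R).
Proof. by rewrite /cell_in /= !lerD2r. Qed.

Lemma cell_relint_shift c x k :
  cell_relint c x -> cell_relint (cell_shift c k) (x + k%:~R).
Proof.
rewrite /cell_relint /= !ltrD2r => -[->|[-> <-]]; first by left.
by right.
Qed.

Lemma breakpoints_shift B : breakpoints B -> forall x k, B x -> B (x + k%:~R).
Proof.
move=> [n [xs [_ _ _ ->]]] x k [y ys [l ->]].
by exists y => //; exists (l + k); rewrite intrD addrA.
Qed.

Lemma breakpoints_shiftE B : breakpoints B -> forall x k, B (x + k%:~R) <-> B x.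
Proof.
move=> bB x k; split; last exact: breakpoints_shift.
by move=> /(breakpoints_shift bB (- k)); rewrite intrN addrK.
Qed.

Lemma breakpoints_int B : breakpoints B -> forall k, B k%:~R.
Proof.
move=> [n [xs [x0 xn inc ->]]] k; exists 0; last by exists k; rewrite add0r.
exists 0%N => //=; case: n xn {inc} => // x0'.
by move: x0'; rewrite x0 => /eqP; rewrite eq_sym oner_eq0.
Qed.

Lemma cell_shiftP B c k : breakpoints B -> cell B c -> cell B (cell_shift c k).
Proof.
move=> bB; case=> [[Ba Bb ab h]|[e Ba]]; last first.
  by right; split; [rewrite /= e|apply: breakpoints_shift].
left; split; [exact: breakpoints_shift|exact: breakpoints_shift|by rewrite /= ltrD2r|].
move=> x /= /andP[x1 x2] /(breakpoints_shift bB (- k)); apply: h.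
by rewrite intrN ltrBrDr ltrBlDr x1.
Qed.

Lemma lt_itv_int (a b : R) k : 0 <= a < 1 -> 0 < b <= 1 -> 0 < a + k%:~R < b -> k = 0.
Proof.
move=> /andP[a0 a1] /andP[b0 b1] /andP[h1 h2].
have k1 : (-1 < k)%R by rewrite -(ltr_int R) intrN; lra.
have k2 : (k < 1)%R by rewrite -(ltr_int R); lra.
by apply/eqP; rewrite eq_le; move: k1 k2; lia.
Qed.

Section BreakpointList.
Variables (n : nat) (xs : nat -> R).
Hypotheses (xs0 : xs 0%N = 0) (xsn : xs n = 1).
Hypothesis inc : forall i, (i < n)%N -> xs i < xs i.+1.
Let B := plusZ [set xs i | i in [set i | (i < n)%N]].

Lemma xs_le i j : (i <= j)%N -> (j <= n)%N -> xs i <= xs j.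
Proof.
move=> /subnK <-; elim: (j - i)%N => // m IH; rewrite addSn => h.
by apply: le_trans (IH (ltnW h)) (ltW (inc h)).
Qed.

Lemma xs_itv i : (i < n)%N -> 0 <= xs i < 1.
Proof.
move=> h; apply/andP; split; first by rewrite -xs0; apply: xs_le => //; exact: ltnW.
by rewrite -xsn; apply: lt_le_trans (inc h) _; apply: xs_le.
Qed.

Lemma xs_gap i j k : (i < n)%N -> (j < n)%N -> ~ (xs i < xs j + k%:~R < xs i.+1).
Proof.
move=> hi hj /andP[h1 h2].
have k0 : k = 0.
  apply: (@lt_itv_int (xs j) (xs i.+1)); first exact: xs_itv.
    have /andP[i0 _] := xs_itv hi.
    rewrite (le_lt_trans i0) ?inc //= -xsn.
    exact: xs_le.
  by rewrite h2 andbT; apply: le_lt_trans h1; have /andP[] := xs_itv hi.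
move: h1 h2; rewrite k0 addr0 => h1 h2.
have [ji|ij] := leqP j i.
  by have := lt_le_trans h1 (xs_le ji (ltnW hi)); rewrite ltxx.
by have := lt_le_trans h2 (xs_le ij (ltnW hj)); rewrite ltxx.
Qed.

Lemma B_succ i k : (i < n)%N -> B (xs i.+1 + k%:~R).
Proof.
move=> hi; have := hi; rewrite leq_eqVlt => /orP[/eqP e|h].
  (* The last point 1 is not in the list; it is the translate by 1 of the first point 0. *)
  exists 0; last by exists (k + 1); rewrite e xsn intrD addrC add0r.
  by exists 0%N => //=; rewrite -e.
by exists (xs i.+1); [exists i.+1|exists k].
Qed.

Lemma consecutive_xs i k : (i < n)%N -> consecutive B (xs i + k%:~R) (xs i.+1 + k%:~R).
Proof.
move=> hi; split; first by exists (xs i); [exists i|exists k].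
- exact: B_succ.
- by rewrite ltrD2r inc.
- move=> x /andP[h1 h2] [_ [j hj <-] [l e]].
  apply: (@xs_gap i j (l - k)) => //.
  rewrite intrB addrA -e; apply/andP; split; lra.
Qed.

Lemma xs_locate w : 0 <= w < 1 -> exists2 i, (i < n)%N & xs i <= w < xs i.+1.
Proof.
move=> /andP[w0 w1]; suff H m : (m <= n)%N -> w < xs m ->
    exists2 i, (i < n)%N & xs i <= w < xs i.+1 by apply: (H n) => //; rewrite xsn.
elim: m => [_|m IH hm wm]; first by rewrite xs0 => /(le_lt_trans w0); rewrite ltxx.
have [h|h] := ltP w (xs m); first by apply: IH => //; exact: ltnW.
by exists m => //; rewrite h.
Qed.

Lemma cell_ex_list x : exists c, cell B c /\ cell_relint c x.
Proof.
have /andP[f1 f2] := floor_itv x; set k := Num.floor x in f1 f2.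
have [|i hi /andP[]] := @xs_locate (x - k%:~R).
  by move: f2; rewrite intrD => f2; apply/andP; split; lra.
rewrite le_eqVlt => /orP[/eqP e _|h1 h2].
  exists (x, x); split; last by right.
  by right; split => //; exists (xs i); [exists i|exists k; rewrite e subrK].
exists (xs i + k%:~R, xs i.+1 + k%:~R); split; first by left; apply: consecutive_xs.
by left; apply/andP; split => /=; lra.
Qed.

Lemma right_cell_list x : exists c, cell B c /\ c.1 <= x < c.2.
Proof.
have /andP[f1 f2] := floor_itv x; set k := Num.floor x in f1 f2.
have [|i hi /andP[h1 h2]] := @xs_locate (x - k%:~R).
  by move: f2; rewrite intrD => f2; apply/andP; split; lra.
exists (xs i + k%:~R, xs i.+1 + k%:~R); split; first by left; apply: consecutive_xs.
by apply/andP; split => /=; lra.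
Qed.

Lemma left_cell_list x : exists c, cell B c /\ c.1 < x <= c.2.
Proof.
have [c [Bc [h|[h1 h2]]]] := cell_ex_list x.
  by exists c; case/andP: h => h1 /ltW h2; rewrite h1.
have : B x by rewrite h1; exact: (cell_endpoints Bc).1.
move=> [_ [i hi <-] [k ->]].
(* The predecessor of the first list point is the last one, a period earlier. *)
case: i hi => [|i] hi.
  have n0 : (n.-1 < n)%N by rewrite prednK.
  exists (xs n.-1 + (k - 1)%:~R, xs n.-1.+1 + (k - 1)%:~R); split.
    by left; apply: consecutive_xs.
  have := inc n0; rewrite /= prednK // xsn xs0 intrB => h.
  by apply/andP; split; lra.
exists (xs i + k%:~R, xs i.+1 + k%:~R).
have hi' := ltnW hi; split; first by left; apply: consecutive_xs.
by rewrite /= lexx andbT ltrD2r inc.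
Qed.

Definition base_cells : set (R * R) :=
  [set (xs i, xs i.+1) | i in [set i | (i < n)%N]] `|`
  [set (xs i, xs i) | i in [set i | (i < n)%N]].

Lemma finite_base_cells : finite_set base_cells.
Proof. by rewrite finite_setU; split; apply: finite_image; exact: finite_II. Qed.

Lemma cell_base c : cell B c -> exists2 c0, base_cells c0 & exists k, c = cell_shift c0 k.
Proof.
case: c => a b; case=> /= [[]|[<-]]; last first.
  move=> [_ [i hi <-] [k ->]]; exists (xs i, xs i); last by exists k.
  by right; exists i.
move=> [_ [i hi <-] [k ->]] Bb ab h; exists (xs i, xs i.+1); first by left; exists i.
exists k; rewrite /cell_shift /=; congr (_, _); apply/eqP; rewrite eq_le.
have [_ Bs s1 s2] := consecutive_xs k hi.
rewrite !leNgt; apply/andP; split; apply/negP => lt.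
  by apply: (h (xs i.+1 + k%:~R)) => //; rewrite s1.
by apply: (s2 b) => //; rewrite ab.
Qed.

End BreakpointList.

Lemma cell_ex B : breakpoints B -> forall x, exists c, cell B c /\ cell_relint c x.
Proof. by move=> [n [xs [x0 xn inc ->]]]; exact: cell_ex_list. Qed.

Lemma right_cell B : breakpoints B -> forall x, exists c, cell B c /\ c.1 <= x < c.2.
Proof. by move=> [n [xs [x0 xn inc ->]]]; exact: right_cell_list. Qed.

Lemma left_cell B : breakpoints B -> forall x, exists c, cell B c /\ c.1 < x <= c.2.
Proof. by move=> [n [xs [x0 xn inc ->]]]; exact: left_cell_list. Qed.

(** Every cell is an integer translate of one of finitely many base cells. *)
Lemma finite_cell_inv B (T : Type) (F : R * R -> T) : breakpoints B ->
  (forall c k, F (cell_shift c k) = F c) -> finite_set [set F c | c in cell B].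
Proof.
move=> [n [xs [x0 xn inc ->]]] hF.
apply: sub_finite_set (finite_image F (finite_base_cells n xs)).
by move=> _ [c /(cell_base x0 xn inc)[c0 h [k ->]] <-]; exists c0; rewrite ?hF.
Qed.

(** At a vertex of the two-dimensional complex two of [x], [y], [x + y] lie in [B], so the third is
    a sum or a difference of points of [B]. *)
Definition cell_sums B := [set z | exists a b, [/\ B a, B b & z = a + b \/ z = a - b]].

Lemma cell_sums_base B : breakpoints B -> exists2 S : set R, finite_set S &
  forall z, cell_sums B z -> exists2 s, S s & exists k, z = s + k%:~R.
Proof.
move=> [n [xs [x0 xn inc ->]]].
set X := [set xs i | i in [set i | (i < n)%N]].
have fX : finite_set X by apply: finite_image; exact: finite_II.
exists ([set x + y | x in X & y in X] `|` [set x - y | x in X & y in X]).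
  by rewrite finite_setU; split; apply: finite_image2.
move=> z [_ [_ [[a Xa [k ->]] [b Xb [l ->]] [->|->]]]].
  by exists (a + b); [left; exists a => //; exists b|exists (k + l); rewrite intrD; ring].
by exists (a - b); [right; exists a => //; exists b|exists (k - l); rewrite intrB; ring].
Qed.

Lemma finite_cell_sums01 B : breakpoints B -> finite_set (cell_sums B `&` `[0, 1]%classic).
Proof.
move=> /cell_sums_base[S fS hS].
apply: (@sub_finite_set _ _ ([set 1] `|` [set s - (Num.floor s)%:~R | s in S])).
  move=> z [/hS[s Ss [k ->]]]; rewrite /= in_itv /= => /andP[h0].
  rewrite le_eqVlt => /orP[/eqP h1|h1]; first by left.
  right; exists s => //; congr (_ + _).
  have -> : Num.floor s = - k; last by rewrite intrN opprK.
  by apply: floor_def; rewrite intrD intrN; apply/andP; split; lra.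
by rewrite finite_setU; split; [exact: finite_set1|exact: finite_image].
Qed.

Lemma finite_cell_sums_values B pi : breakpoints B -> periodic pi 1 ->
  finite_set [set pi z | z in cell_sums B].
Proof.
move=> /cell_sums_base[S fS hS] ppi.
apply: sub_finite_set (finite_image pi fS).
by move=> _ [z /hS[s Ss [k ->]] <-]; exists s; rewrite ?periodicz.
Qed.

Lemma cell_sums_left B : breakpoints B -> B `<=` cell_sums B.
Proof.
move=> bB x Bx; exists x, 0; split => //; last by left; rewrite addr0.
exact: (breakpoints_int bB 0).
Qed.

(** Limits of [pi] from within a cell at coordinates of vertices: a limit of the slack at a vertex
    is a signed sum of three of these. *)
Definition cell_values B pi :=
  [set v | exists c z, [/\ cell B c, cell_in c z, cell_sums B z & v = cell_ext pi c z]].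

Lemma finite_cell_values B pi : breakpoints B -> piecewise_linear B pi ->
  periodic pi 1 -> finite_set (cell_values B pi).
Proof.
move=> bB plB ppi.
apply: (@sub_finite_set _ _ ([set cell_ext pi c c.1 | c in cell B] `|`
  [set cell_ext pi c c.2 | c in cell B] `|` [set pi z | z in cell_sums B])).
  move=> _ [c [z [Bc cz sz ->]]].
  have [->|->|h] := cell_in_cases cz; [by left; left; exists c|by left; right; exists c|].
  by right; exists z => //; apply: (cell_ext_eq plB Bc); left.
rewrite !finite_setU; split; last exact: finite_cell_sums_values.
split; apply: (@finite_cell_inv B _ _ bB) => c k; exact: cell_ext_shift.
Qed.

Lemma finite_cell_slopes B pi : breakpoints B -> periodic pi 1 ->
  finite_set [set cell_slope pi c | c in cell B].
Proof. by move=> bB ppi; apply: (finite_cell_inv bB) => c k; exact: cell_slope_shift. Qed.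

End Cells.

(** * Additive points of the two-dimensional complex *)

Section Edges.
Variable R : realType.
Implicit Types (B : set R) (pi th pt : R -> R) (g : isom R) (c : R * R).
Implicit Types (s x y t : R) (k : int).

Definition setpar g s : isom R :=
  match g with Transl _ => Transl s | Refl _ => Refl s end.

(* One expression for both characters, with the parameter [s] of the isometry free
   to vary around [par g], as the limiting initial moves require. *)
Definition gslack th g s x := th x + chi g * (th s - th (setpar g s x)).

Lemma gslack_transl th t s x : gslack th (Transl t) s x = slack th x s.
Proof. by rewrite /gslack /slack /=; ring. Qed.

Lemma gslack_refl th r s x : gslack th (Refl r) s x = slack th x (s - x).
Proof. by rewrite /gslack /slack /= (_ : x + (s - x) = s); ring. Qed.

Lemma setpar_par g : setpar g (par g) = g.
Proof. by case: g. Qed.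

Lemma setpar_affine g s q x p l :
  setpar g (s + l * (q - s)) (x + l * (p - x))
  = setpar g s x + l * (setpar g q p - setpar g s x).
Proof. by case: g => ? /=; ring. Qed.

Lemma setpar_dist g s q x : `|setpar g s x - setpar g q x| = `|s - q|.
Proof. by case: g => ? /=; congr `|_|; ring. Qed.

Lemma gslack_ge0 th g s x : (forall x y, 0 <= slack th x y) -> 0 <= gslack th g s x.
Proof. by case: g => t h; rewrite ?gslack_transl ?gslack_refl. Qed.

Lemma gslack_le K pi pt g s x :
  (forall x y, `|slack pt x y| <= K * slack pi x y) ->
  `|gslack pt g s x| <= K * gslack pi g s x.
Proof. by case: g => t h; rewrite ?gslack_transl ?gslack_refl. Qed.

(** [p] and [q] make the relative interiors of the three cells meet; by convexity every point of the
    closed face is then a limit of such points. For a reflection [c2] holds the sum and [c3] the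
    second summand. *)
Definition gcell B g c1 c2 c3 := [/\ cell B c1, cell B c2, cell B c3 &
  exists p q, [/\ cell_relint c1 p, cell_relint c2 q & cell_relint c3 (setpar g q p)]].

Definition gcell_in g c1 c2 c3 s x :=
  [/\ cell_in c1 x, cell_in c2 s & cell_in c3 (setpar g s x)].

(** The slack on the relative interior of the face, continued affinely to the closed face: the limit
    of the slack along that face. *)
Definition gext pi g c1 c2 c3 s x :=
  cell_ext pi c1 x + chi g * (cell_ext pi c2 s - cell_ext pi c3 (setpar g s x)).

Lemma gext_affine pi g c1 c2 c3 s q x p l :
  gext pi g c1 c2 c3 (s + l * (q - s)) (x + l * (p - x))
  = gext pi g c1 c2 c3 s x + l * (gext pi g c1 c2 c3 q p - gext pi g c1 c2 c3 s x).
Proof. by rewrite /gext setpar_affine !cell_ext_affine; ring. Qed.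

Lemma gext_par pi g c1 c2 c3 s s' x :
  gext pi g c1 c2 c3 s' x = gext pi g c1 c2 c3 s x
    + chi g * (s' - s) * (cell_slope pi c2 - cell_slope pi c3).
Proof. by rewrite /gext /cell_ext; case: g => ? /=; ring. Qed.

(** The same slope serves both characters: for a reflection the sign of [chi g] and that of [x] in
    [setpar] cancel. *)
Lemma gext_shiftx pi g c1 c2 c3 s x x' :
  gext pi g c1 c2 c3 s x' = gext pi g c1 c2 c3 s x
    + (x' - x) * (cell_slope pi c1 - cell_slope pi c3).
Proof. by rewrite /gext /cell_ext; case: g => ? /=; ring. Qed.

Lemma affine_ge0 (a b : R) : (forall l, 0 < l <= 1 -> 0 <= a + l * (b - a)) -> 0 <= a.
Proof.
move=> h; rewrite leNgt; apply/negP => a0.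
have b0 : 0 <= b by have := h 1; rewrite ltr01 lexx mul1r => /(_ isT); lra.
have ba : 0 < b - a by lra.
(* Halfway to the zero of the affine function, where its value is [a / 2]. *)
have /h : 0 < - a / (2 * (b - a)) <= 1.
  by rewrite divr_gt0 ?mulr_gt0 //= ?ler_pdivrMr ?mulr_gt0 //; lra.
have -> : - a / (2 * (b - a)) * (b - a) = - a / 2 by field; lra.
by lra.
Qed.

Section WithPi.
Variables (B : set R) (pi : R -> R).
Hypotheses (bB : breakpoints B) (plB : piecewise_linear B pi).
Hypotheses (ppi : periodic pi 1) (spi : forall x y, 0 <= slack pi x y).

Lemma gext_eq g c1 c2 c3 s x : gcell B g c1 c2 c3 ->
  cell_relint c1 x -> cell_relint c2 s -> cell_relint c3 (setpar g s x) ->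
  gslack pi g s x = gext pi g c1 c2 c3 s x.
Proof.
move=> [b1 b2 b3 _] h1 h2 h3; rewrite /gslack /gext.
by rewrite (cell_ext_eq plB b1 h1) (cell_ext_eq plB b2 h2) (cell_ext_eq plB b3 h3).
Qed.

(** On the segment towards the witness of [gcell] all points but the first are relatively interior,
    where [gext] is a slack; nonnegativity passes to the first point by affinity. *)
Lemma gext_ge0 g c1 c2 c3 s x : gcell B g c1 c2 c3 -> gcell_in g c1 c2 c3 s x ->
  0 <= gext pi g c1 c2 c3 s x.
Proof.
move=> hc [h1 h2 h3]; have [_ _ _ [p [q [r1 r2 r3]]]] := hc.
apply: (@affine_ge0 _ (gext pi g c1 c2 c3 q p)) => l l01.
rewrite -gext_affine -gext_eq //; first exact: gslack_ge0.
- exact: cell_relint_conv.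
- exact: cell_relint_conv.
- by rewrite setpar_affine; apply: cell_relint_conv.
Qed.

(* Additivity at [x], possibly only as a limit taken from inside the face with
   cells [c1], [c2], [c3]. *)
Definition gadd g x := exists c1 c2 c3, [/\ gcell B g c1 c2 c3,
  gcell_in g c1 c2 c3 (par g) x & gext pi g c1 c2 c3 (par g) x = 0].

(** This lemma and the next two express the symmetry of [x], [y] and [x + y]: permuting the three
    cells turns one reading of an additive point into another. *)
Lemma gadd_swap x y : gadd (Transl y) x -> gadd (Transl x) y.
Proof.
move=> [c1 [c2 [c3 [[b1 b2 b3 [p [q [r1 r2 r3]]]] [h1 h2 h3] e]]]].
exists c2, c1, c3; split.
- by split=> //; exists q, p; split=> //=; rewrite addrC.
- by split=> //=; rewrite addrC.
- by rewrite -e /gext /= (addrC y); ring.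
Qed.

Lemma gadd_refl r x : gadd (Refl r) x -> gadd (Transl (r - x)) x.
Proof.
move=> [c1 [c2 [c3 [[b1 b2 b3 [p [q [r1 r2 r3]]]] [h1 h2 h3] e]]]].
exists c1, c3, c2; split.
- by split=> //; exists p, (q - p); split=> //=; rewrite addrC subrK.
- by split=> //=; rewrite addrC subrK.
- by rewrite -e /gext /= (addrC x) subrK; ring.
Qed.

Lemma gadd_transl y x : gadd (Transl y) x -> gadd (Refl (x + y)) x.
Proof.
move=> [c1 [c2 [c3 [[b1 b2 b3 [p [q [r1 r2 r3]]]] [h1 h2 h3] e]]]].
exists c1, c3, c2; split.
- by split=> //; exists p, (p + q); split=> //=; rewrite (addrC p) addrK.
- by split=> //=; rewrite (addrC x) addrK.
- by rewrite -e /gext /= (addrC x) addrK; ring.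
Qed.

Lemma gadd_shift y x k l :
  gadd (Transl y) x -> gadd (Transl (y + l%:~R)) (x + k%:~R).
Proof.
have E (a b : R) : a + k%:~R + (b + l%:~R) = a + b + (k + l)%:~R by rewrite intrD; ring.
move=> [c1 [c2 [c3 [[b1 b2 b3 [p [q [r1 r2 r3]]]] [h1 h2 h3] e]]]].
exists (cell_shift c1 k), (cell_shift c2 l), (cell_shift c3 (k + l)); split.
- split; [exact: cell_shiftP|exact: cell_shiftP|exact: cell_shiftP|].
  exists (p + k%:~R), (q + l%:~R).
  by split; [exact: cell_relint_shift|exact: cell_relint_shift|rewrite /= E; exact: cell_relint_shift].
- by split; [exact: cell_in_shift|exact: cell_in_shift|rewrite /= E; exact: cell_in_shift].
- by rewrite /gext /= E !cell_ext_shift // -e.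
Qed.

Lemma gadd_slack0 x y : slack pi x y = 0 -> gadd (Transl y) x.
Proof.
move=> e; have [c1 [b1 h1]] := cell_ex bB x; have [c2 [b2 h2]] := cell_ex bB y.
have [c3 [b3 h3]] := cell_ex bB (x + y).
have hc : gcell B (Transl y) c1 c2 c3 by split=> //; exists x, y.
exists c1, c2, c3; split=> //; first by split; apply: cell_relintW.
by rewrite -gext_eq // gslack_transl.
Qed.

(** A relative interior point [v] can be pushed slightly away from the witness [(p, q)] without
    leaving the face, which [cell_exit] forbids as soon as one coordinate is on the boundary of its
    cell. *)
Lemma relint_face3 c1 c2 c3 (v : R^o * R^o) : gcell B (Transl 0) c1 c2 c3 ->
  relint (face3 `[c1.1, c1.2]%classic `[c2.1, c2.2]%classic `[c3.1, c3.2]%classic) v ->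
  [/\ cell_relint c1 v.1, cell_relint c2 v.2 & cell_relint c3 (v.1 + v.2)].
Proof.
move=> [_ _ _ [p [q [r1 r2 r3]]]].
set F := face3 _ _ _ => -[[v1 v2 v3] nv].
have Fp : F (p, q) by split; apply: cell_relintW.
have hull (l : R) : affine_hull F (v + l *: ((p, q) - v)).
  move=> M [aM FM]; apply: aM; apply: FM => //; split => //.
move/nbhs_ballP: nv => [e /= e0 he].
pose m := 1 + `|p - v.1| + `|q - v.2|.
have m0 : 0 < m by rewrite /m -addrA ltr_wpDr // addr_ge0.
(* [m] bounds both coordinates of [(p, q) - v], so the push by [l] stays within the ball of radius
   [e]. *)
pose l := e / (2 * m).
have l0 : 0 < l by rewrite divr_gt0 // mulr_gt0.
have small (a : R) : `|a| <= m -> `|l * a| < e.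
  move=> am; rewrite normrM gtr0_norm //.
  apply: (@le_lt_trans _ _ (l * m)); first by rewrite ler_pM2l.
  have -> : l * m = e / 2 by rewrite /l; field; rewrite gt_eqF.
  by rewrite ltr_pdivrMr // mulr_natr mulr2n ltrDl.
have [w1 w2 w3] : F (v - l *: ((p, q) - v)).
  apply: (he (v - l *: ((p, q) - v))).
    have a1 := normr_ge0 (p - v.1); have a2 := normr_ge0 (q - v.2).
    have m1 : `|p - v.1| <= m by rewrite /m -addrA addrCA lerDl addr_ge0.
    have m2 : `|q - v.2| <= m by rewrite /m lerDr addr_ge0.
    split; rewrite /= /ball /= opprB addrCA subrr addr0; [exact: (small _ m1)|exact: (small _ m2)].
  by rewrite -scaleNr; exact: hull.
have ex c (a b : R) : cell_in c a -> cell_relint c b -> cell_in c (a + l * (a - b)) ->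
    cell_relint c a.
  by move=> ca cb; apply: contraPP => na; apply: (cell_exit ca na cb l0).
split.
- by apply: (ex _ _ p) => //; move: w1; rewrite /= -mulrN opprB.
- by apply: (ex _ _ q) => //; move: w2; rewrite /= -mulrN opprB.
- apply: (ex _ _ (p + q)) => //; move: w3.
  by congr (cell_in c3 _); rewrite /= /GRing.scale /=; ring.
Qed.

(** Two coordinates in [B] allow two of the three faces to be singletons, which pins the point down.
    The required limit exists because the slack coincides with the affine [gext] on the relative
    interior. *)
Lemma gadd_vertex x y : gadd (Transl y) x ->
  (B x /\ B y) \/ (B x /\ B (x + y)) \/ (B y /\ B (x + y)) ->
  additive_vertex B pi (x, y).
Proof.
move=> [c1 [c2 [c3 [hc [/= h1 h2 h3] e]]]] hB.
have [b1 b2 b3 rc] := hc.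
have fB z : B z -> face B [set z] by move=> Bz; constructor 2; exists z.
split.
  case: hB => [[Bx By]|[[Bx Bz]|[By Bz]]].
  - exists [set x], [set y], `[c3.1, c3.2]%classic; split; [exact: fB|exact: fB|exact: cell_face|].
    apply/seteqP; split => [_ ->|[a b] [/= -> -> //]]; split => //=.
  - exists [set x], `[c2.1, c2.2]%classic, [set x + y]; split; [exact: fB|exact: cell_face|exact: fB|].
    by apply/seteqP; split => [_ ->|[a b] [/= -> _ /addrI -> //]]; split => //=.
  - exists `[c1.1, c1.2]%classic, [set y], [set x + y]; split; [exact: cell_face|exact: fB|exact: fB|].
    by apply/seteqP; split => [_ ->|[a b] [/= _ -> /addIr -> //]]; split => //=.
exists (face3 `[c1.1, c1.2]%classic `[c2.1, c2.2]%classic `[c3.1, c3.2]%classic); split.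
- by exists `[c1.1, c1.2]%classic, `[c2.1, c2.2]%classic, `[c3.1, c3.2]%classic; split => //;
    apply: cell_face.
- by split.
- pose h (v : R^o * R^o) := gext pi (Transl 0) c1 c2 c3 v.2 v.1.
  have hE (v : R^o * R^o) : h v = h (x, y)
      + (v.1 - x) * (cell_slope pi c1 - cell_slope pi c3)
      + (v.2 - y) * (cell_slope pi c2 - cell_slope pi c3).
    by rewrite /h /gext /cell_ext /=; ring.
  have hc' : gcell B (Transl 0) c1 c2 c3 by [].
  set F := face3 _ _ _.
  apply: (@cvg_trans _ (h v @[v --> within (relint F) (nbhs ((x, y) : R^o * R^o))])).
    apply: near_eq_cvg; apply: filterS (withinT _ _) => v /(relint_face3 hc') [r1 r2 r3].
    by rewrite /h -gext_eq // gslack_transl.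
  apply: cvg_within_filter.
  have h0 : h (x, y) = 0 by rewrite -e.
  rewrite (funext hE).
  suff : (h (x, y) + (v.1 - x) * (cell_slope pi c1 - cell_slope pi c3)
      + (v.2 - y) * (cell_slope pi c2 - cell_slope pi c3)) @[v --> ((x, y) : R^o * R^o)]
    --> h (x, y) + (x - x) * (cell_slope pi c1 - cell_slope pi c3)
      + (y - y) * (cell_slope pi c2 - cell_slope pi c3).
    by rewrite !subrr !mul0r !addr0 h0.
  apply: cvgD; first (apply: cvgD; first exact: cvg_cst).
    by apply: cvgMr_tmp; apply: cvgB; [exact: cvg_fst|exact: cvg_cst].
  by apply: cvgMr_tmp; apply: cvgB; [exact: cvg_snd|exact: cvg_cst].
Qed.

End WithPi.
End Edges.

(** * Edges and initial moves *)

Section InitialEdges.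
Variable R : realType.
Implicit Types (th pt : R -> R) (g : isom R) (c : R * R) (D E : set R).
Implicit Types (s x y t : R) (k : int).

Lemma cvg_right_affine (F : R -> R) (t a b : R) :
  (\forall s \near t^'+, F s = a + (s - t) * b) ->
  (F s @[s --> t^'+] --> (0 : R)) <-> a = 0.
Proof.
move=> hF; have ca : F s @[s --> t^'+] --> a.
  apply: cvg_trans (_ : a + (s - t) * b @[s --> t^'+] --> a).
    by apply: near_eq_cvg; near do apply: esym.
  apply: cvg_at_right_filter.
  suff : a + (s - t) * b @[s --> t] --> a + (t - t) * b by rewrite subrr mul0r addr0.
  apply: cvgD; first exact: cvg_cst.
  by apply: cvgMr_tmp; apply: cvgB; [exact: cvg_id|exact: cvg_cst].
split=> [c0|<- //]; exact: (cvg_unique _ ca c0).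
Unshelve. all: by end_near. Qed.

Lemma cvg_left_affine (F : R -> R) (t a b : R) :
  (\forall s \near t^'-, F s = a + (s - t) * b) ->
  (F s @[s --> t^'-] --> (0 : R)) <-> a = 0.
Proof.
move=> hF; have ca : F s @[s --> t^'-] --> a.
  apply: cvg_trans (_ : a + (s - t) * b @[s --> t^'-] --> a).
    by apply: near_eq_cvg; near do apply: esym.
  apply: cvg_at_left_filter.
  suff : a + (s - t) * b @[s --> t] --> a + (t - t) * b by rewrite subrr mul0r addr0.
  apply: cvgD; first exact: cvg_cst.
  by apply: cvgMr_tmp; apply: cvgB; [exact: cvg_id|exact: cvg_cst].
split=> [c0|<- //]; exact: (cvg_unique _ ca c0).
Unshelve. all: by end_near. Qed.

Lemma near_itv (l u t : R) : l < t < u -> \forall s \near t, l < s < u.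
Proof.
move=> h; have : open `]l, u[%classic by exact: interval_open.
rewrite openE => /(_ t); rewrite /= in_itv /= => /(_ h).
by apply: filterS => s /=; rewrite in_itv.
Qed.

Lemma cvg_setpar g x t : setpar g s x @[s --> t] --> setpar g t x.
Proof.
case: g => r /=; first by apply: cvgD; [exact: cvg_cst|exact: cvg_id].
by apply: cvgB; [exact: cvg_id|exact: cvg_cst].
Qed.

Lemma near_setpar g x (l u t : R) : l < setpar g t x < u ->
  \forall s \near t, l < setpar g s x < u.
Proof. by move=> /near_itv h; have := @cvg_setpar g x t _ h. Qed.

Variables (B : set R) (pi : R -> R).
Hypotheses (bB : breakpoints B) (plB : piecewise_linear B pi).
Hypotheses (ppi : periodic pi 1) (spi : forall x y, 0 <= slack pi x y).

Lemma contA_sub01 : contA pi `<=` `]0, 1[%classic.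
Proof. by move=> x [U [_ sU _] /sU]. Qed.

Lemma notB_contA x : 0 < x < 1 -> ~ B x -> contA pi x.
Proof.
move=> /andP[x0 x1] nx; have [c [Bc cx]] := cell_ex bB x.
have /andP[c1 c2] := cell_in_notB Bc (cell_relintW cx) nx.
pose O := (`]0, 1[ `&` `]c.1, c.2[ : set R)%classic.
have oO : open O by apply: openI; exact: interval_open.
exists O; last by split; rewrite /= in_itv /= ?x0 ?c1.
split=> //; first by move=> y [].
rewrite continuous_open_subspace // => y; rewrite inE => Oy; rewrite /prop_for /continuous_at.
have -> : pi y = cell_ext pi c y.
  by case: Oy => _; rewrite /= in_itv /= => h; apply: (cell_ext_eq plB Bc); left.
apply: cvg_trans (_ : cell_ext pi c z @[z --> y] --> _).
  apply: near_eq_cvg; have := open_nbhs_nbhs (conj oO Oy).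
  apply: filterS => z [_]; rewrite /= in_itv /= => h.
  by rewrite (cell_ext_eq plB Bc) //; left.
rewrite /cell_ext; apply: cvgD; first exact: cvg_cst.
by apply: cvgMr_tmp; apply: cvgB; [exact: cvg_id|exact: cvg_cst].
Qed.

(** The four families of initial moves in one formula. The bounds on the parameter are omitted: they
    follow from [E] and its image lying in the open unit interval. *)
Definition gmove g E := [/\ open_itv E, E `<=` contA pi, g @` E `<=` contA pi &
  (forall x, E x -> gslack pi g (par g) x = 0) \/
  (forall x, E x -> gslack pi g s x @[s --> (par g)^'+] --> (0 : R) \/
                    gslack pi g s x @[s --> (par g)^'-] --> (0 : R))].

Lemma gslack_fun_transl t x : (fun s => gslack pi (Transl t) s x) = slack pi x.
Proof. by apply/funext => s; rewrite gslack_transl. Qed.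

Lemma gslack_fun_refl r x :
  (fun s => gslack pi (Refl r) s x) = (fun s => slack pi x (s - x)).
Proof. by apply/funext => s; rewrite gslack_refl. Qed.

Definition initial_union : set (move R) :=
  tau_move pi `|` rho_move pi `|` tau_lim_move pi `|` rho_lim_move pi.

Lemma gmove_union g E : gmove g E -> initial_union (restr g E).
Proof.
move=> [oE EA gEA h]; have [_ _ [x Ex]] := oE.
have := contA_sub01 (EA _ Ex); rewrite /= in_itv /= => /andP[x0 x1].
have := contA_sub01 (gEA _ (imageP g Ex)); rewrite /= in_itv /= => /andP[gx0 gx1].
case: g gEA h gx0 gx1 => t gEA [h|h] /= gx0 gx1.
- left; left; left; exists t, E; split=> //; first by apply/andP; split; lra.
  by move=> y /h; rewrite gslack_transl.
- left; right; exists t, E; split=> //; first by apply/andP; split; lra.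
  by move=> y /h; rewrite gslack_fun_transl.
- left; left; right; exists t, E; split=> //; first by apply/andP; split; lra.
  by move=> y /h; rewrite gslack_refl.
- right; exists t, E; split=> //; first by apply/andP; split; lra.
  by move=> y /h; rewrite gslack_fun_refl.
Qed.

Lemma union_gmove m : initial_union m -> exists g E, gmove g E /\ m = restr g E.
Proof.
move=> [[[|]|]|] [t [E [-> ht oE [EA gEA] h]]];
  [exists (Transl t), E|exists (Refl t), E|exists (Transl t), E|exists (Refl t), E];
  split=> //; split=> //.
- by left => x /h; rewrite gslack_transl.
- by left => x /h; rewrite gslack_refl.
- by right => x /h; rewrite gslack_fun_transl.
- by right => x /h; rewrite gslack_fun_refl.
Qed.

Lemma gmove_initial g E : gmove g E -> initial_moves pi (restr g E).
Proof. by move=> /gmove_union h; left; right. Qed.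

Lemma initial_cases m : initial_moves pi m ->
  [\/ exists g, m = restr g set0, exists g E, gmove g E /\ m = restr g E |
      exists g E, gmove g E /\ m = restr (iinv g) (g @` E)].
Proof.
case=> [[|/union_gmove]|]; [by constructor 1|by constructor 2|].
move=> [g [E [/union_gmove[g' [E' [hg' e]]] ->]]]; constructor 3.
have [[_ _ [x Ex]] _ _ _] := hg'.
rewrite (restr_dom e) (restr_isom e (x := x)) ?(restr_dom e) //.
by exists g', E'.
Qed.

Lemma near_right (t : R) (P : set R) :
  (\forall s \near t, P s) -> \forall s \near t^'+, P s.
Proof. exact: cvg_within. Qed.

Lemma near_left (t : R) (P : set R) :
  (\forall s \near t, P s) -> \forall s \near t^'-, P s.
Proof. exact: cvg_within. Qed.

(** A parameter slightly to the right of [t] is inside [c2], and the image of [x] stays inside the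
    open cell [c3]; so the right limit of the slack is the value of [gext] for these cells. *)
Lemma gext_right g c1 c2 c3 t x : cell B c1 -> cell B c2 -> cell B c3 ->
  cell_relint c1 x -> c2.1 <= t < c2.2 -> c3.1 < setpar g t x < c3.2 ->
  gcell B g c1 c2 c3 /\ \forall s \near t^'+, gslack pi g s x = gext pi g c1 c2 c3 t x
      + (s - t) * (chi g * (cell_slope pi c2 - cell_slope pi c3)).
Proof.
move=> b1 b2 b3 r1 /andP[t1 t2] t3.
have h : \forall s \near t^'+, cell_relint c2 s /\ cell_relint c3 (setpar g s x).
  near=> s; split; left; last by near: s; apply: near_right; exact: near_setpar.
  apply/andP; split; near: s; last exact: nbhs_right_lt.
  by apply: filterS (nbhs_right_gt t) => s; exact: le_lt_trans.
have hc : gcell B g c1 c2 c3.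
  have [s [r2 r3]] := @filter_ex _ _ (at_right_proper_filter t) _ h.
  by split=> //; exists x, s.
split=> //; near=> s; have [r2 r3] : cell_relint c2 s /\ cell_relint c3 (setpar g s x).
  by near: s.
by rewrite (gext_eq plB hc) // (gext_par _ _ _ _ _ t); ring.
Unshelve. all: by end_near. Qed.

Lemma gext_left g c1 c2 c3 t x : cell B c1 -> cell B c2 -> cell B c3 ->
  cell_relint c1 x -> c2.1 < t <= c2.2 -> c3.1 < setpar g t x < c3.2 ->
  gcell B g c1 c2 c3 /\ \forall s \near t^'-, gslack pi g s x = gext pi g c1 c2 c3 t x
      + (s - t) * (chi g * (cell_slope pi c2 - cell_slope pi c3)).
Proof.
move=> b1 b2 b3 r1 /andP[t1 t2] t3.
have h : \forall s \near t^'-, cell_relint c2 s /\ cell_relint c3 (setpar g s x).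
  near=> s; split; left; last by near: s; apply: near_left; exact: near_setpar.
  apply/andP; split; near: s; first exact: nbhs_left_gt.
  by apply: filterS (nbhs_left_lt t) => s h; exact: lt_le_trans t2.
have hc : gcell B g c1 c2 c3.
  have [s [r2 r3]] := @filter_ex _ _ (at_left_proper_filter t) _ h.
  by split=> //; exists x, s.
split=> //; near=> s; have [r2 r3] : cell_relint c2 s /\ cell_relint c3 (setpar g s x).
  by near: s.
by rewrite (gext_eq plB hc) // (gext_par _ _ _ _ _ t); ring.
Unshelve. all: by end_near. Qed.

(** The cell of the parameter is the one that contains it when the slack itself vanishes, and
    otherwise the cell on the side from which the limit is taken. *)
Lemma gmove_gadd g E x : gmove g E -> E x -> ~ B x -> ~ B (g x) -> gadd B pi g x.
Proof.
move=> [_ _ _ h] Ex nx ngx.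
have [c1 [b1 r1]] := cell_ex bB x; have [c3 [b3 r3]] := cell_ex bB (g x).
have i3 := cell_in_notB b3 (cell_relintW r3) ngx.
case: h => /(_ x Ex).
  move=> e; have [c2 [b2 r2]] := cell_ex bB (par g).
  have hc : gcell B g c1 c2 c3.
    by split=> //; exists x, (par g); rewrite setpar_par.
  exists c1, c2, c3; split=> //; first by split; apply: cell_relintW; rewrite ?setpar_par.
  by rewrite -(gext_eq plB hc) // setpar_par.
rewrite -(setpar_par g) in i3 r3; case=> cv.
  have [c2 [b2 i2]] := right_cell bB (par g).
  have [hc /cvg_right_affine H] := gext_right b1 b2 b3 r1 i2 i3.
  exists c1, c2, c3; split=> //; last exact/H.
  split; [exact: cell_relintW|by case/andP: i2 => ? /ltW ?; apply/andP|exact: cell_relintW].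
have [c2 [b2 i2]] := left_cell bB (par g).
have [hc /cvg_left_affine H] := gext_left b1 b2 b3 r1 i2 i3.
exists c1, c2, c3; split=> //; last exact/H.
split; [exact: cell_relintW|by case/andP: i2 => /ltW ? ?; apply/andP|exact: cell_relintW].
Qed.

(** With the parameter fixed, the points of the face form the intersection of [c1] with the preimage
    of [c3]; each end of that interval is an end of one of the two. *)
Lemma edge_interval g c1 c3 x : c1.1 < x < c1.2 -> c3.1 < g x < c3.2 ->
  exists a b, [/\ a < x < b,
    forall y, a < y < b -> c1.1 < y < c1.2 /\ c3.1 < g y < c3.2,
    forall y, a <= y <= b -> cell_in c1 y /\ cell_in c3 (g y),
    [\/ a = c1.1, g a = c3.1 | g a = c3.2] &
    [\/ b = c1.2, g b = c3.1 | g b = c3.2]].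
Proof.
case: c1 c3 => [a1 b1] [a3 b3] /andP[/= h1 h2]; rewrite /cell_in.
case: g => t /= /andP[h3 h4].
- exists (Num.max a1 (a3 - t)), (Num.min b1 (b3 - t)).
  rewrite gt_max lt_min; split.
  + by apply/andP; split; apply/andP; split; lra.
  + by move=> y; rewrite gt_max lt_min => /andP[/andP[? ?] /andP[? ?]];
      split; apply/andP; split; lra.
  + by move=> y; rewrite ge_max le_min => /andP[/andP[? ?] /andP[? ?]];
      split; apply/andP; split; lra.
  + case: (leP a1 (a3 - t)) => _; [constructor 2; ring|by constructor 1].
  + case: (leP b1 (b3 - t)) => _; [by constructor 1|constructor 3; ring].
- exists (Num.max a1 (t - b3)), (Num.min b1 (t - a3)).
  rewrite gt_max lt_min; split.
  + by apply/andP; split; apply/andP; split; lra.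
  + by move=> y; rewrite gt_max lt_min => /andP[/andP[? ?] /andP[? ?]];
      split; apply/andP; split; lra.
  + by move=> y; rewrite ge_max le_min => /andP[/andP[? ?] /andP[? ?]];
      split; apply/andP; split; lra.
  + case: (leP a1 (t - b3)) => _; [constructor 3; ring|by constructor 1].
  + case: (leP b1 (t - a3)) => _; [by constructor 1|constructor 2; ring].
Qed.

(* The slack is affine and nonnegative along the edge through [x] and vanishes at
   this interior point of the edge, hence on the whole closed edge. *)
Lemma gadd_edge g c1 c2 c3 x : gcell B g c1 c2 c3 ->
  gcell_in g c1 c2 c3 (par g) x -> gext pi g c1 c2 c3 (par g) x = 0 ->
  ~ B x -> ~ B (g x) ->
  exists a b, [/\ a < x < b,
    forall y, a < y < b -> c1.1 < y < c1.2 /\ c3.1 < g y < c3.2,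
    forall y, a <= y <= b -> gcell_in g c1 c2 c3 (par g) y /\
                             gext pi g c1 c2 c3 (par g) y = 0,
    B a \/ B (g a) & B b \/ B (g b)].
Proof.
move=> hc [i1 i2 i3] e nx ngx; have [b1 b2 b3 _] := hc.
rewrite setpar_par in i3.
have [a [b [axb h1 h2 ha hb]]] :=
  edge_interval (cell_in_notB b1 i1 nx) (cell_in_notB b3 i3 ngx).
have hin y : a <= y <= b -> gcell_in g c1 c2 c3 (par g) y.
  by move=> /h2[? ?]; split=> //; rewrite setpar_par.
have [ax xb] := andP axb.
have b0 : cell_slope pi c1 - cell_slope pi c3 = 0.
  have aab : a <= a <= b by rewrite lexx (ltW (lt_trans ax xb)).
  have abb : a <= b <= b by rewrite lexx (ltW (lt_trans ax xb)).
  have := gext_ge0 plB spi hc (hin a aab); have := gext_ge0 plB spi hc (hin b abb).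
  rewrite (gext_shiftx _ _ _ _ _ _ x) e add0r pmulr_rge0 ?subr_gt0 // => p1.
  rewrite (gext_shiftx _ _ _ _ _ _ x) e add0r nmulr_rge0 ?subr_lt0 // => p2.
  by apply/eqP; rewrite eq_le p1 p2.
exists a, b; split=> //.
- by move=> y /[dup] /hin hy _; rewrite (gext_shiftx _ _ _ _ _ _ x) e b0 mulr0 addr0.
- have [? ?] := cell_endpoints b1; have [? ?] := cell_endpoints b3.
  by case: ha => ->; [left|right|right].
- have [? ?] := cell_endpoints b1; have [? ?] := cell_endpoints b3.
  by case: hb => ->; [left|right|right].
Qed.

Lemma cell_sub01 c x : cell B c -> c.1 < x < c.2 -> 0 < x < 1 -> 0 <= c.1 /\ c.2 <= 1.
Proof.
move=> Bc /andP[h1 h2] /andP[x0 x1]; split; rewrite leNgt; apply/negP => h.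
  by apply: (cell_notB Bc (_ : c.1 < 0 < c.2)); [rewrite h (lt_trans x0)|exact: (breakpoints_int bB 0)].
by apply: (cell_notB Bc (_ : c.1 < 1 < c.2)); [rewrite h (lt_trans h1)|exact: (breakpoints_int bB 1)].
Qed.

(** If the parameter is not relatively interior to [c2], it is an end of a nondegenerate [c2], and
    the slack vanishes in the limit from the side where [c2] lies. *)
Lemma gcell_side g c1 c2 c3 x : gcell B g c1 c2 c3 -> cell_in c2 (par g) ->
  c1.1 < x < c1.2 -> c3.1 < g x < c3.2 -> gext pi g c1 c2 c3 (par g) x = 0 ->
  [\/ cell_relint c2 (par g) /\ gslack pi g (par g) x = 0,
      c2.1 <= par g < c2.2 /\ gslack pi g s x @[s --> (par g)^'+] --> (0 : R) |
      c2.1 < par g <= c2.2 /\ gslack pi g s x @[s --> (par g)^'-] --> (0 : R)].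
Proof.
move=> hc i2 h1 h3 e; have [b1 b2 b3 _] := hc.
have r1 : cell_relint c1 x by left.
have r3 : cell_relint c3 (setpar g (par g) x) by left; rewrite setpar_par.
have h3' : c3.1 < setpar g (par g) x < c3.2 by rewrite setpar_par.
have [r2|nr2] := pselect (cell_relint c2 (par g)).
  by constructor 1; split=> //; rewrite (gext_eq plB hc).
have n12 : c2.1 < c2.2.
  rewrite lt_neqAle (cell_le b2) andbT; apply/eqP => e12; apply: nr2; right.
  by move: i2; rewrite /cell_in -e12 andbC -eq_le => /eqP.
case: (cell_in_cases i2) => h; last by case: nr2; left.
  constructor 2; have i : c2.1 <= par g < c2.2 by rewrite h lexx n12.
  by split=> //; have [_ /cvg_right_affine ->] := gext_right b1 b2 b3 r1 i h3'.
constructor 3; have i : c2.1 < par g <= c2.2 by rewrite h lexx n12.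
by split=> //; have [_ /cvg_left_affine ->] := gext_left b1 b2 b3 r1 i h3'.
Qed.

(** The side of the limit depends only on where the parameter sits in [c2], so all points of the
    edge satisfy the same defining condition. Since 0 and 1 are breakpoints, the open cells lie in
    the unit interval, where [pi] is continuous off [B]. *)
Lemma edge_gmove g c1 c2 c3 a b x : gcell B g c1 c2 c3 -> cell_in c2 (par g) ->
  0 < x < 1 -> 0 < g x < 1 -> a < x < b ->
  (forall y, a < y < b -> [/\ c1.1 < y < c1.2, c3.1 < g y < c3.2 &
                             gext pi g c1 c2 c3 (par g) y = 0]) ->
  gmove g `]a, b[%classic.
Proof.
move=> hc i2 x01 gx01 axb H; have [b1 b2 b3 _] := hc.
have [h1 h3 _] := H _ axb.
have [c10 c11] := cell_sub01 b1 h1 x01; have [c30 c31] := cell_sub01 b3 h3 gx01.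
split.
- by apply: open_itv_oo; case/andP: axb; exact: lt_trans.
- move=> y; rewrite /= in_itv /= => /H[k1 _ _].
  apply: notB_contA; last exact: (cell_notB b1 k1).
  by case/andP: k1 => k1 k2; rewrite (le_lt_trans c10 k1) (lt_le_trans k2 c11).
- move=> _ [y + <-]; rewrite /= in_itv /= => /H[_ k1 _].
  apply: notB_contA; last exact: (cell_notB b3 k1).
  by case/andP: k1 => k1 k2; rewrite (le_lt_trans c30 k1) (lt_le_trans k2 c31).
have [r2|nr2] := pselect (cell_relint c2 (par g)).
  left=> y; rewrite /= in_itv /= => /H[k1 k2 e].
  by rewrite (gext_eq plB hc) ?setpar_par //; left.
right=> y; rewrite /= in_itv /= => /H[k1 k2 e].
by case: (gcell_side hc i2 k1 k2 e) => -[// _ h]; [left|right].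
Qed.

(* In the difference of the slacks at [x] and [y] the value of [pt] at the moving
   parameter cancels, so the difference is continuous where [pt] itself may jump. *)
Lemma edge_respect (K : R) pt g c1 c2 c3 x y : gcell B g c1 c2 c3 ->
  (forall u v, `|slack pt u v| <= K * slack pi u v) ->
  (forall z, ~ B z -> pt w @[w --> z] --> pt z) ->
  cell_in c2 (par g) ->
  [/\ c1.1 < x < c1.2, c3.1 < g x < c3.2 & gext pi g c1 c2 c3 (par g) x = 0] ->
  [/\ c1.1 < y < c1.2, c3.1 < g y < c3.2 & gext pi g c1 c2 c3 (par g) y = 0] ->
  pt (g x) - chi g * pt x = pt (g y) - chi g * pt y.
Proof.
move=> hc hK ct i2 [x1 x3 ex] [y1 y3 ey]; have [b1 b2 b3 _] := hc.
suff : chi g * (gslack pt g (par g) x - gslack pt g (par g) y) = 0.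
  rewrite /gslack setpar_par; have := chi_sqr g => h h'.
  have := congr1 (fun u => - u) h'; rewrite oppr0.
  have -> : - (chi g * (pt x + chi g * (pt (par g) - pt (g x)) -
       (pt y + chi g * (pt (par g) - pt (g y)))))
    = chi g * chi g * (pt (g x) - pt (g y)) - chi g * pt x + chi g * pt y by ring.
  by rewrite h; lra.
apply/eqP; rewrite mulf_eq0; apply/orP; right; apply/eqP.
pose F s := gslack pt g s x - gslack pt g s y.
have cF : F s @[s --> par g] --> F (par g).
  have -> : F = fun s => (pt x - pt y) - chi g * (pt (setpar g s x) - pt (setpar g s y)).
    by apply/funext => s; rewrite /F /gslack; ring.
  apply: cvgB; first exact: cvg_cst.
  apply: cvgMl_tmp; apply: cvgB.
    apply: cvg_comp (@cvg_setpar g x (par g)) _.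
    by apply: ct; rewrite setpar_par; exact: (cell_notB b3 x3).
  apply: cvg_comp (@cvg_setpar g y (par g)) _.
  by apply: ct; rewrite setpar_par; exact: (cell_notB b3 y3).
have sq z (G : set_system R) : Filter G -> gslack pi g s z @[s --> G] --> (0 : R) ->
    gslack pt g s z @[s --> G] --> (0 : R).
  move=> fG cz.
  apply: (@squeeze_cvgr _ _ _ _ (fun s => - (K * gslack pi g s z))
    (fun s => K * gslack pi g s z)).
  - near=> s; have := gslack_le g s z hK.
    by rewrite ler_norml.
  - by rewrite -[X in _ --> X]oppr0; apply: cvgN; rewrite -[X in _ --> X](mulr0 K); apply: cvgMl_tmp.
  - by rewrite -[X in _ --> X](mulr0 K); apply: cvgMl_tmp.
(* [F] is continuous at the parameter, while along the side on which both slacks of [pi] vanish the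
   squeezed slacks of [pt] tend to 0; uniqueness of limits gives [F (par g) = 0]. *)
have F0 (G : set_system R) : ProperFilter G -> G `=>` nbhs (par g) ->
    gslack pi g s x @[s --> G] --> (0 : R) -> gslack pi g s y @[s --> G] --> (0 : R) ->
    F (par g) = 0.
  move=> pG sG cx cy; apply: (@cvg_unique _ _ (F s @[s --> G])) => //.
    by apply: cvg_trans cF => A /= /sG.
  have := cvgB (sq x G _ cx) (sq y G _ cy); rewrite subr0; exact.
have gy3 : c3.1 < setpar g (par g) y < c3.2 by rewrite setpar_par.
have ry : cell_relint c1 y by left.
case: (gcell_side hc i2 x1 x3 ex) => -[h cx].
- have cy : gslack pi g (par g) y = 0 by rewrite (gext_eq plB hc) //; left.
  have z0 z : gslack pi g (par g) z = 0 -> gslack pt g (par g) z = 0.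
    by move=> e0; apply/eqP; rewrite -normr_le0 (le_trans (gslack_le _ _ _ hK)) // e0 mulr0.
  by rewrite !z0 ?subr0.
- have [_ /cvg_right_affine cy] := gext_right b1 b2 b3 ry h gy3.
  by apply: (F0 ((par g)^'+)) => //; [exact: cvg_within|exact/cy].
- have [_ /cvg_left_affine cy] := gext_left b1 b2 b3 ry h gy3.
  by apply: (F0 ((par g)^'-)) => //; [exact: cvg_within|exact/cy].
Unshelve. all: by end_near. Qed.

End InitialEdges.

(** * Closed move semigroups *)

Section ClosedSemigroups.
Variable R : realType.
Implicit Types (g : isom R) (D E I J A : set R) (x y s : R) (G Om : set (move R)).

(** Each closure axiom passes to intersections. That the result consists of moves needs one closed
    semigroup [G] to intersect with, since an empty intersection would contain everything. *)
Lemma clsemi_closed A Om G : closed_semigroup A G -> Om `<=` G ->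
  closed_semigroup A (clsemi A Om).
Proof.
move=> hG OmG; split.
- by move=> m /(_ G (conj hG OmG)) /(cs_ensemble hG).
- by move=> g1 D1 g2 D2 h1 h2 M HM; apply: (cs_comp HM.1); [exact: h1|exact: h2].
- by move=> g D h M HM; apply: (cs_inv HM.1); exact: h.
- by move=> g D D' h sD oD M HM; apply: (cs_restrict HM.1 _ sD oD); exact: h.
- by move=> g F h oF M HM; apply: (cs_continuation HM.1) => // I FI; exact: h.
- by move=> g F D h oD sD M HM; apply: (cs_extend HM.1 _ oD sD) => I FI; exact: h.
- by move=> gs g D oD h c p M HM; apply: (cs_lim HM.1 oD _ c p) => i; exact: h.
- move=> D I oD oI; split=> h m hm M HM.
    by apply: ((cs_kaleido HM.1 oD oI).1 _ _ hm) => m' /h; apply.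
  by apply: ((cs_kaleido HM.1 oD oI).2 _ _ hm) => m' /h; apply.
Qed.

Lemma local_move g D I x : open D -> open I -> D x -> I (g x) ->
  exists2 e, 0 < e & forall s, `|s - par g| < e -> exists E,
    [/\ open_itv E, E x, E `<=` D & setpar g s @` E `<=` I].
Proof.
move=> /open_ballP oD /open_ballP oI /oD[d d0 hd] /oI[i i0 hi].
(* Half of the room around [g x] is for the change of parameter, half for the change of point. *)
exists (i / 2); first by rewrite divr_gt0.
move=> s hs; exists [set y | `|y - x| < Num.min d (i / 2)].
have m0 : 0 < Num.min d (i / 2) by rewrite lt_min d0 divr_gt0.
split; first exact: open_itv_ball.
- by rewrite /= subrr normr0.
- by move=> y /=; rewrite lt_min => /andP[/hd].
- move=> _ [y /= + <-]; rewrite lt_min => /andP[_ hy]; apply: hi.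
  rewrite -(subrKA (setpar g s x)) (le_lt_trans (ler_normD _ _)) //.
  by rewrite isom_dist -[in g x](setpar_par g) setpar_dist; lra.
Qed.

Definition moves_type g (O : set (R * R)) :=
  match g with Transl _ => moves_plus O | Refl _ => moves_minus O end.

Lemma moves_typeI g O E : open_itv0 E -> mgraph (restr g E) `<=` O ->
  moves_type g O (restr g E).
Proof. by case: g => t oE h; exists t, E. Qed.

Lemma moves_type_setpar g s O : moves_type (setpar g s) O = moves_type g O.
Proof. by case: g. Qed.

Lemma local_moves_type g D I x : open D -> open I -> D x -> I (g x) ->
  exists2 e, 0 < e & forall s, `|s - par g| < e -> exists2 E,
    moves_type g (D `*` I) (restr (setpar g s) E) & E x.
Proof.
move=> oD oI Dx Igx; have [e e0 he] := local_move oD oI Dx Igx.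
exists e => // s /he[E [oE Ex ED EI]]; exists E => //.
rewrite -(moves_type_setpar g s); apply: moves_typeI; first by left.
by move=> [u v] /= [Eu ->]; split=> /=; [exact: ED|apply: EI; exists u].
Qed.

(** An explicit closed semigroup containing the initial moves: it shows that the closure is one and
    confines its domains and images to [A]. *)
Definition moves_in A : set (move R) :=
  [set m | exists g E, [/\ open_itv0 E, m = restr g E, E `<=` A & g @` E `<=` A]].

Lemma moves_inP A g E :
  moves_in A (restr g E) <-> [/\ open_itv0 E, E `<=` A & g @` E `<=` A].
Proof.
split=> [[g' [E' [oE' e sE' gE']]]|[oE sE gE]]; last by exists g, E.
rewrite (restr_dom e); split=> // _ [x Ex <-]; apply: gE'; exists x => //.
by rewrite (restr_isom e (x := x)) // (restr_dom e).
Qed.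

Lemma moves_in_type A g D I : open_itv D -> open_itv I ->
  moves_type g (D `*` I) `<=` moves_in A -> D `<=` A /\ I `<=` A.
Proof.
move=> [oD _ [x0 Dx0]] [oI _ [y0 Iy0]] h.
have H x y : D x -> I y -> A x /\ A y.
  move=> Dx Iy; have [g' g'E gx] : exists2 g' : isom R, g' x = y & exists s, g' = setpar g s.
    case: g {h} => t; first by exists (Transl (y - x)); [rewrite /= addrC subrK|exists (y - x)].
    by exists (Refl (x + y)); [rewrite /= addrC addKr|exists (x + y)].
  have Igx : I (g' x) by rewrite g'E.
  have [e e0 /(_ (par g'))] := local_moves_type oD oI Dx Igx.
  rewrite subrr normr0 => /(_ e0)[E + Ex].
  case: gx => s e'; rewrite setpar_par {1}e' moves_type_setpar => /h/moves_inP[_ sE gE].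
  by split; [exact: sE|rewrite -g'E; apply: gE; exists x].
by split=> [x Dx|y Iy]; [exact: (H x y0 Dx Iy0).1|exact: (H x0 y Dx0 Iy).2].
Qed.

Lemma closed_moves_in A : closed_semigroup A (moves_in A).
Proof.
split.
- by move=> m [g [E [hE eqm sE gE]]]; exists g, E.
- move=> g1 D1 g2 D2 /moves_inP [v1 s1 i1] /moves_inP [v2 s2 i2]; apply/moves_inP; split.
  + by apply: open_itv0I => //; exact: open_itv0_preimage.
  + by move=> x [/s1].
  + by move=> _ [x [_ D2x] <-]; rewrite icompE; apply: i2; exists (g1 x).
- move=> g D /moves_inP[oD sD gD]; apply/moves_inP; split=> //; first exact: open_itv0_image.
  by move=> _ [_ [x Dx <-] <-]; rewrite iinvK; exact: sD.
- move=> g D D' /moves_inP[oD sD gD] sub oD'; apply/moves_inP; split=> //.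
    exact: subset_trans sD.
  by apply: subset_trans gD; exact: image_subset.
- move=> g F h oF; apply/moves_inP; split; first by left.
    by move=> x [I FI Ix]; have /moves_inP[_ + _] := h _ FI; apply.
  by move=> _ [x [I FI Ix] <-]; have /moves_inP[_ _] := h _ FI; apply; exists x.
- move=> g F D h oD sD; apply/moves_inP; split=> //.
    by move=> x /sD[[]].
  by move=> _ [x /sD[_ Agx] <-].
- move=> gs g D oD h hc hp; apply/moves_inP; split; first by left.
    by have /moves_inP[] := h 0%N.
  move=> _ [x Dx <-]; have [/open_ballP oD' _ _] := oD.
  have [e e0 he] := oD' _ Dx.
  have /cvgrPdist_lt/(_ _ e0) hp' := hp.
  (* One index with the right character and a parameter within [e] suffices: the preimage of [g x]
     under [gs i] is within [e] of [x], hence in [D]. *)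
  have [i [ci di]] : exists i, chi (gs i) = chi g /\ `|par g - par (gs i)| < e.
    by apply: (@filter_ex _ _ eventually_filter); near=> i; split; near: i.
  have /moves_inP[_ _] := h i; apply.
  exists (iinv (gs i) (g x)); last by rewrite iinvKV.
  apply: he; rewrite -(isom_dist (gs i)) iinvKV.
  suff -> : `|g x - gs i x| = `|par g - par (gs i)| by [].
  move: ci; case: (g) (gs i) => t [] u /= ci; try (exfalso; lra); congr `|_|; ring.
- move=> D I oD oI; split=> h m.
    have [sD sI] := @moves_in_type A (Transl 0) _ _ oD oI h.
    move=> [t [E [oE -> sO]]]; apply/moves_inP; split=> //.
      by move=> x Ex; have [/= /sD] := sO (x, Refl t x) (conj Ex erefl).
    by move=> _ [x Ex <-]; have [/= _ /sI] := sO (x, Refl t x) (conj Ex erefl).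
  have [sD sI] := @moves_in_type A (Refl 0) _ _ oD oI h.
  move=> [t [E [oE -> sO]]]; apply/moves_inP; split=> //.
    by move=> x Ex; have [/= /sD] := sO (x, Transl t x) (conj Ex erefl).
  by move=> _ [x Ex <-]; have [/= _ /sI] := sO (x, Transl t x) (conj Ex erefl).
Unshelve. all: by end_near. Qed.

Lemma maximal_itv_eq (S I J : set R) x :
  maximal_itv S I -> maximal_itv S J -> I x -> J x -> I = J.
Proof.
move=> [oI sI mI] [oJ sJ mJ] Ix Jx.
have oU := open_itvU oI oJ Ix Jx.
have sU : I `|` J `<=` S by move=> y [/sI|/sJ].
by rewrite -(mI _ oU sU (@subsetUl _ _ _)); apply: mJ => //; exact: subsetUr.
Qed.

(** A positive change of parameter smaller than every positive parameter difference occurring in [S]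
    leads outside [S]. *)
Lemma isom_finite_near (S : set (isom R)) g e : finite_set S -> 0 < e ->
  ~ forall s, `|s - par g| < e -> S (setpar g s).
Proof.
move=> fS e0 h.
have [c c0 hc] := finite_pos_lb (finite_image (fun g' => par g' - par g) fS).
have m0 : 0 < Num.min c e / 2 by rewrite divr_gt0 // lt_min c0 e0.
have [mc me] : Num.min c e <= c /\ Num.min c e <= e by rewrite !ge_min !lexx orbT.
have Ss : S (setpar g (par g + Num.min c e / 2)).
  by apply: h; rewrite addrAC subrr add0r gtr0_norm //; lra.
have := hc (Num.min c e / 2); rewrite m0 => H.
have /H : exists2 g', S g' & par g' - par g = Num.min c e / 2.
  exists (setpar g (par g + Num.min c e / 2)) => //.
  by case: (g) => t /=; ring.
by move=> /(_ isT); lra.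
Qed.

(** Finitely many parameters stay at a positive distance from the limit unless they equal it, so
    convergence forces equality at some index. *)
Lemma isom_finite_lim (S : set (isom R)) (gs : nat -> isom R) g : finite_set S ->
  (forall i, S (gs i)) -> (\forall i \near \oo, chi (gs i) = chi g) ->
  par (gs i) @[i --> \oo] --> par g -> exists i, gs i = g.
Proof.
move=> fS hS hc hp.
have [c c0 hcl] := finite_pos_lb (finite_image (fun g' => `|par g - par g'|) fS).
have /cvgrPdist_lt/(_ _ c0) hp' := hp.
have [i [ci di]] : exists i, chi (gs i) = chi g /\ `|par g - par (gs i)| < c.
  by apply: (@filter_ex _ _ eventually_filter); near=> i; split; near: i.
exists i; have := hcl `|par g - par (gs i)|; move=> /(_ _)/(_ _) H.
have : `|par g - par (gs i)| = 0.
  apply/eqP; rewrite eq_le normr_ge0 andbT leNgt; apply/negP => p0.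
  by move: di; rewrite ltNge => /negP; apply; apply: H => //; exists (gs i).
move=> /eqP; rewrite normr_eq0 subr_eq0 => /eqP e.
by move: ci e; case: (g) (gs i) => t [] u /= ci e; rewrite ?e //; exfalso; lra.
Unshelve. all: by end_near. Qed.

Lemma itv_subset_oo J a b x : is_interval J -> J x -> a < x < b -> ~ J a -> ~ J b ->
  J `<=` `]a, b[%classic.
Proof.
move=> iJ Jx /andP[ax xb] na nb y Jy; rewrite /= in_itv /=.
apply/andP; split; rewrite ltNge; apply/negP => h.
  by apply: na; apply: (iJ y x) => //; rewrite h ltW.
by apply: nb; apply: (iJ x y) => //; rewrite h ltW.
Qed.

End ClosedSemigroups.

(** * The moves closure on the uncovered set *)

Lemma finite_subsingleton (T : Type) (S : set T) :
  (forall a b, S a -> S b -> a = b) -> finite_set S.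
Proof.
move=> h; have [[a Sa]|nS] := pselect (exists a, S a).
  by apply: sub_finite_set (finite_set1 a) => b Sb; apply: h.
by apply: sub_finite_set (finite_set0 T) => b Sb; case: nS; exists b.
Qed.

Section FinitePresentation.
Variable R : realType.
Implicit Types (g : isom R) (D E J : set R) (x y z s : R).
Variables (B : set R) (pi : R -> R) (Om : set (move R)) (k : nat) (C : 'I_k -> set R).
Hypotheses (bB : breakpoints B) (plB : piecewise_linear B pi).
Hypotheses (ppi : periodic pi 1) (pi0 : pi 0 = 0).
Hypothesis (spi : forall x y, 0 <= slack pi x y).
Let G := clsemi (contA pi) (initial_moves pi).
Hypothesis fp : finite_presentation G Om C.
Hypothesis rf : reduced_form G Om C.

Let U := uncovered C.
Let U' := uncovered' pi B Om C.
Let V := Vset pi B.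

(** * Locality and finiteness of the closure at uncovered points *)

Lemma initial_moves_in : initial_moves pi `<=` moves_in (contA pi).
Proof.
move=> m /initial_cases[[g ->]|[g [E [[oE sE gE _] ->]]]|[g [E [[oE sE gE _] ->]]]].
- by apply/moves_inP; split; [right|exact: sub0set|rewrite image_set0; exact: sub0set].
- by apply/moves_inP; split=> //; left.
- apply/moves_inP; split=> //; first by left; exact: open_itv_image.
  by move=> _ [_ [x Ex <-] <-]; rewrite iinvK; exact: sE.
Qed.

Lemma closed_clsemi : closed_semigroup (contA pi) G.
Proof. exact: clsemi_closed (closed_moves_in _) initial_moves_in. Qed.

Lemma clsemi_in : G `<=` moves_in (contA pi).
Proof. by apply: smallest_sub; [exact: closed_moves_in|exact: initial_moves_in]. Qed.

Lemma clsemi_initial : initial_moves pi `<=` G.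
Proof. exact: sub_gen_smallest. Qed.

Lemma clsemi_Om : Om `<=` G.
Proof. by move=> m /rf[[]]. Qed.

(** Pointwise membership in the closure; composition and inversion then become groupoid laws,
    without keeping track of domains. *)
Definition germ g x := exists2 E, G (restr g E) & E x.

Lemma germ_comp g1 g2 x : germ g1 x -> germ g2 (g1 x) -> germ (icomp g2 g1) x.
Proof.
move=> [E1 h1 x1] [E2 h2 x2]; exists (E1 `&` g1 @^-1` E2) => //.
exact: (cs_comp closed_clsemi).
Qed.

Lemma germ_inv g x : germ g x -> germ (iinv g) (g x).
Proof.
move=> [E h Ex]; exists (g @` E); last by exists x.
exact: (cs_inv closed_clsemi).
Qed.

Lemma germ_open g x : germ g x -> exists2 E, G (restr g E) & [/\ E x, open E & is_interval E].
Proof.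
move=> [E h Ex]; exists E => //.
by have /clsemi_in/moves_inP[/open_itv0_oi[]] := h.
Qed.

Lemma germ_contA g x : germ g x -> contA pi x /\ contA pi (g x).
Proof.
move=> [E /clsemi_in/moves_inP[_ sE gE] Ex].
by split; [exact: sE|apply: gE; exists x].
Qed.

Lemma germ01 g x : germ g x -> 0 < x < 1 /\ 0 < g x < 1.
Proof.
by move=> /germ_contA[/contA_sub01 + /contA_sub01]; rewrite /= !in_itv.
Qed.

Lemma open_C i : open (C i).
Proof.
have [F [_ sF _ ->]] := fp_itvs fp i.
by apply: bigcup_open => I /sF[].
Qed.

(** The property [P] concerns single points of a graph, so restriction and continuation preserve it
    and it holds on the whole join. *)
Lemma join_local g E x : G (restr g E) -> E x ->
  (exists2 D, Om (restr g D) & D x) \/ (exists i, C i x /\ C i (g x)).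
Proof.
pose P : set (move R) := [set m | is_move m /\ forall q, mgraph m q ->
  (exists g' D, [/\ chi g' = mchi m, Om (restr g' D), D q.1 & q.2 = g' q.1]) \/
  (exists i, C i q.1 /\ C i q.2)].
have GP : G `<=` P.
  rewrite (fp_join fp); apply: smallest_sub; first split.
  - by move=> m [].
  - move=> g' D D' [_ h] sD oD'; split; first by exists g', D'.
    by move=> q [/= D'q e]; apply: h; split=> //; exact: sD.
  - move=> g' F h oF; split; first by exists g', (\bigcup_(I in F) I); split=> //; left.
    by move=> q [/= [I FI Iq] e]; have [_] := h _ FI; apply; split.
  move=> m [Omm|[i _ Cm]].
    split; first exact: (fp_ensemble fp).
    have [g' [D [_ e]]] := fp_ensemble fp Omm.
    move=> q; rewrite e => -[/= Dq eq]; left; exists g', D; split=> //.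
    by rewrite -e.
  case: Cm => -[t [D [oD -> sO]]]; (split; first by [exists (Transl t), D|exists (Refl t), D]);
    by move=> q /sO[]; right; exists i.
move=> /GP[_ h] Ex; have [|[g' [D [ce hD Dx gx]]]|] := h (x, g x); [by []| |by right].
left; exists D => //; have <- // : g' = g by apply: (isom_eq (x := x)).
Qed.

Lemma uncovered_notin x i : U x -> ~ C i x.
Proof. by move=> [_ nc] Cx; apply/nc/subset_closure; exists i. Qed.

Lemma germ_Om g x : U x -> germ g x -> exists2 D, Om (restr g D) & D x.
Proof.
move=> Ux [E h Ex]; have [//|[i [Cx _]]] := join_local h Ex.
by have := uncovered_notin Ux Cx.
Qed.

Lemma Om_germ g D x : Om (restr g D) -> D x -> germ g x.
Proof. by move=> /clsemi_Om h Dx; exists D. Qed.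

(** At an uncovered point a germ comes from a listed move, and each listed move determines at most
    one isometry at a point of its domain. *)
Lemma finite_germs x : U x -> finite_set [set g | germ g x].
Proof.
move=> Ux; pose F m := [set g | exists2 D, m = restr g D & D x].
apply: (@sub_finite_set _ _ (\bigcup_(m in Om) F m)).
  by move=> g /(germ_Om Ux)[D hD Dx]; exists (restr g D) => //; exists D.
apply: bigcup_finite; first exact: fp_finite fp.
move=> m _; apply: finite_subsingleton => g g' [D -> Dx] [D' e _].
exact: restr_isom e Dx.
Qed.

Lemma uncovered_no_near g x e : U x -> 0 < e ->
  ~ forall s, `|s - par g| < e -> germ (setpar g s) x.
Proof. by move=> Ux; apply: (isom_finite_near (finite_germs Ux)). Qed.

Lemma germ_moves_list i g x : C i x -> C i (g x) -> germ g x.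
Proof.
move=> Cx Cgx; have [e e0 /(_ (par g))] := local_moves_type (@open_C i) (@open_C i) Cx Cgx.
rewrite subrr normr0 setpar_par => /(_ e0)[E hE Ex]; exists E => //.
rewrite (fp_join fp) => M [_ sM]; apply: sM; right; exists i => //.
by case: g hE {Cgx} => t hE; [left|right].
Qed.

(** The identity on [C i] belongs to the closure, all of whose domains lie in the unit interval. *)
Lemma C_sub01 i : C i `<=` `]0, 1[%classic.
Proof.
move=> x Cx; have : germ (Transl 0) x by apply: (@germ_moves_list i) => //=; rewrite addr0.
by move=> /germ01[]; rewrite /= in_itv.
Qed.

Lemma closure_covered01 : closure (covered C) `<=` `[0, 1]%classic.
Proof.
have sub : covered C `<=` `]0, 1[%classic by move=> x [i _]; exact: C_sub01.
by move=> x /(closureS sub)/itv_closure.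
Qed.

Lemma open_U : open U.
Proof.
apply: openI; first exact: interval_open.
by rewrite openC; exact: closed_closure.
Qed.

(** If [g x] were in the closure of the covered set, some uncovered point near [x] would be sent
    into a [C i]. Conjugating by [g] the small translations available in [C i] would give that point
    infinitely many germs. *)
Lemma germ_U g x : germ g x -> U x -> U (g x).
Proof.
move=> hg Ux; have [_ gx01] := germ01 hg; split; first by rewrite /= in_itv.
move=> clgx; have [E hE [Ex oE _]] := germ_open hg.
have /open_ballP/(_ x (conj Ex Ux)) [e e0 he] : open (E `&` U) by apply: openI => //; exact: open_U.
have [y [i _ Cy] yx] := (closure_ballP _ _).1 clgx _ e0.
have [Ex' Ux'] : (E `&` U) (iinv g y) by apply: he; rewrite -(isom_dist g) iinvKV.
have gx' : germ g (iinv g y) by exists E.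
have Cgx : C i (g (iinv g y)) by rewrite iinvKV.
have /open_ballP/(_ _ Cy) [d d0 hd] := @open_C i.
have /open_ballP/(_ _ Ex') [d' d'0 hd'] := oE.
have m0 : 0 < Num.min d d' by rewrite lt_min d0.
apply: (@uncovered_no_near (Transl 0) (iinv g y) _ Ux' m0) => s /=.
rewrite subr0 lt_min => /andP[sd sd'].
have Es : E (iinv g y + s) by apply: hd'; rewrite addrAC subrr add0r.
(* A reflection reverses the direction of the translation, hence the factor [chi g]. *)
have gs : g (iinv g y + s) = y + chi g * s.
  by rewrite -[in RHS](iinvKV g y); case: (g) => t /=; ring.
have h : germ (Transl (chi g * s)) (g (iinv g y)).
  rewrite iinvKV; apply: (@germ_moves_list i) => //; apply: hd => /=.
  rewrite addrAC subrr add0r normrM; case: (g) => _ /=; first by rewrite normr1 mul1r.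
  by rewrite normrN1 mul1r.
have h2 : germ (iinv g) (icomp (Transl (chi g * s)) g (iinv g y)).
  by rewrite icompE iinvKV /= -gs; apply: germ_inv; exists E.
suff -> : Transl s = icomp (iinv g) (icomp (Transl (chi g * s)) g).
  exact: germ_comp (germ_comp gx' h) h2.
by case: (g) => t /=; congr Transl; ring.
Qed.

(** * Additive vertices and invariance of [U'] *)

Lemma Vset01 x : V x -> 0 <= x <= 1.
Proof. by move=> [_]; rewrite /= in_itv. Qed.

Lemma gadd_V g x z : gadd B pi g x -> B (par g) -> B x \/ B (g x) ->
  z = x \/ z = g x -> 0 <= z <= 1 -> V z.
Proof.
case: g => t /= h Bt Bx zE z01.
  split; last by rewrite /= in_itv.
  exists (x, t) => /=.
    apply: gadd_vertex => //; case: Bx; tauto.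
  by case: zE => ->; [constructor 1|constructor 3].
split; last by rewrite /= in_itv.
exists (x, t - x) => /=.
  apply: (gadd_vertex plB (gadd_refl h)).
  rewrite (_ : x + (t - x) = t); last by ring.
  case: Bx; tauto.
by case: zE => ->; [constructor 1|constructor 2].
Qed.

(** Since [pi 0 = 0], the slack at [(x, 0)] is 0, and both coordinates are breakpoints. *)
Lemma B_V x : B x -> 0 <= x <= 1 -> V x.
Proof.
move=> Bx x01; apply: (@gadd_V (Transl 0) x) => //; last 1 first.
- by left.
- by apply: gadd_slack0 => //; rewrite /slack addr0 pi0 addr0 subrr.
- exact: (breakpoints_int bB 0).
- by left.
Qed.

Lemma Xset01 x : Xset C x -> 0 <= x <= 1.
Proof.
case=> [[->|[/closure_covered01 + _]]|->]; rewrite ?lexx ?ler01 //.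
Qed.

Lemma Yset01 x : Yset pi B Om C x -> 0 < x < 1.
Proof.
case=> [[_ []]|[g [D [z [hg _ Dz ->]]]]]; first by rewrite /= in_itv.
by have [] := germ01 (Om_germ hg Dz).
Qed.

Lemma refined01 z : 0 < z < 1 -> refined_breakpoints pi B Om C z ->
  (Xset C `|` Yset pi B Om C `|` Zset Om C) z.
Proof.
move=> /andP[z0 z1] [w hw [l e]].
have /andP[w0 w1] : 0 <= w <= 1.
  case: hw => [[/Xset01//|/Yset01/andP[a b]]|[[+ _] _]]; first by rewrite !ltW.
  by rewrite /= in_itv /= => /andP[a b]; rewrite !ltW.
have l1 : (-1 < l)%R by rewrite -(ltr_int R) intrN; lra.
have l2 : (l < 1)%R by rewrite -(ltr_int R); lra.
have l0 : l = 0 by move: l1 l2; lia.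
by rewrite e l0 addr0.
Qed.

Lemma U_sub01 x : U x -> 0 < x < 1.
Proof. by move=> [+ _]; rewrite /= in_itv. Qed.

Lemma U'P x : U' x <-> [/\ U x, ~ Yset pi B Om C x & ~ Zset Om C x].
Proof.
split=> [[Ux nb]|[Ux nY nZ]].
  by split=> // h; apply: nb; exists x; [left; right|exists 0; rewrite addr0|right|exists 0; rewrite addr0].
split=> // /(refined01 (U_sub01 Ux)) [[|//]|//].
have [x0 x1] := andP (U_sub01 Ux).
case=> [[e|[h _]]|e]; [by move: x0; rewrite e ltxx|by case: Ux|by move: x1; rewrite e ltxx].
Qed.

Lemma U'_U x : U' x -> U x. Proof. by case. Qed.

Lemma U'_notV x : U' x -> ~ V x.
Proof. by move=> /U'P[Ux nY _] Vx; apply: nY; left. Qed.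

Lemma U'_notB x : U' x -> ~ B x.
Proof.
move=> hx Bx; apply: (U'_notV hx); apply: B_V => //.
by have /andP[a b] := U_sub01 (U'_U hx); rewrite !ltW.
Qed.

(** At an uncovered point a composite of germs is again a listed move. So if [g x] were in Y, a
    listed move would carry a point of [V] to [x]; if it were in Z, conjugation would give a listed
    reflection fixing [x]. *)
Lemma germ_U' g x : germ g x -> U' x -> U' (g x).
Proof.
move=> hg /U'P[Ux nY nZ]; have Ugx := germ_U hg Ux.
have hi := germ_inv hg; apply/U'P; split=> //.
  case=> [[Vgx _]|[g' [D [v [hD [Vv Uv] Dv e]]]]].
    apply: nY; right; have [D hD Dg] := germ_Om Ugx hi.
    by exists (iinv g), D, (g x); split=> //; rewrite iinvK.
  have hv : germ (icomp (iinv g) g') v.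
    by apply: germ_comp (Om_germ hD Dv) _; rewrite -e.
  apply: nY; right; have [D' hD' Dv'] := germ_Om Uv hv.
  by exists (icomp (iinv g) g'), D', v; split=> //; rewrite icompE -e iinvK.
move=> [_ [r [D [hD Dg e]]]]; apply: nZ; split=> //.
have hr := Om_germ hD Dg.
have hc : germ (icomp (iinv g) (icomp (Refl r) g)) x.
  by apply: germ_comp (germ_comp hg hr) _; rewrite icompE -e.
have fx : icomp (iinv g) (icomp (Refl r) g) x = x by rewrite !icompE -e iinvK.
have [r' er] : exists r', icomp (iinv g) (icomp (Refl r) g) = Refl r'.
  by case: (g) => t; eexists; reflexivity.
rewrite er in hc fx.
by have [D' hD' Dx'] := germ_Om Ux hc; exists r', D'.
Qed.

Lemma germ_itv_U' g J : open_itv J -> J `<=` U' -> (forall x, J x -> germ g x) ->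
  open_itv (g @` J) /\ g @` J `<=` U'.
Proof.
move=> oJ JU h; split; first exact: open_itv_image.
by move=> _ [x Jx <-]; apply: germ_U'; [exact: h|exact: JU].
Qed.

Lemma near_gap (l t u : R) : l < t < u ->
  exists2 e, 0 < e & forall s, `|s - t| < e -> l < s < u.
Proof.
move=> h; have oI : open `]l, u[%classic by exact: interval_open.
have [|e e0 he] := (open_ballP _).1 oI t; first by rewrite /= in_itv.
by exists e => // s /he; rewrite /= in_itv.
Qed.

Lemma sym_affine_eq0 (e d : R) : 0 < e -> 0 <= e * d -> 0 <= - e * d -> d = 0.
Proof.
move=> e0; rewrite pmulr_rge0 // mulNr oppr_ge0 pmulr_rle0 // => a b.
by apply/eqP; rewrite eq_le a b.
Qed.

(* An additive point in the interior of a two-dimensional face makes the whole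
   face additive, so that infinitely many moves are defined near [x]. *)
Lemma gadd_interior g c1 c2 c3 x : gcell B g c1 c2 c3 ->
  gext pi g c1 c2 c3 (par g) x = 0 ->
  c1.1 < x < c1.2 -> c2.1 < par g < c2.2 -> c3.1 < g x < c3.2 ->
  0 < x < 1 -> 0 < g x < 1 ->
  exists2 e, 0 < e & forall s, `|s - par g| < e -> germ (setpar g s) x.
Proof.
move=> hc e0 i1 i2 i3 x01 gx01; have [b1 b2 b3 _] := hc.
have [e1 e10 h1] := near_gap i1; have [e2 e20 h2] := near_gap i2.
have [e3 e30 h3] := near_gap i3.
(* The halving leaves room for [setpar g s y], which moves by at most [e] with [s] and by at most
   [e] with [y]. *)
pose e := Num.min e1 (Num.min e2 e3) / 2.
have [l1 l2 l3] : [/\ e < e1, e < e2 & 2 * e <= e3].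
  have m0 : 0 < Num.min e1 (Num.min e2 e3) by rewrite !lt_min e10 e20.
  have m1 : Num.min e1 (Num.min e2 e3) <= e1 by rewrite ge_min lexx.
  have m2 : Num.min e1 (Num.min e2 e3) <= e2 by rewrite !ge_min lexx orbT.
  have m3 : Num.min e1 (Num.min e2 e3) <= e3 by rewrite !ge_min lexx !orbT.
  by rewrite /e; split; lra.
have ep : 0 < e by rewrite divr_gt0 // !lt_min e10 e20.
have hin s y : `|s - par g| <= e -> `|y - x| <= e -> `|setpar g s y - g x| < e3 ->
    [/\ c1.1 < y < c1.2, c2.1 < s < c2.2 & c3.1 < setpar g s y < c3.2].
  move=> hs hy hg; split; [apply: h1|apply: h2|exact: h3].
    exact: le_lt_trans hy l1.
  exact: le_lt_trans hs l2.
have pos s y : `|s - par g| <= e -> `|y - x| <= e -> `|setpar g s y - g x| < e3 ->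
    0 <= gext pi g c1 c2 c3 s y.
  move=> hs hy hg; have [k1 k2 k3] := hin s y hs hy hg.
  by apply: (gext_ge0 plB spi hc); split; apply: cell_relintW; left.
have ne : `|e| = e by rewrite gtr0_norm.
have le3 : e < e3 by lra.
(* [gext] is nonnegative on both sides of its zero, so its slope in the point vanishes; [D2] does
   the same for the parameter. *)
have D1 : cell_slope pi c1 - cell_slope pi c3 = 0.
  have h y : `|y - x| = e -> 0 <= (y - x) * (cell_slope pi c1 - cell_slope pi c3).
    move=> hy; have := pos (par g) y; rewrite (gext_shiftx _ _ _ _ _ _ x) e0 add0r.
    by apply; rewrite ?setpar_par ?isom_dist ?subrr ?normr0 ?hy // ltW.
  apply: (sym_affine_eq0 ep).
    by have := h (x + e); rewrite addrAC subrr add0r; apply.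
  by have := h (x - e); rewrite addrAC subrr add0r; apply; rewrite normrN.
have D2 : chi g * (cell_slope pi c2 - cell_slope pi c3) = 0.
  have h s : `|s - par g| = e ->
      0 <= (s - par g) * (chi g * (cell_slope pi c2 - cell_slope pi c3)).
    move=> hs; have := pos s x; rewrite (gext_par _ _ _ _ _ (par g)) e0 add0r.
    rewrite (mulrC (chi g)) mulrA; apply; rewrite ?hs ?subrr ?normr0 //; first exact: ltW.
    by rewrite -[in g x](setpar_par g) setpar_dist hs.
  apply: (sym_affine_eq0 ep).
    by have := h (par g + e); rewrite addrAC subrr add0r; apply.
  by have := h (par g - e); rewrite addrAC subrr add0r; apply; rewrite normrN.
exists e => // s hs.
have hin' y : `|y - x| < e -> [/\ c1.1 < y < c1.2, c2.1 < s < c2.2 & c3.1 < setpar g s y < c3.2].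
  move=> hy; apply: hin; [exact: ltW|exact: ltW|].
  rewrite -(subrKA (setpar g s x)) (le_lt_trans (ler_normD _ _)) //.
  by rewrite isom_dist -[in g x](setpar_par g) setpar_dist; lra.
have hm : gmove pi (setpar g s) [set y | `|y - x| < e].
  have [c10 c11] := cell_sub01 bB b1 i1 x01; have [c30 c31] := cell_sub01 bB b3 i3 gx01.
  split; first exact: open_itv_ball.
  - move=> y /hin'[k1 _ _]; apply: (notB_contA bB plB); last exact: (cell_notB b1 k1).
    by case/andP: k1 => k1 k2; rewrite (le_lt_trans c10 k1) (lt_le_trans k2 c11).
  - move=> _ [y /hin'[_ _ k1] <-]; apply: (notB_contA bB plB); last exact: (cell_notB b3 k1).
    by case/andP: k1 => k1 k2; rewrite (le_lt_trans c30 k1) (lt_le_trans k2 c31).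
  left=> y /hin'[k1 k2 k3].
  have -> : gslack pi (setpar g s) (par (setpar g s)) y = gslack pi g s y.
    by case: (g).
  have -> : gslack pi g s y = gext pi g c1 c2 c3 s y by apply: (gext_eq plB hc); left.
  rewrite (gext_par _ _ _ _ _ (par g)) (gext_shiftx _ _ _ _ _ _ x) e0 D1 mulr0 addr0 add0r.
  by rewrite (mulrC (chi g)) -mulrA D2 mulr0.
exists [set y | `|y - x| < e]; last by rewrite /= subrr normr0.
by apply: clsemi_initial; exact: gmove_initial.
Qed.

(** * Induction over the closure axioms, component by component *)

Section Induction.
(* [Q] will be the equivariance of a perturbation up to a constant, or [True]. *)
Variable Q : isom R -> set R -> Prop.
Hypothesis Qcomp : forall g1 g2 J, Q g1 J -> Q g2 (g1 @` J) -> Q (icomp g2 g1) J.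
Hypothesis Qinv : forall g J, Q g J -> Q (iinv g) (g @` J).
Hypothesis Qedge : forall g J c1 c2 c3, gcell B g c1 c2 c3 -> cell_in c2 (par g) ->
  (forall y, J y -> [/\ c1.1 < y < c1.2, c3.1 < g y < c3.2 &
                       gext pi g c1 c2 c3 (par g) y = 0]) -> Q g J.

Definition full g J := [/\ exists2 E, J `<=` E & G (restr g E),
  maximal_itv U' (g @` J) & Q g J].

(* The condition is imposed on whole components because [ax_extend] only provides
   a dense union of domains: such a union meets every component that the extended
   domain meets, whereas a pointwise condition could fail on a Cantor-like set. *)
Definition fullG : set (move R) := [set m | G m /\ forall g E, m = restr g E ->
  forall J x, maximal_itv U' J -> J x -> E x -> full g J].

Lemma fullGI g E : G (restr g E) ->
  (forall J x, maximal_itv U' J -> J x -> E x -> full g J) -> fullG (restr g E).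
Proof.
move=> h H; split=> // g' E' e J x mJ Jx; rewrite -(restr_dom e) => Ex.
by rewrite -(restr_isom e Ex); exact: H Ex.
Qed.

Lemma fullG_full g E J x : fullG (restr g E) -> maximal_itv U' J -> J x -> E x -> full g J.
Proof. by move=> [_ h]; exact: h. Qed.

Lemma full_inv g J : maximal_itv U' J -> full g J -> full (iinv g) (g @` J).
Proof.
move=> mJ [[E JE GE] _ q]; split; last exact: Qinv.
  by exists (g @` E); [exact: image_subset|exact: (cs_inv closed_clsemi)].
suff -> : iinv g @` (g @` J) = J by [].
apply/seteqP; split => [_ [_ [x Jx <-] <-]|x Jx]; first by rewrite iinvK.
by exists (g x); [exists x|rewrite iinvK].
Qed.

Lemma full_comp g1 g2 J : full g1 J -> full g2 (g1 @` J) -> full (icomp g2 g1) J.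
Proof.
move=> [[E1 s1 G1] _ q1] [[E2 s2 G2] m2 q2]; split; last exact: Qcomp.
  exists (E1 `&` g1 @^-1` E2); last exact: (cs_comp closed_clsemi).
  by move=> x Jx; split; [exact: s1|apply: s2; exists x].
suff -> : icomp g2 g1 @` J = g2 @` (g1 @` J) by [].
apply/seteqP; split => [_ [x Jx <-]|_ [_ [x Jx <-] <-]].
  by exists (g1 x); [exists x|rewrite icompE].
by exists x => //; rewrite icompE.
Qed.

(** All moves of one type in a rectangle would give the uncovered point [x] infinitely many germs;
    this empties the kaleidoscope case. *)
Lemma moves_type_full g D I J x : open D -> open I -> D x -> I (g x) ->
  maximal_itv U' J -> J x -> moves_type g (D `*` I) `<=` fullG -> False.
Proof.
move=> oD oI Dx Igx [_ JU _] Jx h.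
have [e e0 he] := local_moves_type oD oI Dx Igx.
apply: (@uncovered_no_near g x e (U'_U (JU _ Jx)) e0) => s /he[E /h[hE _] Ex].
by exists E.
Qed.

Lemma closed_fullG : closed_semigroup (contA pi) fullG.
Proof.
have cG := closed_clsemi; split.
- by move=> m [/(cs_ensemble cG)].
- move=> g1 D1 g2 D2 h1 h2; apply: fullGI; first exact: (cs_comp cG) h1.1 h2.1.
  move=> J x mJ Jx [D1x D2x]; have f1 := fullG_full h1 mJ Jx D1x.
  apply: (full_comp f1); have [_ m1 _] := f1.
  by apply: (fullG_full (x := g1 x) h2) => //; exists x.
- move=> g D h; apply: fullGI; first exact: (cs_inv cG) h.1.
  move=> J _ mJ /[swap] -[x Dx <-] Jgx.
  have [_ JU' _] := mJ; have [oJ _ _] := mJ.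
  have hgx : germ g x by exists D => //; exact: h.1.
  (* The behaviour of [iinv g] on all of [J] is not known yet. A neighbourhood of [g x] in [J] is
     pulled back into [U'] and enlarged to the component [J0] of [x]; the image of [J0] is a
     component meeting [J], hence [J] itself. *)
  have [E0 hE0 [Ex0 oE0 iE0]] := germ_open hgx.
  pose N := J `&` g @` E0.
  have oN : open_itv N.
    have : open_itv0 N.
      apply: open_itv0I; first by left.
      by apply: open_itv0_image; exact: open_itv0P.
    by case=> // N0; exfalso; have : N (g x); [split=> //; exists x|rewrite N0].
  have gN y : N y -> germ (iinv g) y.
    by move=> [_ [z Ez <-]]; apply: germ_inv; exists E0.
  have [oiN siN] := @germ_itv_U' (iinv g) N oN (fun y Ny => JU' y Ny.1)
    gN.
  have [J0 mJ0 sJ0] := maximal_itv_ex oiN siN.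
  have J0x : J0 x by apply: sJ0; exists (g x); [split=> //; exists x|rewrite iinvK].
  have f0 := fullG_full h mJ0 J0x Dx.
  have [_ m0 _] := f0.
  have -> : J = g @` J0 by apply: (maximal_itv_eq mJ m0 Jgx); exists x.
  exact: full_inv.
- move=> g D D' h sD oD'; apply: fullGI; first exact: (cs_restrict cG) h.1 sD oD'.
  by move=> J x mJ Jx /sD; exact: fullG_full.
- move=> g F h oF; apply: fullGI.
    by apply: (cs_continuation cG) => // I /h[].
  by move=> J x mJ Jx [I /h hI Ix]; exact: fullG_full hI mJ Jx Ix.
- move=> g F D h oD sD; apply: fullGI.
    by apply: (cs_extend cG) oD sD => I /h[].
  move=> J x mJ Jx Dx; have [[cx _] _] := sD _ Dx.
  have [[oJ _ _] _ _] := mJ.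
  have [y [[I FI Iy] Jy]] := cx _ (open_nbhs_nbhs (conj oJ Jx)).
  exact: fullG_full (h _ FI) mJ Jy Iy.
- move=> gs g D oD h hc hp; apply: fullGI.
    by apply: (cs_lim cG) oD _ hc hp => i; case: (h i).
  move=> J x mJ Jx Dx; have [_ JU' _] := mJ.
  have [i <-] := isom_finite_lim (finite_germs (U'_U (JU' _ Jx)))
    (fun i => ex_intro2 _ _ D (h i).1 Dx) hc hp.
  exact: fullG_full (h i) mJ Jx Dx.
- move=> D I [oD iD nD] [oI iI nI]; split=> h m hm.
    have hG : G m by apply: ((cs_kaleido cG (And3 oD iD nD) (And3 oI iI nI)).1 _ _ hm) => m' /h[].
    case: hm hG => t [E [_ -> sE]] hG; apply: fullGI => // J x mJ Jx Ex; exfalso.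
    have [/= Dx Ix] := sE (x, Refl t x) (conj Ex erefl).
    (* The translation that agrees with [Refl t] at [x]. *)
    apply: (@moves_type_full (Transl (t - x - x)) D I J x) => //=.
    by rewrite addrC subrK.
  have hG : G m by apply: ((cs_kaleido cG (And3 oD iD nD) (And3 oI iI nI)).2 _ _ hm) => m' /h[].
  case: hm hG => t [E [_ -> sE]] hG; apply: fullGI => // J x mJ Jx Ex; exfalso.
  have [/= Dx Ix] := sE (x, Transl t x) (conj Ex erefl).
  apply: (@moves_type_full (Refl (x + t + x)) D I J x) => //=.
  by rewrite addrK.
Qed.

Lemma gmove_full g E J x : gmove pi g E -> E x -> maximal_itv U' J -> J x -> full g J.
Proof.
move=> hm Ex mJ Jx; have [[oJ iJ _] JU' _] := mJ.
have gx : germ g x by exists E => //; apply: clsemi_initial; exact: gmove_initial.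
have [x01 gx01] := germ01 gx.
have U'x := JU' _ Jx; have U'gx := germ_U' gx U'x.
have nx := U'_notB U'x; have ngx := U'_notB U'gx.
have [c1 [c2 [c3 [hc hin e0]]]] := gmove_gadd bB plB hm Ex nx ngx.
have [i1 i2 i3] := hin; have [b1 b2 b3 _] := hc; rewrite setpar_par in i3.
have o1 := cell_in_notB b1 i1 nx; have o3 := cell_in_notB b3 i3 ngx.
(* Otherwise the additive point is interior to a two-dimensional face. *)
have Bp : B (par g).
  apply: contrapT => np.
  have [e ep he] := gadd_interior hc e0 o1 (cell_in_notB b2 i2 np) o3 x01 gx01.
  exact: (uncovered_no_near (U'_U U'x) ep he).
have [a [b [axb hopen hcl Ba Bb]]] := gadd_edge plB spi hc hin e0 nx ngx.
have [ax xb] := andP axb.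
have [c10 c11] := cell_sub01 bB b1 o1 x01; have [c30 c31] := cell_sub01 bB b3 o3 gx01.
(* At an end of the edge the parameter and a further coordinate are breakpoints, so it is an
   additive vertex and puts both [z] and [g z] in [V]. *)
have end_V z w : a <= z <= b -> B z \/ B (g z) -> w = z \/ w = g z -> V w.
  move=> hz Bz hw; have [hz1 hz2] := hcl z hz.
  have [/andP[q1 q2] _ /andP[q3 q4]] := hz1; rewrite setpar_par in q3 q4.
  apply: (@gadd_V g z) => //; first by exists c1, c2, c3.
  by case: hw => ->; apply/andP; split; lra.
have aab : a <= a <= b by rewrite lexx (ltW (lt_trans ax xb)).
have abb : a <= b <= b by rewrite lexx (ltW (lt_trans ax xb)).
have notJ K z w : K `<=` U' -> a <= z <= b -> B z \/ B (g z) -> w = z \/ w = g z -> ~ K w.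
  by move=> KU hz Bz hw /KU /U'_notV; apply; exact: end_V hz Bz hw.
have JE : J `<=` `]a, b[%classic.
  apply: (itv_subset_oo iJ Jx axb).
    by apply: (notJ J a) => //; left.
  by apply: (notJ J b) => //; left.
have GE : G (restr g `]a, b[%classic).
  apply: clsemi_initial; apply: gmove_initial.
  apply: (edge_gmove bB plB hc i2 x01 gx01 axb) => y hy.
  have [k1 k2] := hopen _ hy; split=> //.
  by have [] := hcl y; [case/andP: hy => *; rewrite !ltW|].
split; first by exists `]a, b[%classic.
- have gJ y : J y -> germ g y by move=> /JE ?; exists `]a, b[%classic.
  have [oiJ siJ] := germ_itv_U' (And3 oJ iJ (ex_intro _ x Jx)) JU' gJ.
  (* A larger interval [K] in [U'] avoids [g a] and [g b], so it pulls back inside the edge, where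
     [iinv g] is available on all of it; maximality of [J] concludes. *)
  split=> // K oK KU' sK.
  have [_ iK _] := open_itv_image (iinv g) oK.
  have KE : iinv g @` K `<=` `]a, b[%classic.
    apply: (@itv_subset_oo _ _ a b x iK) => //.
    - by exists (g x); [apply: sK; exists x|rewrite iinvK].
    - move=> [y Ky ya]; apply: (notJ K a y) => //; right.
      by rewrite -ya iinvKV.
    - move=> [y Ky ya]; apply: (notJ K b y) => //; right.
      by rewrite -ya iinvKV.
  have gK y : K y -> germ (iinv g) y.
    move=> Ky; rewrite -[y](iinvKV g); apply: germ_inv; exists `]a, b[%classic => //.
    by apply: KE; exists y.
  have [oiK siK] := germ_itv_U' oK KU' gK.
  have [_ _ maxJ] := mJ.
  have -> : J = iinv g @` K.
    apply/esym; apply: maxJ => // y Jy; exists (g y); last by rewrite iinvK.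
    by apply: sK; exists y.
  apply/seteqP; split=> [y Ky|_ [_ [y Ky <-] <-]]; last by rewrite iinvKV.
  by exists (iinv g y); [exists y|rewrite iinvKV].
- apply: (Qedge hc i2) => y /JE hy; have [k1 k2] := hopen _ hy; split=> //.
  by have [] := hcl y; [move: hy; rewrite /= in_itv /= => /andP[? ?]; rewrite !ltW|].
Qed.

Lemma clsemi_full : G `<=` fullG.
Proof.
apply: smallest_sub; first exact: closed_fullG.
have H g E : gmove pi g E -> fullG (restr g E).
  move=> hm; apply: fullGI; first by apply: clsemi_initial; exact: gmove_initial.
  by move=> J x mJ Jx Ex; exact: gmove_full hm Ex mJ Jx.
move=> m /[dup] hm /initial_cases[[g e]|[g [E [hg ->]]]|[g [E [hg ->]]]].
- by rewrite e; apply: fullGI; [rewrite -e; exact: clsemi_initial|].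
- exact: H.
- by apply: (cs_inv closed_fullG); exact: H.
Qed.

Lemma germ_full g J x : germ g x -> maximal_itv U' J -> J x -> full g J.
Proof. by move=> [E /clsemi_full hE Ex] mJ Jx; exact: fullG_full hE mJ Jx Ex. Qed.

End Induction.

Lemma germ_maximal g J x : germ g x -> maximal_itv U' J -> J x ->
  (exists2 E, J `<=` E & G (restr g E)) /\ maximal_itv U' (g @` J).
Proof.
move=> hg mJ Jx.
have [h1 h2 _] := @germ_full (fun _ _ => True) (fun _ _ _ _ _ => I) (fun _ _ _ => I)
  (fun _ _ _ _ _ _ _ _ => I) g J x hg mJ Jx.
by split.
Qed.

Lemma germ_itv g J x : germ g x -> maximal_itv U' J -> J x -> forall y, J y -> germ g y.
Proof.
by move=> hg mJ Jx y Jy; have [[E JE GE] _] := germ_maximal hg mJ Jx; exists E => //; exact: JE.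
Qed.

(** The domain [D] of the listed move and the larger domain [E] containing [J] share [x], so
    continuation gives a move on their union; maximality in the reduced form makes this union equal
    to [D]. *)
Lemma germ_Omega g J x : germ g x -> maximal_itv U' J -> J x ->
  Omega_uncovered pi B Om C (restr g J).
Proof.
move=> hg mJ Jx; have [oJ JU' _] := mJ; have [[E JE GE] _] := germ_maximal hg mJ Jx.
have [D hD Dx] := germ_Om (U'_U (JU' _ Jx)) hg.
have Ex := JE _ Jx.
have oit K : G (restr g K) -> K x -> open_itv K.
  by move=> /clsemi_in/moves_inP[[//|->]].
have GDE : G (restr g (D `|` E)).
  have -> : D `|` E = \bigcup_(K in [set D; E]) K by rewrite bigcup_setU1 bigcup_set1.
  apply: (cs_continuation closed_clsemi).
    by move=> K [->|->] //; exact: clsemi_Om.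
  rewrite bigcup_setU1 bigcup_set1; apply: (open_itvU (x := x)) => //; apply: oit => //.
  exact: clsemi_Om.
have [[_ maxD] _] := rf hD.
have /restr_dom DE : restr g (D `|` E) = restr g D.
  by apply: maxD => //; split=> // -[u v] /= [Du ->]; split=> //; left.
have JD : J `<=` D by rewrite -DE => y /JE Ey; right.
exists g, D, J; split=> //; first by left; exists x.
by apply: restr_eq; apply/seteqP; split=> [y Jy|y []//]; split=> //; exact: JD.
Qed.

Lemma Omega_germ g J x : Omega_uncovered pi B Om C (restr g J) -> J x -> germ g x.
Proof.
move=> [g' [D [K [hD mK _ e]]]] Jx.
have := Jx; rewrite {1}(restr_dom e) => -[Dx _].
by rewrite (restr_isom e Jx); exact: Om_germ hD Dx.
Qed.

(** * Finiteness of the refined breakpoints and boundaries of components *)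

Lemma face_cell F x : face B F -> F x ->
  exists c, [/\ cell B c, cell_in c x & F = `[c.1, c.2]%classic].
Proof.
case=> [->//|[y By ->] ->|[a [b [hab ->]]] hx].
  by exists (y, y); split; [right|rewrite /cell_in lexx|exact: set1_itv].
by exists (a, b); split; [left|move: hx; rewrite /= in_itv|].
Qed.

(** If at most one of the three coordinates were a breakpoint, the point could slide inside the face
    with that coordinate fixed, so the face would not be a singleton. *)
Lemma delta_vertex_B x y : delta_vertex B (x, y) -> [\/ B x /\ B y,
  B x /\ B (x + y) | B y /\ B (x + y)].
Proof.
move=> [F1 [F2 [F3 [f1 f2 f3 E]]]].
have [/= h1 h2 h3] : face3 F1 F2 F3 (x, y) by rewrite -E.
have [c1 [b1 i1 e1]] := face_cell f1 h1; have [c2 [b2 i2 e2]] := face_cell f2 h2.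
have [c3 [b3 i3 e3]] := face_cell f3 h3.
have uniq (a b : R) : cell_in c1 a -> cell_in c2 b -> cell_in c3 (a + b) -> a = x /\ b = y.
  move=> k1 k2 k3; suff [] : [set (x, y) : R^o * R^o] (a, b) by [].
  by rewrite E; split; rewrite /= ?e1 ?e2 ?e3 /= in_itv.
clear E e1 e2 e3.
have stay c z : cell B c -> cell_in c z -> ~ B z ->
    exists2 e : R, 0 < e & forall w, `|w - z| < e -> cell_in c w.
  move=> Bc cz nz; have [e e0 he] := near_gap (cell_in_notB Bc cz nz).
  by exists e => // w /he/andP[a b]; rewrite /cell_in !ltW.
have pick (e e' : R) : 0 < e -> 0 < e' -> exists d : R, [/\ 0 < d, d < e & d < e'].
  move=> p p'; exists (Num.min e e' / 2); have m0 : 0 < Num.min e e' by rewrite lt_min p.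
  have [ma mb] : Num.min e e' <= e /\ Num.min e e' <= e' by rewrite !ge_min !lexx orbT.
  by split; lra.
have [Bx|nx] := pselect (B x); have [By|ny] := pselect (B y);
  have [Bz|nz] := pselect (B (x + y)); try (by constructor 1); try (by constructor 2);
  try (by constructor 3); exfalso.
- have [e p q] := stay _ _ b2 i2 ny; have [e' p' q'] := stay _ _ b3 i3 nz.
  have [d [d0 de de']] := pick _ _ p p'.
  have [//||_ ed] := uniq x (y + d) i1; last by lra.
    by apply: q; rewrite addrAC subrr add0r gtr0_norm.
  by apply: q'; rewrite (_ : x + (y + d) - (x + y) = d) ?gtr0_norm //; ring.
- have [e p q] := stay _ _ b1 i1 nx; have [e' p' q'] := stay _ _ b3 i3 nz.
  have [d [d0 de de']] := pick _ _ p p'.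
  have [||ed _] := uniq (x + d) y _ i2; last by lra.
    by apply: q; rewrite addrAC subrr add0r gtr0_norm.
  by apply: q'; rewrite (_ : x + d + y - (x + y) = d) ?gtr0_norm //; ring.
- have [e p q] := stay _ _ b1 i1 nx; have [e' p' q'] := stay _ _ b2 i2 ny.
  have [d [d0 de de']] := pick _ _ p p'.
  have [|||ed _] := uniq (x + d) (y - d); last by lra.
  + by apply: q; rewrite addrAC subrr add0r gtr0_norm.
  + by apply: q'; rewrite addrAC subrr add0r normrN gtr0_norm.
  + by rewrite addrACA subrr addr0.
- have [e p q] := stay _ _ b1 i1 nx; have [e' p' q'] := stay _ _ b3 i3 nz.
  have [e2' p2 q2] := stay _ _ b2 i2 ny.
  have [d [d0 de de']] := pick _ _ p p2.
  have [|||ed _] := uniq (x + d) (y - d); last by lra.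
  + by apply: q; rewrite addrAC subrr add0r gtr0_norm.
  + by apply: q2; rewrite addrAC subrr add0r normrN gtr0_norm.
  + by rewrite addrACA subrr addr0.
Qed.

Lemma finite_V : finite_set V.
Proof.
apply: sub_finite_set (finite_cell_sums01 bB) => z [[[x y] [dv _] hz] z01]; split=> //.
have sums := cell_sums_left bB.
have := delta_vertex_B dv; case: hz => /= ->; case=> -[h1 h2]; try exact: sums.
- by exists (x + y), y; split=> //; right; rewrite addrK.
- by exists (x + y), x; split=> //; right; rewrite addrAC subrr add0r.
- by exists x, y; split=> //; left.
Qed.

Lemma finite_Y : finite_set (Yset pi B Om C).
Proof.
rewrite finite_setU; split; first by apply: sub_finite_set finite_V => z [].
apply: (@sub_finite_set _ _ (\bigcup_(m in Om) \bigcup_(x in V) [set y | mgraph m (x, y)])).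
  by move=> y [g [D [x [hD [Vx _] Dx ->]]]]; exists (restr g D) => //; exists x.
apply: bigcup_finite => [|m hm]; first exact: fp_finite fp.
apply: bigcup_finite => [|x _]; first exact: finite_V.
have [g [D [_ ->]]] := fp_ensemble fp hm.
by apply: finite_subsingleton => a b /= [_ ->] [_ ->].
Qed.

Lemma finite_Z : finite_set (Zset Om C).
Proof.
apply: (@sub_finite_set _ _ (\bigcup_(m in Om) [set x | mchi m = -1 /\ mgraph m (x, x)])).
  by move=> x [_ [r [D [hD Dx e]]]]; exists (restr (Refl r) D).
apply: bigcup_finite => [|m hm]; first exact: fp_finite fp.
have [g [D [_ ->]]] := fp_ensemble fp hm.
apply: finite_subsingleton => a b /= [hc [_ ea]] [_ [_ eb]].
by case: g hc ea eb => t /= hc ea eb; [exfalso|]; lra.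
Qed.

Lemma open_U' : open U'.
Proof.
have -> : U' = U `&` ~` Yset pi B Om C `&` ~` Zset Om C.
  by apply/seteqP; split=> [x /U'P[]|x [[Ux nY] nZ]]; [split|apply/U'P].
have closedF (S : set R) : finite_set S -> closed S.
  exact: (accessible_finite_set_closed.1 (hausdorff_accessible (@Rhausdorff R))).
apply: openI; first apply: openI; first exact: open_U.
- rewrite openC; exact: closedF finite_Y.
- rewrite openC; exact: closedF finite_Z.
Qed.

(** A boundary point that is no refined breakpoint would be in the open set [U'], and [J] could be
    enlarged by a ball around it. *)
Lemma boundary_refined J x : maximal_itv U' J -> boundary J x ->
  refined_breakpoints pi B Om C x.
Proof.
move=> [[oJ iJ nJ] JU' mJ] [cJx +]; rewrite (interior_id _).1 // => nJx.
apply: contrapT => nr.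
have inr w : (Xset C `|` Yset pi B Om C `|` Zset Om C) w -> w <> x.
  by move=> hw e; apply: nr; rewrite -e; exists w => //; exists 0; rewrite addr0.
have x01 : `[0, 1]%classic x.
  apply: itv_closure; apply: closureS cJx => y /JU'/U'_U/U_sub01.
  by rewrite /= in_itv.
move: x01; rewrite /= in_itv /= => /andP[].
rewrite le_eqVlt => /orP[/eqP e|x0]; first by case: (inr 0) => //; left; left; left; left.
rewrite le_eqVlt => /orP[/eqP e|x1]; first by case: (inr 1) => //; left; left; right.
have Ux : U x.
  split; first by rewrite /= in_itv /= x0.
  move=> cCx; apply: (inr x) => //; left; left; left; right; split=> //.
  move=> iCx; have [y [Jy Cy]] := cJx _ iCx.
  have [_] := U'_U (JU' _ Jy); apply; exact: subset_closure.
have U'x : U' x.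
  by apply/U'P; split=> // h; apply: (inr x) => //; [left; right|right].
have [e e0 he] := (open_ballP _).1 open_U' x U'x.
have [y Jy yx] := (closure_ballP _ _).1 cJx _ e0.
have oit := open_itvU (And3 oJ iJ nJ) (open_itv_ball x e0) Jy yx.
have JE : J `|` [set y | `|y - x| < e] = J.
  by apply: mJ => // z [/JU'|/he].
by apply: nJx; rewrite -JE; right; rewrite /= subrr normr0.
Qed.

(** The induction is applied to equivariance up to an additive constant, a condition stable under
    composition and inversion and supplied on edges by [edge_respect]. *)
Lemma germ_respect (K : R) (pt : R -> R) g J x :
  (forall u v, `|slack pt u v| <= K * slack pi u v) ->
  (forall z, ~ B z -> pt w @[w --> z] --> pt z) ->
  germ g x -> maximal_itv U' J -> J x ->
  exists a, forall y, J y -> pt (g y) = chi g * pt y + a.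
Proof.
move=> hK ct hg mJ Jx.
pose Q g J := exists a, forall y, J y -> pt (g y) = chi g * pt y + a.
suff [] : full Q g J by [].
apply: (germ_full (Q := Q)) hg mJ Jx.
- move=> g1 g2 K' [a1 h1] [a2 h2]; exists (chi g2 * a1 + a2) => y K'y.
  rewrite icompE h2; last by exists y.
  by rewrite h1 // chi_icomp; ring.
- move=> g' K' [a h]; exists (- (chi g' * a)) => _ [y K'y <-].
  rewrite iinvK h // chi_iinv; have := chi_sqr g' => e.
  have -> : chi g' * (chi g' * pt y + a) = chi g' * chi g' * pt y + chi g' * a by ring.
  by rewrite e; ring.
- move=> g' K' c1 c2 c3 hc i2 H.
  have [[z K'z]|nK] := pselect (exists z, K' z); last by exists 0 => y K'y; case: nK; exists y.
  exists (pt (g' z) - chi g' * pt z) => y K'y.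
  have := edge_respect plB hc hK ct i2 (H _ K'y) (H _ K'z).
  by move=> <-; ring.
Qed.

(** * Moves within a connected uncovered component *)

Section Components.
Variables (p : nat) (I : 'I_p -> set R) (D : set R) (g_ : 'I_p -> isom R).
Hypothesis uc : uncovered_component pi B Om C I.
Hypothesis DI : exists i, D = I i.
Hypothesis hg_ : forall j, Omega_uncovered pi B Om C (restr (g_ j) D) /\ g_ j @` D = I j.

Lemma component_maximal i : maximal_itv U' (I i).
Proof. by have [_ [sI _] _] := uc; apply: sI; exists i. Qed.

Lemma domain_maximal : maximal_itv U' D.
Proof. by have [i ->] := DI; exact: component_maximal. Qed.

Lemma domain_germ j x : D x -> germ (g_ j) x.
Proof. exact: Omega_germ (hg_ j).1. Qed.

Lemma maximal_oo J : maximal_itv U' J -> exists a b, a < b /\ J = `]a, b[%classic.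
Proof.
move=> [oJ JU' _]; apply: (@open_itv_bounded _ J 0 1 oJ).
by move=> x /JU'/U'_U/U_sub01/andP[a b]; rewrite /= in_itv /= !ltW.
Qed.

Definition conn J1 J2 := exists2 g, (forall x, J1 x -> germ g x) & g @` J1 = J2.

Lemma conn_sym J1 J2 : conn J1 J2 -> conn J2 J1.
Proof.
move=> [g hg <-]; exists (iinv g); first by move=> _ [x /hg h <-]; exact: germ_inv.
apply/seteqP; split=> [_ [_ [x Jx <-] <-]|x Jx]; first by rewrite iinvK.
by exists (g x); [exists x|rewrite iinvK].
Qed.

Lemma conn_trans J1 J2 J3 : conn J1 J2 -> conn J2 J3 -> conn J1 J3.
Proof.
move=> [g hg <-] [h hh <-]; exists (icomp h g).
  by move=> x Jx; apply: germ_comp; [exact: hg|apply: hh; exists x].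
apply/seteqP; split=> [_ [x Jx <-]|_ [_ [x Jx <-] <-]].
  by exists (g x); [exists x|rewrite icompE].
by exists x; rewrite ?icompE.
Qed.

Lemma connP J1 J2 : maximal_itv U' J1 -> connected_itvs pi B Om C J1 J2 <-> conn J1 J2.
Proof.
move=> mJ; split=> [[g [hg e]]|[g hg e]]; exists g => //; first by move=> x; exact: Omega_germ hg.
split=> //; have [[_ _ [x Jx]] _ _] := mJ.
exact: germ_Omega (hg _ Jx) mJ Jx.
Qed.

(** Adding the image of [I j] to the class keeps it pairwise connected, so by maximality the image
    was already there. *)
Lemma component_closed j g u : I j u -> germ g u -> exists l, g @` I j = I l.
Proof.
move=> Iu hg; have mj := component_maximal j.
have [_ mJ'] := germ_maximal hg mj Iu.
have cj : conn (I j) (g @` I j) by exists g => //; exact: germ_itv hg mj Iu.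
have [_ [sI cI] maxI] := uc.
pose cl := range I `|` [set g @` I j].
have mcl J : cl J -> maximal_itv U' J by case=> [/sI//|->].
have to_j J : cl J -> conn J (I j).
  case=> [hJ|->]; last exact: conn_sym.
  by apply/connP; [exact: sI|apply: cI => //; exists j].
have : cl = range I.
  apply: maxI; last exact: subsetUl.
  split=> // J1 J2 h1 h2; apply/connP; first exact: mcl.
  by apply: conn_trans (to_j _ h1) _; apply: conn_sym; exact: to_j.
move=> e; have : range I (g @` I j) by rewrite -e; right.
by move=> [l _ <-]; exists l.
Qed.

(* A move of the closure from a component onto itself is the identity: it is no
   nontrivial translation because the component is bounded, and no reflection
   because its fixed point would belong to Z. *)
Lemma self_move J g : maximal_itv U' J -> (forall x, J x -> germ g x) -> g @` J = J ->
  g = Transl 0.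
Proof.
move=> mJ hg e; have [[_ iJ [x0 Jx0]] JU' _] := mJ.
have gJ x : J x -> J (g x) by move=> Jx; rewrite -e; exists x.
case: g hg gJ {e} => t hg gJ.
  congr Transl; have [a [b [ab JE]]] := maximal_oo mJ.
  have H x : a < x < b -> a < x + t < b.
    by have := gJ x; rewrite JE /= !in_itv.
  clear JE.
  have [t0|t0|//] := ltgtP t 0.
    pose m := Num.min (- t) (b - a).
    have m0 : 0 < m by rewrite lt_min oppr_gt0 t0 subr_gt0.
    have [m1 m2] : m <= - t /\ m <= b - a by rewrite !ge_min !lexx orbT.
    have /H/andP[h1 _] : a < a + m / 2 < b by apply/andP; split; lra.
    by exfalso; lra.
  pose m := Num.min t (b - a).
  have m0 : 0 < m by rewrite lt_min t0 subr_gt0.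
  have [m1 m2] : m <= t /\ m <= b - a by rewrite !ge_min !lexx orbT.
  have /H/andP[_ h1] : a < b - m / 2 < b by apply/andP; split; lra.
  by exfalso; lra.
(* The fixed point of the reflection is the midpoint of [x0] and its image, both in the interval
   [J]. *)
exfalso; have Jm : J (t / 2).
  have := gJ _ Jx0; rewrite /= => Jt.
  have [h|h] := leP x0 (t - x0).
    by apply: (iJ x0 (t - x0)) => //; apply/andP; split; lra.
  by apply: (iJ (t - x0) x0) => //; apply/andP; split; lra.
have Um := U'_U (JU' _ Jm); have [D' hD' Dm] := germ_Om Um (hg _ Jm).
have /U'P[_ _] := JU' _ Jm; apply; split=> //; exists t, D'; split=> //=.
by field.
Qed.

(** Conjugated to the fundamental domain, [g] becomes a move [h] of [D] onto itself, hence the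
    identity; so [g] is the composite of the inverse of [g_ j] with [g_ l]. *)
Lemma component_transport j g u : I j u -> germ g u -> exists l x,
  [/\ D x, u = g_ j x, g u = g_ l x & chi g = chi (g_ l) * chi (g_ j)].
Proof.
move=> Iu hg; have [l el] := component_closed Iu hg.
have [_ ej] := hg_ j; have [_ el'] := hg_ l.
have [x Dx xu] : (g_ j @` D) u by rewrite ej.
exists l, x; have cj : conn D (I j) by exists (g_ j) => //; exact: domain_germ.
pose h := icomp (iinv (g_ l)) (icomp g (g_ j)).
have gI := germ_itv hg (component_maximal j) Iu.
have Igy y : D y -> I l (g (g_ j y)).
  by move=> Dy; rewrite -el; exists (g_ j y) => //; rewrite -ej; exists y.
have hh y : D y -> germ h y.
  move=> Dy; apply: germ_comp.
    by apply: germ_comp; [exact: domain_germ|apply: gI; rewrite -ej; exists y].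
  rewrite icompE; have [z Dz <-] : (g_ l @` D) (g (g_ j y)) by rewrite el'; exact: Igy.
  by apply: germ_inv; exact: domain_germ.
have hD : h @` D = D.
  apply/seteqP; split=> [_ [y Dy <-]|y Dy].
    rewrite /h !icompE; have [z Dz <-] : (g_ l @` D) (g (g_ j y)) by rewrite el'; exact: Igy.
    by rewrite iinvK.
  have : I l (g_ l y) by rewrite -el'; exists y.
  rewrite -el -ej => -[_ [z Dz <-] e]; exists z => //.
  by rewrite /h !icompE e iinvK.
have h1 := self_move domain_maximal hh hD.
split=> //.
  have : h x = x by rewrite h1 /= addr0.
  by rewrite /h !icompE xu => hx; rewrite -[in RHS]hx iinvKV.
have : chi h = 1 by rewrite h1.
rewrite /h !chi_icomp chi_iinv => e.
have := chi_sqr (g_ l); have := chi_sqr (g_ j) => ej2 el2.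
have -> : chi g = chi (g_ l) * chi (g_ l) * chi g * (chi (g_ j) * chi (g_ j)).
  by rewrite ej2 el2; ring.
transitivity (chi (g_ l) * chi (g_ j) * (chi (g_ l) * (chi g * chi (g_ j)))); first ring.
by rewrite e mulr1.
Qed.

(** * Vanishing of the slack of an equivariant function at additive points *)

Section Equivariant.
Variable pt : R -> R.
Hypotheses (ppt : periodic pt 1).
Hypothesis supp : forall x, 0 <= x <= 1 -> ~ (\bigcup_j I j) x -> pt x = 0.
Hypothesis eqv : forall x j, D x -> pt x = chi (g_ j) * pt (g_ j x).

Lemma notU'_zero x : 0 <= x <= 1 -> ~ U' x -> pt x = 0.
Proof.
move=> x01 nx; apply: supp => // -[j _ Ix]; apply: nx.
by have [_ + _] := component_maximal j; apply.
Qed.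

Lemma notU_zero x : 0 < x < 1 -> ~ U x -> pt x = 0.
Proof.
by move=> /andP[a b] nx; apply: notU'_zero; [rewrite !ltW|move=> /U'_U].
Qed.

Lemma V_zero x : V x -> pt x = 0.
Proof. by move=> Vx; apply: notU'_zero; [exact: Vset01|move=> /U'_notV]. Qed.

Lemma frac_ex x : exists l : int, 0 <= x + l%:~R < 1.
Proof.
exists (- Num.floor x); have := floor_itv x; rewrite intrD intrN => /andP[a b].
by apply/andP; split; lra.
Qed.

Lemma B_zero x : B x -> pt x = 0.
Proof.
move=> Bx; have [l /andP[a b]] := frac_ex x; rewrite -(periodicz ppt x l).
by apply/V_zero/B_V; [exact: breakpoints_shift|rewrite a ltW].
Qed.

(** Outside the component both values are 0, since the inverse germ would otherwise bring [u] back
    into it. *)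
Lemma germ_equivariant g u : germ g u -> pt (g u) = chi g * pt u.
Proof.
move=> hg; have [/andP[u0 u1] /andP[gu0 gu1]] := germ01 hg.
have [[j _ Iu]|nI] := pselect ((\bigcup_j I j) u).
  have [l [x [Dx -> -> ->]]] := component_transport Iu hg.
  have := eqv l Dx; have := eqv j Dx => ej el.
  have := chi_sqr (g_ l); have := chi_sqr (g_ j) => sj sl.
  have -> : pt (g_ l x) = chi (g_ l) * chi (g_ l) * pt (g_ l x) by rewrite sl mul1r.
  by rewrite -!mulrA -el -ej.
rewrite (supp _ nI) ?ltW // mulr0; apply: supp; first by rewrite !ltW.
move=> [j _ Igu]; apply: nI.
have [l [x [Dx _ e _]]] := component_transport Igu (germ_inv hg).
by exists l => //; rewrite -[u](iinvK g) e -(hg_ l).2; exists x.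
Qed.

Lemma gadd_germ g x : gadd B pi g x -> 0 < x < 1 -> 0 < g x < 1 -> ~ B x -> ~ B (g x) ->
  germ g x.
Proof.
move=> [c1 [c2 [c3 [hc hin e0]]]] x01 gx01 nx ngx.
have [a [b [axb hopen hcl _ _]]] := gadd_edge plB spi hc hin e0 nx ngx.
exists `]a, b[%classic; last by rewrite /= in_itv.
apply: clsemi_initial; apply: gmove_initial; have [_ i2 _] := hin.
apply: (edge_gmove bB plB hc i2 x01 gx01 axb) => y hy.
have [k1 k2] := hopen _ hy; split=> //.
by have [] := hcl y; [case/andP: hy => *; rewrite !ltW|].
Qed.

Lemma notB_frac x : ~ B x -> exists l : int, 0 < x + l%:~R < 1.
Proof.
move=> nx; have [l /andP[a b]] := frac_ex x; exists l; rewrite b andbT lt_neqAle a andbT.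
apply/eqP => e; apply: nx; apply/(breakpoints_shiftE bB x l).
by rewrite -e; exact: (breakpoints_int bB 0).
Qed.

Lemma gadd_vertex_zero x y : gadd B pi (Transl y) x ->
  (B x /\ B y) \/ (B x /\ B (x + y)) \/ (B y /\ B (x + y)) ->
  pt x = 0 /\ pt (x + y) = 0.
Proof.
move=> h hB.
have key l : additive_vertex B pi (x + l%:~R, y).
  have h' := gadd_shift bB ppi l 0 h; rewrite addr0 in h'.
  apply: (gadd_vertex plB h').
  rewrite addrAC !(breakpoints_shiftE bB); exact: hB.
have [l /andP[a b]] := frac_ex x; have [l' /andP[a' b']] := frac_ex (x + y).
split.
  rewrite -(periodicz ppt x l); apply: V_zero; split; last by rewrite /= in_itv /= a ltW.
  by exists (x + l%:~R, y); [exact: key|constructor 1].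
rewrite -(periodicz ppt (x + y) l'); apply: V_zero; split; last by rewrite /= in_itv /= a' ltW.
by exists (x + l'%:~R, y); [exact: key|constructor 3; rewrite /= addrAC].
Qed.

Lemma gadd_edge_zero x y : gadd B pi (Transl y) x -> B y -> ~ B x -> ~ B (x + y) ->
  slack pt x y = 0.
Proof.
(* [x] and [x + y] are brought into the unit interval by separate shifts [l] and [l']; the
   breakpoint [y] absorbs the difference. *)
move=> h By nx nz; have [l x01] := notB_frac nx; have [l' z01] := notB_frac nz.
have h' := gadd_shift bB ppi l (l' - l) h.
have e : x + l%:~R + (y + (l' - l)%:~R) = x + y + l'%:~R by rewrite intrB; ring.
have nx' : ~ B (x + l%:~R) by rewrite breakpoints_shiftE.
have nz' : ~ B (x + l%:~R + (y + (l' - l)%:~R)) by rewrite e breakpoints_shiftE.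
have := germ_equivariant (gadd_germ h' x01 _ nx' nz'); rewrite /= e => /(_ z01).
by rewrite !periodicz // mul1r /slack (B_zero By) => ->; ring.
Qed.

Lemma gadd_diagonal_zero x y : gadd B pi (Transl y) x -> B (x + y) -> ~ B x -> ~ B y ->
  slack pt x y = 0.
Proof.
move=> h Bz nx ny; have [l x01] := notB_frac nx; have [l' y01] := notB_frac ny.
have h' := gadd_transl (gadd_shift bB ppi l l' h).
have e : x + l%:~R + (y + l'%:~R) - (x + l%:~R) = y + l'%:~R by ring.
have nx' : ~ B (x + l%:~R) by rewrite breakpoints_shiftE.
have ny' : ~ B (y + l'%:~R) by rewrite breakpoints_shiftE.
have := germ_equivariant (gadd_germ h' x01 _ nx' _); rewrite /= e => /(_ y01 ny').
by rewrite !periodicz // /slack (B_zero Bz) => ->; ring.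
Qed.

(** An additive point interior to a two-dimensional face has infinitely many germs at [x], so [x] is
    not uncovered modulo 1, nor is [x + y] by invariance of [U]. *)
Lemma gadd_face_zero x y : gadd B pi (Transl y) x -> ~ B x -> ~ B y -> ~ B (x + y) ->
  pt x = 0 /\ pt (x + y) = 0.
Proof.
move=> h nx ny nz; have [l x01] := notB_frac nx; have [l' z01] := notB_frac nz.
have h' := gadd_shift bB ppi l (l' - l) h.
have e : x + l%:~R + (y + (l' - l)%:~R) = x + y + l'%:~R by rewrite intrB; ring.
have nx' : ~ B (x + l%:~R) by rewrite breakpoints_shiftE.
have ny' : ~ B (y + (l' - l)%:~R) by rewrite breakpoints_shiftE.
have nz' : ~ B (x + l%:~R + (y + (l' - l)%:~R)) by rewrite e breakpoints_shiftE.
have z01' : 0 < Transl (y + (l' - l)%:~R) (x + l%:~R) < 1 by rewrite /= e.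
have hg := gadd_germ h' x01 z01' nx' nz'.
have [c1 [c2 [c3 [hc [i1 i2 i3] e0]]]] := h'.
have [b1 b2 b3 _] := hc.
have nU : ~ U (x + l%:~R).
  move=> Ux; have [d d0 hd] := gadd_interior hc e0 (cell_in_notB b1 i1 nx')
    (cell_in_notB b2 i2 ny') (cell_in_notB b3 i3 nz') x01 z01'.
  exact: (uncovered_no_near Ux d0 hd).
split; first by rewrite -(periodicz ppt x l); exact: notU_zero.
rewrite -(periodicz ppt (x + y) l') -e; apply: notU_zero => // Uz.
by apply: nU; have := germ_U (germ_inv hg) Uz; rewrite iinvK.
Qed.

Lemma gadd_slack_zero x y : gadd B pi (Transl y) x -> slack pt x y = 0.
Proof.
move=> h; have h' := gadd_swap h.
have vz : (B x /\ B y) \/ (B x /\ B (x + y)) \/ (B y /\ B (x + y)) -> slack pt x y = 0.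
  move=> hB; have [zx zz] := gadd_vertex_zero h hB.
  have [|zy _] := gadd_vertex_zero h'; first by rewrite (addrC y); tauto.
  by rewrite /slack zx zy zz; ring.
have sw : slack pt x y = slack pt y x by rewrite /slack (addrC y); ring.
have [Bx|nx] := pselect (B x); have [By|ny] := pselect (B y);
  have [Bz|nz] := pselect (B (x + y)); try (apply: vz; tauto).
- by rewrite sw; apply: gadd_edge_zero => //; rewrite addrC.
- exact: gadd_edge_zero.
- exact: gadd_diagonal_zero.
- have [zx zz] := gadd_face_zero h nx ny nz.
  have [|zy _] := gadd_face_zero h' ny nx; first by rewrite addrC.
  by rewrite /slack zx zy zz; ring.
Qed.

End Equivariant.
End Components.

End FinitePresentation.

(** * Domination of the slack of a Lipschitz function *)

Section Domination.
Variable R : realType.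
Implicit Types (g : isom R) (c : R * R) (x y z s : R).
Variables (B : set R) (pi pt : R -> R).
Hypotheses (bB : breakpoints B) (plB : piecewise_linear B pi).
Hypotheses (ppi : periodic pi 1) (spi : forall x y, 0 <= slack pi x y).

Lemma gcell_swap c1 c2 c3 x y :
  gcell B (Transl y) c1 c2 c3 -> gcell B (Transl x) c2 c1 c3.
Proof.
by move=> [b1 b2 b3 [p [q [r1 r2 r3]]]]; split=> //; exists q, p; split=> //=; rewrite addrC.
Qed.

Lemma gcell_refl c1 c2 c3 y s :
  gcell B (Transl y) c1 c2 c3 -> gcell B (Refl s) c1 c3 c2.
Proof.
move=> [b1 b2 b3 [p [q [r1 r2 r3]]]]; split=> //; exists p, (p + q).
by split=> //=; rewrite (addrC p) addrK.
Qed.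

Lemma gext_swap c1 c2 c3 x y t t' :
  gext pi (Transl t) c1 c2 c3 y x = gext pi (Transl t') c2 c1 c3 x y.
Proof. by rewrite /gext /= (addrC y); ring. Qed.

Lemma gext_refl c1 c2 c3 x y t t' :
  gext pi (Transl t) c1 c2 c3 y x = gext pi (Refl t') c1 c3 c2 (x + y) x.
Proof. by rewrite /gext /= (addrC x) addrK; ring. Qed.

Lemma gcell_in_swap c1 c2 c3 x y t t' :
  gcell_in (Transl t) c1 c2 c3 y x -> gcell_in (Transl t') c2 c1 c3 x y.
Proof. by move=> [h1 h2 h3]; split=> //=; rewrite addrC. Qed.

Lemma gcell_in_refl c1 c2 c3 x y t t' :
  gcell_in (Transl t) c1 c2 c3 y x -> gcell_in (Refl t') c1 c3 c2 (x + y) x.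
Proof. by move=> [h1 h2 h3]; split=> //=; rewrite (addrC x) addrK. Qed.

Variables (L M : R).
Hypothesis lip : forall x y, `|pt x - pt y| <= L * `|x - y|.
Hypothesis bnd : forall x, `|pt x| <= M.
Hypothesis zero : forall x y, gadd B pi (Transl y) x -> slack pt x y = 0.

Lemma gext_zero g c1 c2 c3 s x : gcell B g c1 c2 c3 -> gcell_in g c1 c2 c3 s x ->
  gext pi g c1 c2 c3 s x = 0 -> gslack pt g s x = 0.
Proof.
move=> hc hin e0; have : gadd B pi (setpar g s) x.
  by exists c1, c2, c3; case: (g) hc hin e0.
case: (g) => t /=; first by rewrite gslack_transl => /zero.
by rewrite gslack_refl => /gadd_refl /zero.
Qed.

Lemma gslack_bound g s x : `|gslack pt g s x| <= 3 * M.
Proof.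
have := bnd x; have := bnd s; have := bnd (setpar g s x).
rewrite /gslack !ler_norml; case: g => t /= /andP[? ?] /andP[? ?] /andP[? ?];
  by apply/andP; split; lra.
Qed.

Lemma gslack_lip g s x x' :
  `|gslack pt g s x - gslack pt g s x'| <= 2 * L * `|x - x'|.
Proof.
have := lip x x'; have := lip (setpar g s x) (setpar g s x'); rewrite isom_dist /gslack.
rewrite !ler_norml; case: g => t /= /andP[? ?] /andP[? ?];
  by apply/andP; split; lra.
Qed.

(** [c] is a gap for the limits of the slack of [pi] at vertices and [d] one for slopes. In [Kc] and
    [Kd], [3 * M] bounds the three terms of the slack of [pt] and [2 * L] its rate of change along
    an edge, where two arguments move. *)
Variables (c d K : R).
Hypothesis K0 : 0 <= K.
Hypothesis values : forall g v1 v2 v3, cell_values B pi v1 -> cell_values B pi v2 ->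
  cell_values B pi v3 -> 0 < v1 + chi g * (v2 - v3) -> c <= v1 + chi g * (v2 - v3).
Hypothesis slopes : forall c1 c2, cell B c1 -> cell B c2 ->
  cell_slope pi c1 != cell_slope pi c2 -> d <= `|cell_slope pi c1 - cell_slope pi c2|.
Hypotheses (Kc : 3 * M <= K * c) (Kd : 2 * L <= K * d).

Lemma gap_dominated g c1 c2 c3 s x : gcell B g c1 c2 c3 -> gcell_in g c1 c2 c3 s x ->
  gext pi g c1 c2 c3 s x = 0 \/ c <= gext pi g c1 c2 c3 s x ->
  `|gslack pt g s x| <= K * gext pi g c1 c2 c3 s x.
Proof.
move=> hc hin [e|h]; first by rewrite (gext_zero hc hin e) e normr0 mulr0.
by rewrite (le_trans (gslack_bound _ _ _)) // (le_trans Kc) // ler_wpM2l.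
Qed.

Lemma vertex_gap g c1 c2 c3 s x : gcell B g c1 c2 c3 -> gcell_in g c1 c2 c3 s x ->
  B s -> B x \/ B (setpar g s x) ->
  gext pi g c1 c2 c3 s x = 0 \/ c <= gext pi g c1 c2 c3 s x.
Proof.
move=> hc [i1 i2 i3] Bs Bx; have [b1 b2 b3 _] := hc.
have [W1 W3] : cell_sums B x /\ cell_sums B (setpar g s x).
  case: Bx => Bx; split; try exact: cell_sums_left.
    by case: (g) => t; [exists x, s|exists s, x]; split=> //; [left|right].
  case: (g) Bx => t /= Bx; [exists (x + s), s|exists s, (s - x)]; split=> //; right.
    by rewrite addrK.
  by rewrite opprB addrC subrK.
have W2 := cell_sums_left bB Bs.
have := gext_ge0 plB spi hc (And3 i1 i2 i3).
rewrite le_eqVlt => /orP[/eqP<-|h]; [by left|right].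
by apply: values h; [exists c1, x|exists c2, s|exists c3, (setpar g s x)].
Qed.

(* A point of a face is moved along a line, downhill for the slack of [pi], until it
   reaches an edge, and then likewise to a vertex: the decrease of the slack of [pi]
   controls the distance, hence the variation of the slack of [pt]. *)
Lemma gstep g c1 c2 c3 s x : gcell B g c1 c2 c3 -> gcell_in g c1 c2 c3 s x ->
  ~ B x -> ~ B (setpar g s x) ->
  exists x', [/\ gcell_in g c1 c2 c3 s x', B x' \/ B (setpar g s x') &
    gext pi g c1 c2 c3 s x = gext pi g c1 c2 c3 s x'
      + `|x - x'| * `|cell_slope pi c1 - cell_slope pi c3|].
Proof.
move=> hc [i1 i2 i3] nx ngx; have [b1 b2 b3 _] := hc.
have [a [b [/andP[ax xb] _ hcl ha hb]]] :=
  edge_interval (cell_in_notB b1 i1 nx) (cell_in_notB b3 i3 ngx).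
have [e1 e1'] := cell_endpoints b1; have [e3 e3'] := cell_endpoints b3.
have [D|D] := leP 0 (cell_slope pi c1 - cell_slope pi c3).
  exists a; split.
  - by have [|? ?] := hcl a; [rewrite lexx ltW // (lt_trans ax)|split].
  - by case: ha => ->; [left|right|right].
  - by rewrite (gext_shiftx _ _ _ _ _ _ a) (ger0_norm D) gtr0_norm ?subr_gt0.
exists b; split.
- by have [|? ?] := hcl b; [rewrite lexx ltW // (lt_trans ax)|split].
- by case: hb => ->; [left|right|right].
- by rewrite (gext_shiftx _ _ _ _ _ _ b) (ltr0_norm D) ltr0_norm ?subr_lt0 // mulrNN.
Qed.

(** Along the step the slack of [pi] drops by at least [d] times the length, while that of [pt]
    varies by at most [2 * L] times the length; [Kd] compares the two. *)
Lemma step_dominated g c1 c2 c3 s x x' : cell B c1 -> cell B c3 ->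
  cell_slope pi c1 != cell_slope pi c3 ->
  gext pi g c1 c2 c3 s x = gext pi g c1 c2 c3 s x'
      + `|x - x'| * `|cell_slope pi c1 - cell_slope pi c3| ->
  `|gslack pt g s x'| <= K * gext pi g c1 c2 c3 s x' ->
  `|gslack pt g s x| <= K * gext pi g c1 c2 c3 s x.
Proof.
move=> b1 b3 ne e h; have hd := slopes b1 b3 ne; rewrite e mulrDr.
rewrite -(subrK (gslack pt g s x') (gslack pt g s x)) (le_trans (ler_normD _ _)) //.
rewrite addrC lerD // (le_trans (gslack_lip _ _ _ _)) // mulrCA mulrC ler_wpM2l //.
by rewrite (le_trans Kd) // ler_wpM2l.
Qed.

(** With equal slopes the slack of [pi] is constant along the edge, so the gap at its end vertex
    holds everywhere on it. *)
Lemma edge_flat_gap g c1 c2 c3 s x : gcell B g c1 c2 c3 -> gcell_in g c1 c2 c3 s x ->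
  B s -> cell_slope pi c1 = cell_slope pi c3 ->
  gext pi g c1 c2 c3 s x = 0 \/ c <= gext pi g c1 c2 c3 s x.
Proof.
move=> hc hin Bs e.
have [Bx|nx] := pselect (B x \/ B (setpar g s x)); first exact: vertex_gap.
have [|//|x' [hin' Bx' ->]] := gstep hc hin; first by move=> ?; apply: nx; left.
  by move=> ?; apply: nx; right.
by rewrite e subrr normr0 mulr0 addr0; exact: vertex_gap.
Qed.

Lemma edge_dominated g c1 c2 c3 s x : gcell B g c1 c2 c3 -> gcell_in g c1 c2 c3 s x ->
  B s -> `|gslack pt g s x| <= K * gext pi g c1 c2 c3 s x.
Proof.
move=> hc hin Bs.
have [e|ne] := eqVneq (cell_slope pi c1) (cell_slope pi c3).
  by apply: (gap_dominated hc hin); exact: edge_flat_gap.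
have [Bx|nx] := pselect (B x \/ B (setpar g s x)).
  by apply: (gap_dominated hc hin); exact: vertex_gap.
have [|//|x' [hin' Bx' e]] := gstep hc hin; first by move=> ?; apply: nx; left.
  by move=> ?; apply: nx; right.
have [b1 _ b3 _] := hc.
apply: (step_dominated b1 b3 ne e); apply: (gap_dominated hc hin'); exact: vertex_gap.
Qed.

(** The other two kinds of edges reduce to the one with fixed parameter by exchanging coordinates,
    or by reading the point as a reflection. *)
Lemma boundary_dominated c1 c2 c3 x y : gcell B (Transl y) c1 c2 c3 ->
  gcell_in (Transl y) c1 c2 c3 y x -> B x \/ B (x + y) ->
  `|gslack pt (Transl y) y x| <= K * gext pi (Transl y) c1 c2 c3 y x.
Proof.
move=> hc hin [Bx|Bz].
  rewrite (gext_swap _ _ _ _ _ _ x) gslack_transl.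
  have -> : slack pt x y = gslack pt (Transl x) x y.
    by rewrite gslack_transl /slack (addrC y); ring.
  by apply: edge_dominated => //; [exact: gcell_swap hc|exact: gcell_in_swap hin].
rewrite (gext_refl _ _ _ _ _ _ 0) gslack_transl.
have -> : slack pt x y = gslack pt (Refl 0) (x + y) x.
  by rewrite gslack_refl (addrC x) addrK.
by apply: edge_dominated => //; [exact: gcell_refl hc|exact: gcell_in_refl hin].
Qed.

Lemma interior_step c1 c2 c3 x y : gcell B (Transl y) c1 c2 c3 ->
  gcell_in (Transl y) c1 c2 c3 y x -> ~ B x -> ~ B (x + y) ->
  cell_slope pi c1 != cell_slope pi c3 ->
  `|gslack pt (Transl y) y x| <= K * gext pi (Transl y) c1 c2 c3 y x.
Proof.
move=> hc hin nx nz ne; have [b1 _ b3 _] := hc.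
have [x' [hin' Bx' e]] := gstep hc hin nx nz.
by apply: (step_dominated b1 b3 ne e); exact: boundary_dominated.
Qed.

Lemma slack_dominated x y : `|slack pt x y| <= K * slack pi x y.
Proof.
have [c1 [b1 r1]] := cell_ex bB x; have [c2 [b2 r2]] := cell_ex bB y.
have [c3 [b3 r3]] := cell_ex bB (x + y).
have hc : gcell B (Transl y) c1 c2 c3 by split=> //; exists x, y.
have hin : gcell_in (Transl y) c1 c2 c3 y x by split; apply: cell_relintW.
rewrite -!(gslack_transl _ y) (gext_eq plB hc) //.
have [By|ny] := pselect (B y); first exact: edge_dominated.
have [Bx|nx] := pselect (B x \/ B (x + y)); first exact: boundary_dominated.
have n1 : ~ B x by move=> ?; apply: nx; left.
have n3 : ~ B (x + y) by move=> ?; apply: nx; right.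
have [e13|ne] := eqVneq (cell_slope pi c1) (cell_slope pi c3); last exact: interior_step.
have [e23|ne] := eqVneq (cell_slope pi c2) (cell_slope pi c3); last first.
  rewrite (gext_swap _ _ _ _ _ _ x) gslack_transl.
  have -> : slack pt x y = gslack pt (Transl x) x y.
    by rewrite gslack_transl /slack (addrC y); ring.
  apply: interior_step => //; [exact: gcell_swap hc|exact: gcell_in_swap hin|].
  by rewrite addrC.
(* All three slopes agree, so the slack of [pi] is constant on the face and inherits the gap from an
   edge. *)
apply: (gap_dominated hc hin).
have [x' [hin' Bx' ->]] := gstep hc hin n1 n3.
rewrite e13 subrr normr0 mulr0 addr0; case: Bx' => Bx'.
  rewrite (gext_swap _ _ _ _ _ _ x'); apply: edge_flat_gap => //.
    exact: gcell_swap hc.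
  exact: gcell_in_swap hin'.
rewrite (gext_refl _ _ _ _ _ _ 0); apply: edge_flat_gap => //.
- exact: gcell_refl hc.
- exact: gcell_in_refl hin'.
- by rewrite e13 e23.
Qed.

End Domination.

Lemma slack_domination (R : realType) (B : set R) (pi pt : R -> R) (L M : R) :
  breakpoints B -> piecewise_linear B pi -> periodic pi 1 ->
  (forall x y, 0 <= slack pi x y) -> 0 <= L -> 0 <= M ->
  (forall x y, `|pt x - pt y| <= L * `|x - y|) -> (forall x, `|pt x| <= M) ->
  (forall x y, gadd B pi (Transl y) x -> slack pt x y = 0) ->
  exists2 K, 0 < K & forall x y, `|slack pt x y| <= K * slack pi x y.
Proof.
move=> bB plB ppi spi L0 M0 lip bnd zero.
have fv := finite_cell_values bB plB ppi.
have fs := finite_cell_slopes bB ppi.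
have [c1 c10 h1] := finite_pos_lb (finite_image2 (fun v w => v + w) fv
  (finite_image2 (fun v w => v - w) fv fv)).
have [c2 c20 h2] := finite_pos_lb (finite_image2 (fun v w => v - w) fv
  (finite_image2 (fun v w => v - w) fv fv)).
have [d d0 hd] := finite_pos_lb (finite_image2 (fun v w => `|v - w|) fs fs).
pose c := Num.min c1 c2; have c0 : 0 < c by rewrite lt_min c10 c20.
(* The first two terms provide [Kc] and [Kd]; the last keeps [K] positive when [L] and [M]
   vanish. *)
pose K := 3 * M / c + 2 * L / d + 1.
have q1 : 0 <= 3 * M / c by apply: divr_ge0; [exact: mulr_ge0|exact: ltW].
have q2 : 0 <= 2 * L / d by apply: divr_ge0; [exact: mulr_ge0|exact: ltW].
exists K; first by rewrite /K; lra.
apply: (@slack_dominated R B pi pt bB plB spi L M lip bnd zero c d K).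
- by rewrite /K; lra.
- case=> t v1 v2 v3 V1 V2 V3 /= h.
    rewrite ge_min; apply/orP; left; apply: h1; last by move: h; rewrite mul1r.
    by exists v1 => //; exists (v2 - v3); [exists v2 => //; exists v3|rewrite mul1r].
  rewrite ge_min; apply/orP; right; apply: h2; last by move: h; rewrite mulN1r.
  by exists v1 => //; exists (v2 - v3); [exists v2 => //; exists v3|rewrite mulN1r].
- move=> a b Ba Bb ne; apply: hd; last by rewrite normr_gt0 subr_eq0.
  by exists (cell_slope pi a); [exists a|exists (cell_slope pi b) => //; exists b].
- by rewrite /K -ler_pdivrMr //; lra.
- by rewrite /K -ler_pdivrMr //; lra.
Qed.

(** * Effective perturbations *)

Section EffectivePerturbations.
Variable R : realType.
Implicit Types (x y z h : R) (c : R * R).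
Variables (f : R) (B : set R) (pi pt : R -> R).
Hypotheses (bB : breakpoints B) (plB : piecewise_linear B pi) (mpi : minimal_valid f pi).
Hypothesis side0 : pi x @[x --> (0 : R)^'+] --> pi 0 \/ pi x @[x --> (0 : R)^'-] --> pi 0.

Lemma minimal_valid_le1 x : pi x <= 1.
Proof.
have := mv_symmetric mpi x; have := mv_ge0 mpi (f - x).
by rewrite /slack (addrC x) subrK (mv_f mpi); lra.
Qed.

(** Inside the cell on the continuous side of 0, [pi] is linear because its limit there is
    [pi 0 = 0]. Beyond that cell the bound [pi <= 1] is absorbed by the inverse of the cell
    length. *)
Lemma one_sided_linear : exists2 s, 0 <= s &
  (forall h, 0 < h -> pi h <= s * h) \/ (forall h, 0 < h -> pi (- h) <= s * h).
Proof.
have B0 := breakpoints_int bB 0; have p0 := mv_0 mpi.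
case: side0 => cv.
  have [c [Bc /andP[c1 c2]]] := right_cell bB 0.
  have e1 : c.1 = 0.
    apply/eqP; rewrite eq_le c1 leNgt; apply/negP => lt0.
    by apply: (cell_notB Bc (_ : c.1 < 0 < c.2)); rewrite ?lt0.
  have H : \forall x \near (0 : R)^'+, pi x = cell_ext pi c 0 + (x - 0) * cell_slope pi c.
    near=> x; rewrite -cell_extB; apply: (cell_ext_eq plB Bc); left; rewrite e1.
    by apply/andP; split; near: x; [exact: nbhs_right_gt|exact: nbhs_right_lt].
  have c0 : cell_ext pi c 0 = 0 by apply/(cvg_right_affine H); rewrite -[X in _ --> X]p0.
  exists (`|cell_slope pi c| + c.2^-1); first by rewrite addr_ge0 // invr_ge0 ltW.
  left=> h h0; have [hd|dh] := ltP h c.2.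
    have -> : pi h = h * cell_slope pi c.
      by rewrite (cell_ext_eq plB Bc) ?(cell_extB _ _ h 0) ?c0 ?subr0 ?add0r //; left; rewrite e1 h0.
    rewrite mulrC ler_pM2r // (le_trans (ler_norm _)) // lerDl invr_ge0 ltW //.
  apply: (le_trans (minimal_valid_le1 h)); rewrite mulrDl.
  apply: (@le_trans _ _ (c.2^-1 * h)); last by rewrite lerDr mulr_ge0 // ltW.
  by rewrite mulrC ler_pdivlMr // mul1r.
have [c [Bc /andP[c1 c2]]] := left_cell bB 0.
have e2 : c.2 = 0.
  apply/eqP; rewrite eq_le c2 andbT leNgt; apply/negP => lt0.
  by apply: (cell_notB Bc (_ : c.1 < 0 < c.2)); rewrite ?lt0 ?c1.
have H : \forall x \near (0 : R)^'-, pi x = cell_ext pi c 0 + (x - 0) * cell_slope pi c.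
  near=> x; rewrite -cell_extB; apply: (cell_ext_eq plB Bc); left; rewrite e2.
  by apply/andP; split; near: x; [exact: nbhs_left_gt|exact: nbhs_left_lt].
have c0 : cell_ext pi c 0 = 0 by apply/(cvg_left_affine H); rewrite -[X in _ --> X]p0.
have d0 : 0 < - c.1 by rewrite oppr_gt0.
exists (`|cell_slope pi c| + (- c.1)^-1); first by rewrite addr_ge0 // invr_ge0 ltW.
right=> h h0; have [hd|dh] := ltP h (- c.1).
  have -> : pi (- h) = h * (- cell_slope pi c).
    rewrite (cell_ext_eq plB Bc) ?(cell_extB _ _ (- h) 0) ?c0 ?subr0 ?add0r ?mulNr ?mulrN //.
    by left; rewrite e2 oppr_lt0 h0 andbT ltrNr.
  rewrite mulrC ler_pM2r // (le_trans (ler_norm _)) // normrN lerDl invr_ge0 ltW //.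
apply: (le_trans (minimal_valid_le1 _)); rewrite mulrDl.
apply: (@le_trans _ _ ((- c.1)^-1 * h)); last by rewrite lerDr mulr_ge0 // ltW.
by rewrite mulrC ler_pdivlMr // mul1r.
Unshelve. all: by end_near. Qed.

Hypothesis eff : effective_perturbation f pi pt.

Lemma effective_dominated : exists K, forall x y, `|slack pt x y| <= K * slack pi x y.
Proof.
have [e e0 [mp mm]] := eff; exists e^-1 => x y.
have := mv_subadditive mp x y; have := mv_subadditive mm x y.
rewrite mulrC ler_pdivlMr // -[X in _ * X](gtr0_norm e0) -normrM ler_norml /slack.
by move=> h1 h2; apply/andP; split; lra.
Qed.

(* For both perturbed functions, [th (x + h) - th x <= th h <= 2 * pi h], which is
   linear in [h] on one side of 0. *)
Lemma effective_lipschitz c : cell B c -> exists2 K, 0 <= K &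
  forall x y, c.1 < x < c.2 -> c.1 < y < c.2 -> `|pt x - pt y| <= K * `|x - y|.
Proof.
move=> Bc; have [e e0 [mp mm]] := eff; have [s s0 hs] := one_sided_linear.
have e0' : 0 <= e^-1 by rewrite invr_ge0 ltW.
exists (e^-1 * (2 * s + `|cell_slope pi c|)); first by rewrite mulr_ge0 // addr_ge0 ?mulr_ge0.
suff H x y : c.1 < x < c.2 -> c.1 < y < c.2 -> x < y ->
    `|pt x - pt y| <= e^-1 * (2 * s + `|cell_slope pi c|) * `|x - y|.
  move=> x y hx hy; have [xy|yx|->] := ltgtP x y; first exact: H.
    by rewrite distrC (distrC x); exact: H.
  by rewrite !subrr !normr0 mulr0.
move=> hx hy xy; pose h := y - x; have h0 : 0 < h by rewrite subr_gt0.
have pe : pi y = pi x + h * cell_slope pi c.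
  by rewrite !(cell_ext_eq plB Bc) -?cell_extB //; left.
have yE : y = x + h by rewrite /h; ring.
have mle : `|h * cell_slope pi c| = h * `|cell_slope pi c| by rewrite normrM gtr0_norm.
(* Taking [u = -1] exchanges the two perturbed functions; the two instances bound the increment of
   [pt] from both sides. *)
have key (u : R) : u = 1 \/ u = -1 ->
    (forall z, 0 <= pi z + u * e * pt z) ->
    (forall z, 0 <= pi z - u * e * pt z) ->
    (forall z w, 0 <= slack (fun x => pi x + u * e * pt x) z w) ->
    (forall z w, 0 <= slack (fun x => pi x - u * e * pt x) z w) ->
    u * e * (pt y - pt x) <= (2 * s + `|cell_slope pi c|) * h.
  move=> hu p1 p2 s1 s2; have := ler_norm (h * cell_slope pi c).
  have := ler_norm (- (h * cell_slope pi c)); rewrite normrN mle => n1 n2.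
  case: hs => hs.
    have := s1 x h; rewrite /slack -yE; have := p2 h; have := hs _ h0.
    by rewrite pe; lra.
  have := s2 y (- h); rewrite /slack (_ : y - h = x); last by rewrite yE addrK.
  have := p1 (- h); have := hs _ h0.
  by rewrite pe; lra.
have k1 : e * (pt y - pt x) <= (2 * s + `|cell_slope pi c|) * h.
  have := key 1 (or_introl erefl); rewrite !mul1r; apply.
  - exact: mv_ge0 mp.
  - exact: mv_ge0 mm.
  - move=> z w; have := mv_subadditive mp z w; rewrite /slack; lra.
  - move=> z w; have := mv_subadditive mm z w; rewrite /slack; lra.
have k2 : - (e * (pt y - pt x)) <= (2 * s + `|cell_slope pi c|) * h.
  have := key (-1) (or_intror erefl); rewrite mulN1r mulNr; apply.
  - by move=> z; have := mv_ge0 mm z; lra.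
  - by move=> z; have := mv_ge0 mp z; lra.
  - move=> z w; have := mv_subadditive mm z w; rewrite /slack; lra.
  - move=> z w; have := mv_subadditive mp z w; rewrite /slack; lra.
rewrite -mulrA mulrC ler_pdivlMr // -[X in _ * X](gtr0_norm e0) -normrM.
rewrite (distrC x) (gtr0_norm h0) ler_norml; apply/andP; split; lra.
Qed.

Lemma effective_continuous z : ~ B z -> pt w @[w --> z] --> pt z.
Proof.
move=> nz; have [c [Bc rc]] := cell_ex bB z.
have iz := cell_in_notB Bc (cell_relintW rc) nz.
have [K K0 hK] := effective_lipschitz Bc.
apply/cvgrPdist_lt => e e0; near=> w.
have iw : c.1 < w < c.2 by near: w; exact: near_itv.
apply: le_lt_trans (hK _ _ iz iw) _.
apply: (@le_lt_trans _ _ ((K + 1) * `|z - w|)); first by rewrite ler_wpM2r // lerDl.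
rewrite mulrC -ltr_pdivlMr ?ltr_wpDl //.
by near: w; apply: cvgr_dist_lt => //; rewrite divr_gt0 // ltr_wpDl.
Unshelve. all: by end_near. Qed.

End EffectivePerturbations.

(** * Proof of the theorem *)

Section Analysis.
Variable R : realType.
Implicit Types (pt : R -> R) (g : isom R) (D J : set R) (x y : R).

Lemma punctured_lim pt t : pt y @[y --> t^'-] --> (0 : R) -> pt y @[y --> t^'+] --> (0 : R) ->
  forall e, 0 < e -> exists2 d, 0 < d & forall y, y <> t -> `|y - t| < d -> `|pt y| < e.
Proof.
move=> /cvgrPdist_lt hl /cvgrPdist_lt hr e e0.
have hl' : \forall y \near t, y < t -> `|0 - pt y| < e by exact: hl.
have hr' : \forall y \near t, t < y -> `|0 - pt y| < e by exact: hr.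
have : \forall y \near t, y <> t -> `|pt y| < e.
  near=> y => yt; rewrite -normrN -sub0r.
  have [h|h|//] := ltgtP y t; first by move: h; near: y.
  by move: h; near: y.
move=> /nbhs_ballP[d /= d0 hd]; exists d => // y yt yd; apply: hd => //.
by rewrite /ball /= distrC.
Unshelve. all: by end_near. Qed.

Lemma lipschitz_onP pt D : [lipschitz (pt x : R^o) | x in (D : set R^o)] <->
  exists2 K, 0 <= K & forall x y, D x -> D y -> `|pt x - pt y| <= K * `|x - y|.
Proof.
split=> [[M [_ hM]]|[K K0 hK]].
  exists (Num.max M 0 + 1) => [|x y Dx Dy].
    by rewrite addr_ge0 // le_max lexx orbT.
  have MK : M < Num.max M 0 + 1 by rewrite ltr_pwDr // le_max lexx.
  exact: (hM _ MK (x, y) (conj Dx Dy)).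
apply: filterS (nbhs_pinfty_ge (num_real K)) => N KN -[x y] [/= Dx Dy].
by apply: le_trans (hK _ _ Dx Dy) _; apply: ler_wpM2r.
Qed.

Lemma boundary_openP J x : open J ->
  boundary J x <-> (forall e, 0 < e -> exists2 y, J y & `|y - x| < e) /\ ~ J x.
Proof.
move=> oJ; rewrite /boundary (interior_id _).1 //; split=> -[h1 h2]; split=> //.
  exact/closure_ballP.
exact/closure_ballP.
Qed.

Lemma boundary_image g J x : open J -> open (g @` J) -> boundary J x -> boundary (g @` J) (g x).
Proof.
move=> oJ ogJ /(boundary_openP _ oJ)[h nJ]; apply/(boundary_openP _ ogJ); split.
  by move=> e /h[y Jy yx]; exists (g y); [exists y|rewrite isom_dist].
by rewrite image_isomE /= iinvK.
Qed.

(** As [y] tends to [t] within [J], both [pt y] and [pt (g y)] tend to 0, leaving only [a] in the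
    relation. *)
Lemma constant_zero pt g J t (a : R) : open J -> boundary J t ->
  (forall e, 0 < e -> exists2 d, 0 < d & forall y, y <> t -> `|y - t| < d -> `|pt y| < e) ->
  (forall e, 0 < e -> exists2 d, 0 < d & forall y, y <> g t -> `|y - g t| < d -> `|pt y| < e) ->
  (forall y, J y -> pt (g y) = chi g * pt y + a) -> a = 0.
Proof.
move=> oJ /(boundary_openP _ oJ)[hJ nJ] l1 l2 h.
apply/eqP; rewrite -normr_le0; apply/ler_addgt0Pl => e e0; rewrite addr0.
have e2 : 0 < e / 2 by rewrite divr_gt0.
have [d1 d10 h1] := l1 _ e2; have [d2 d20 h2] := l2 _ e2.
have [|y Jy] := hJ (Num.min d1 d2); first by rewrite lt_min d10.
rewrite lt_min => /andP[y1 y2].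
have yt : y <> t by move=> yt; apply: nJ; rewrite -yt.
have k1 := h1 y yt y1.
have k2 : `|pt (g y)| < e / 2.
  apply: h2; last by rewrite isom_dist.
  by move=> /(congr1 (iinv g)); rewrite !iinvK.
have nchi : `|chi g * pt y| = `|pt y|.
  by rewrite normrM; case: (g) => r /=; rewrite ?normrN normr1 mul1r.
rewrite (h _ Jy) in k2; rewrite (_ : a = (chi g * pt y + a) - chi g * pt y); last by ring.
by rewrite (le_trans (ler_normB _ _)) // nchi ltW // (splitr e) ltrD.
Qed.

(** The vanishing limits at the ends of the fundamental domain bound [pt] by [K] times the distance
    to its complement. The factor 2 is for two points that do not correspond to points of one copy
    of the domain. *)
Lemma equivariant_lipschitz pt (p : nat) (I : 'I_p -> set R) (gs : 'I_p -> isom R)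
    (a b K : R) : a < b -> 0 <= K -> periodic pt 1 ->
  (forall x, 0 <= x <= 1 -> ~ (\bigcup_j I j) x -> pt x = 0) ->
  (forall j, gs j @` `]a, b[%classic = I j) ->
  (forall x j, a < x < b -> pt x = chi (gs j) * pt (gs j x)) ->
  (forall x y, a < x < b -> a < y < b -> `|pt x - pt y| <= K * `|x - y|) ->
  pt y @[y --> a^'+] --> (0 : R) -> pt y @[y --> b^'-] --> (0 : R) ->
  forall x y, `|pt x - pt y| <= 2 * K * `|x - y|.
Proof.
move=> ab K0 ppt supp hI eqv lip la lb.
have toa x : a < x < b -> `|pt x| <= K * (x - a).
  move=> xab; have [ax xb] := andP xab.
  apply/ler_addgt0Pr => e e0; have /cvgrPdist_lt/(_ _ e0) h := la.
  have [y [/andP[ay yx] ye]] : exists y, a < y < x /\ `|0 - pt y| < e.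
    apply: (@filter_ex _ _ (at_right_proper_filter a)); near=> y; split; last by near: y.
    by apply/andP; split; near: y; [exact: nbhs_right_gt|exact: nbhs_right_lt].
  have yab : a < y < b by rewrite ay (lt_trans yx).
  have := lip x y xab yab; rewrite (@gtr0_norm _ (x - y)) ?subr_gt0 // => h1.
  rewrite -(subrK (pt y) (pt x)) (le_trans (ler_normD _ _)) // lerD //.
    by rewrite (le_trans h1) // ler_wpM2l // lerD2l lerN2 ltW.
  by move: ye; rewrite sub0r normrN => /ltW.
have tob x : a < x < b -> `|pt x| <= K * (b - x).
  move=> xab; have [ax xb] := andP xab.
  apply/ler_addgt0Pr => e e0; have /cvgrPdist_lt/(_ _ e0) h := lb.
  have [y [/andP[xy yb] ye]] : exists y, x < y < b /\ `|0 - pt y| < e.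
    apply: (@filter_ex _ _ (at_left_proper_filter b)); near=> y; split; last by near: y.
    by apply/andP; split; near: y; [exact: nbhs_left_gt|exact: nbhs_left_lt].
  have yab : a < y < b by rewrite (lt_trans ax xy).
  have := lip x y xab yab; rewrite (distrC x y) (@gtr0_norm _ (y - x)) ?subr_gt0 // => h1.
  rewrite -(subrK (pt y) (pt x)) (le_trans (ler_normD _ _)) // lerD //.
    by rewrite (le_trans h1) // ler_wpM2l // lerD2r ltW.
  by move: ye; rewrite sub0r normrN => /ltW.
have out x z : a < x < b -> ~ (a < z < b) -> `|pt x| <= K * `|x - z|.
  move=> xab nz; have [ax xb] := andP xab; have [za|az] := leP z a.
    apply: (le_trans (toa x xab)); rewrite ler_wpM2l //.
    rewrite (@gtr0_norm _ (x - z)) ?subr_gt0 ?(le_lt_trans za) //.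
    by rewrite lerD2l lerN2.
  have bz : b <= z by rewrite leNgt; apply/negP => zb; apply: nz; rewrite az.
  apply: (le_trans (tob x xab)); rewrite ler_wpM2l //.
  rewrite (distrC x z) (@gtr0_norm _ (z - x)) ?subr_gt0 ?(lt_le_trans xb) //.
  by rewrite lerD2r.
have nchi j x : a < x < b -> `|pt (gs j x)| = `|pt x|.
  move=> xab; rewrite (eqv x j xab) normrM.
  by case: (gs j) => r /=; rewrite ?normrN normr1 mul1r.
(* Both points are pulled back along the move that reaches [u]; if [w] falls outside the domain, the
   value at [u] alone is controlled. *)
have half u w : `|pt u| <= K * `|u - w| \/ `|pt u - pt w| <= K * `|u - w|.
  have [l u01] : exists l : int, 0 <= u + l%:~R < 1.
    exists (- Num.floor u); have := floor_itv u; rewrite intrD intrN => /andP[? ?].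
    by apply/andP; split; lra.
  have [[j _ Iu]|nI] := pselect ((\bigcup_j I j) (u + l%:~R)); last first.
    left; rewrite -(periodicz ppt u l) supp // ?normr0 ?mulr_ge0 //.
    by case/andP: u01 => -> /ltW ->.
  move: Iu; rewrite -hI => -[x]; rewrite /= in_itv /= => xab xu.
  pose z := iinv (gs j) (w + l%:~R).
  have zw : gs j z = w + l%:~R by rewrite iinvKV.
  have d : `|u - w| = `|x - z|.
    by rewrite -(isom_dist (gs j) x z) xu zw; congr `|_|; ring.
  rewrite d -(periodicz ppt u l) -(periodicz ppt w l) -xu -zw.
  have [zab|nz] := pselect (a < z < b); last by left; rewrite nchi //; exact: out.
  right; have -> : pt (gs j x) - pt (gs j z) = chi (gs j) * (pt x - pt z).
    rewrite (eqv x j xab) (eqv z j zab); have := chi_sqr (gs j) => e.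
    transitivity (chi (gs j) * chi (gs j) * (pt (gs j x) - pt (gs j z))); last by ring.
    by rewrite e mul1r.
  rewrite normrM (_ : `|chi (gs j)| = 1) ?mul1r; first exact: lip.
  by case: (gs j) => r /=; rewrite ?normrN normr1.
move=> u w; have := mulr_ge0 K0 (normr_ge0 (u - w)) => nn.
case: (half u w) => [hu|hu]; last by apply: (le_trans hu); lra.
have := half w u; rewrite (distrC w u) (distrC (pt w)) => -[hw|hw].
  by apply: (le_trans (ler_normB _ _)); lra.
by apply: (le_trans hw); lra.
Unshelve. all: by end_near. Qed.

End Analysis.

(** If [pi] were affine around [f], its maximum 1 there would make it constant near [f]. By symmetry
    [pi] would vanish near 0, and subadditivity applied to multiples of a small fraction of [f]
    would give [pi f = 0]. *)
Lemma minimal_breakpoint_f (R : realType) (f : R) (B : set R) (pi : R -> R) :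
  minimal_valid f pi -> breakpoints B -> piecewise_linear B pi -> B f.
Proof.
move=> mpi bB plB; apply: contrapT => nf.
have [c [Bc rc]] := cell_ex bB f.
have hf := cell_in_notB Bc (cell_relintW rc) nf.
have [d d0 hd] := near_gap hf.
have le1 := minimal_valid_le1 mpi.
have piE y : `|y - f| < d -> pi y = 1 + (y - f) * cell_slope pi c.
  move=> /hd hy; rewrite (cell_ext_eq plB Bc); last by left.
  by rewrite (cell_extB _ _ y f) -(cell_ext_eq plB Bc rc) (mv_f mpi).
have d2 : 0 < d / 2 by rewrite divr_gt0.
have sl : cell_slope pi c = 0.
  have n1 : `|f - d / 2 - f| < d by rewrite addrAC subrr sub0r normrN gtr0_norm //; lra.
  have n2 : `|f + d / 2 - f| < d by rewrite addrAC subrr add0r gtr0_norm //; lra.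
  have := le1 (f + d / 2); have := le1 (f - d / 2); rewrite !piE //.
  rewrite (addrAC f) subrr sub0r (addrAC f) subrr add0r => h1 h2.
  by apply: (sym_affine_eq0 d2); lra.
have zero y : `|y| < d -> pi y = 0.
  move=> yd; have := mv_symmetric mpi y; rewrite /slack (addrC y) subrK (mv_f mpi).
  have yd' : `|f - y - f| < d by rewrite addrAC subrr sub0r normrN.
  by rewrite (piE (f - y) yd') sl mulr0 addr0; lra.
have zn y n : `|y| < d -> pi (y *+ n) = 0.
  move=> yd; elim: n => [|n IH]; first by rewrite mulr0n (mv_0 mpi).
  have := mv_subadditive mpi y (y *+ n); rewrite /slack IH (zero y yd) -mulrS addr0 sub0r oppr_ge0.
  by have := mv_ge0 mpi (y *+ n.+1); move=> h1 h2; apply/eqP; rewrite eq_le h1 h2.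
have [n hn] : exists n : nat, `|f| / d < n.+1%:R.
  exists (Num.bound (`|f| / d)); apply: lt_trans (archi_boundP _) _; last by rewrite ltr_nat.
  by rewrite divr_ge0 // ltW.
have e : f / n.+1%:R *+ n.+1 = f by rewrite -[LHS]mulr_natr divfK ?pnatr_eq0.
have := zn (f / n.+1%:R) n.+1; rewrite e (mv_f mpi) => H.
have : (1 : R) = 0.
  apply: H; rewrite normrM normfV (@ger0_norm _ n.+1%:R) // ltr_pdivrMr ?ltr0n //.
  by rewrite mulrC -ltr_pdivrMr.
by move/eqP; rewrite oner_eq0.
Qed.

Lemma lipschitz_lim (R : realType) (pt : R -> R) (K t : R) : 0 <= K ->
  (forall x y, `|pt x - pt y| <= K * `|x - y|) -> pt y @[y --> t] --> pt t.
Proof.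
move=> K0 L; apply/cvgrPdist_lt => e e0; near=> y.
apply: le_lt_trans (L _ _) _.
apply: (@le_lt_trans _ _ ((K + 1) * `|t - y|)); first by rewrite ler_wpM2r // lerDl.
rewrite mulrC -ltr_pdivlMr ?ltr_wpDl //.
by near: y; apply: cvgr_dist_lt => //; rewrite divr_gt0 // ltr_wpDl.
Unshelve. all: by end_near. Qed.

Lemma perturbed_minimal (R : realType) (f u M : R) (pi pt : R -> R) :
  minimal_valid f pi -> periodic pt 1 -> pt 0 = 0 -> pt f = 0 -> (forall x, `|pt x| <= M) ->
  (forall x y, `|u * slack pt x y| <= slack pi x y) ->
  minimal_valid f (fun x => pi x + u * pt x).
Proof.
move=> mpi ppt pt0 ptf bnd dom.
have sE x y : slack (fun x => pi x + u * pt x) x y = slack pi x y + u * slack pt x y.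
  by rewrite /slack; ring.
have sub x y : 0 <= slack (fun x => pi x + u * pt x) x y.
  by rewrite sE -lerBlDr sub0r; have := dom x y; rewrite ler_norml => /andP[]; rewrite lerNl.
split=> //.
(* Nonnegativity: subadditivity bounds [th] at the [n]-th multiple of [x] by [n] times [th x], and
   [th] is bounded below, so [th x] cannot be negative. *)
- move=> x; pose th x := pi x + u * pt x.
  have nth n : th (x *+ n) <= n%:R * th x.
    elim: n => [|n IH]; first by rewrite mulr0n mul0r /th pt0 (mv_0 mpi) mulr0 addr0.
    have := sub x (x *+ n); rewrite /slack -mulrS -/(th _) -/(th _) -/(th _).
    by rewrite -natr1 mulrDl mul1r; lra.
  have low y : - (`|u| * M) <= th y.
    have := mv_ge0 mpi y; have : `|u * pt y| <= `|u| * M by rewrite normrM ler_wpM2l.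
    by rewrite ler_norml /th => /andP[]; lra.
  have uM0 : 0 <= `|u| * M by rewrite mulr_ge0 // (le_trans (normr_ge0 _) (bnd 0)).
  rewrite -/(th x) leNgt; apply/negP => neg.
  have pos : 0 < - th x by rewrite oppr_gt0.
  have := archi_boundP (divr_ge0 uM0 (ltW pos)); set n := Num.bound _.
  rewrite ltr_pdivrMr // => h; have := le_trans (low _) (nth n).
  by rewrite mulrN in h; lra.
- by move=> x /=; rewrite ppt (mv_periodic mpi).
- by rewrite pt0 (mv_0 mpi) mulr0 addr0.
- by rewrite ptf (mv_f mpi) mulr0 addr0.
- move=> x; rewrite sE; have := dom x (f - x); rewrite (mv_symmetric mpi) normr_le0.
  by move=> /eqP ->; rewrite addr0.
Qed.

Theorem theorem10p28 (R : realType) (f : R) (pi : R -> R) (B : set R)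
    (Om : set (move R)) (k : nat) (C : 'I_k -> set R)
    (p : nat) (I : 'I_p -> set R) (D : set R) (g : 'I_p -> isom R)
    (pt : R -> R) :
  f \isn't a Num.int ->
  minimal_valid f pi ->
  breakpoints B ->
  piecewise_linear B pi ->
  (pi x @[x --> (0 : R)^'+] --> pi 0 \/ pi x @[x --> (0 : R)^'-] --> pi 0) ->
  minimal_breakpoints B pi ->
  finite_presentation (clsemi (contA pi) (initial_moves pi)) Om C ->
  reduced_form (clsemi (contA pi) (initial_moves pi)) Om C ->
  uncovered_component pi B Om C I ->
  (exists i, D = I i) ->
  (forall j, Omega_uncovered pi B Om C (restr (g j) D) /\ g j @` D = I j) ->
  periodic pt 1 ->
  (forall x, 0 <= x <= 1 -> ~ (\bigcup_j I j) x -> pt x = 0) ->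
  zero_perturbation pi B Om C f pt <->
  [/\ [lipschitz (pt x : R^o) | x in (D : set R^o)],
      forall x, boundary D x ->
        [/\ pt x = 0, pt y @[y --> x^'-] --> (0 : R)
          & pt y @[y --> x^'+] --> (0 : R)]
    & forall x j, D x -> pt x = chi (g j) * pt (g j x)].
Proof.
move=> _ mpi bB plB side0 _ fp rf uc DI hg ppt supp.
have ppi := mv_periodic mpi; have pi0 := mv_0 mpi; have spi := mv_subadditive mpi.
have mD : maximal_itv (uncovered' pi B Om C) D := domain_maximal uc DI.
have [[oD iD [x0 Dx0]] DU' _] := mD.
have [a [b [ab DE]]] := maximal_oo mD.
have aD : boundary D a by rewrite DE; apply/(boundary_oo _ ab); left.
have bD : boundary D b by rewrite DE; apply/(boundary_oo _ ab); right.
split=> [[eff zr]|[/lipschitz_onP[K K0 lip] bd eqv]].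
- have [K hK] := effective_dominated eff.
  have ct := effective_continuous bB plB mpi side0 eff.
  split.
  + apply/lipschitz_onP; have [c [Bc rc]] := cell_ex bB x0.
    have nB x : D x -> ~ B x by move=> /DU'; exact: (U'_notB bB plB pi0 fp rf).
    have [e1 e2] := cell_endpoints Bc.
    have Dc : D `<=` `]c.1, c.2[%classic.
      apply: (itv_subset_oo iD Dx0); last 2 first.
      * by move=> /nB.
      * by move=> /nB.
      exact: (cell_in_notB Bc (cell_relintW rc) (nB _ Dx0)).
    have [K' K'0 hK'] := effective_lipschitz bB plB mpi side0 eff Bc.
    by exists K' => // x y /Dc + /Dc; rewrite /= !in_itv; exact: hK'.
  + by move=> x bx; apply: zr; exact: (boundary_refined bB fp rf mD bx).
  + move=> x j Dx; have hj : germ pi (g j) x0 := Omega_germ rf (hg j).1 Dx0.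
    have [c hc] := germ_respect bB plB pi0 spi fp rf hK ct hj mD Dx0.
    have lim t : refined_breakpoints pi B Om C t -> forall e, 0 < e ->
        exists2 d, 0 < d & forall y, y <> t -> `|y - t| < d -> `|pt y| < e.
      by move=> /zr[_ l r]; exact: punctured_lim.
    have mgD : maximal_itv (uncovered' pi B Om C) (g j @` D).
      by rewrite (hg j).2; exact: component_maximal uc j.
    have [[ogD _ _] _ _] := mgD.
    (* The endpoint [a] of [D] and its image are boundary points of components, hence refined
       breakpoints, where the limits of [pt] vanish. *)
    have c0 : c = 0.
      apply: (constant_zero oD aD _ _ hc).
        exact: lim (boundary_refined bB fp rf mD aD).
      apply: lim; apply: (boundary_refined bB fp rf mgD); exact: boundary_image.
    by rewrite hc // c0 addr0 mulrA chi_sqr mul1r.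
have Dab x : D x <-> a < x < b by rewrite DE /= in_itv.
have [za la' la] := bd a aD; have [zb lb lb'] := bd b bD.
have L : forall x y, `|pt x - pt y| <= 2 * K * `|x - y|.
  apply: (@equivariant_lipschitz R pt p I g a b K) => //.
  - by move=> j; rewrite -DE (hg j).2.
  - by move=> x j /Dab; exact: eqv.
  - by move=> x y /Dab Dx /Dab Dy; exact: lip.
have pB := B_zero bB plB pi0 fp rf uc ppt supp.
have pt0 : pt 0 = 0 by apply: pB; exact: (breakpoints_int bB 0).
have K20 : 0 <= 2 * K by rewrite mulr_ge0.
(* Modulo 1 every point is within distance 1 of 0, where [pt] vanishes, so the Lipschitz constant
   also bounds [pt]. *)
have bnd x : `|pt x| <= 2 * K.
  have /andP[h1 h2] := floor_itv x; rewrite -(periodicz ppt x (- Num.floor x)).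
  rewrite -[pt _]subr0 -pt0 (le_trans (L _ _)) // subr0 ler_piMr // intrN ger0_norm ?subr_ge0 //.
  by move: h2; rewrite intrD => h2; rewrite lerBlDr addrC ltW.
have [N N0 dom] := slack_domination bB plB ppi spi K20 K20 L bnd
  (gadd_slack_zero bB plB ppi pi0 spi fp rf uc DI hg ppt supp eqv).
have ptf : pt f = 0 by apply: pB; exact: minimal_breakpoint_f mpi bB plB.
have MV u : `|u| = N^-1 -> minimal_valid f (fun x => pi x + u * pt x).
  move=> uN; apply: (perturbed_minimal mpi ppt pt0 ptf bnd) => x y.
  by rewrite normrM uN mulrC ler_pdivrMr // mulrC.
split.
  have Ni : 0 < N^-1 by rewrite invr_gt0.
  exists N^-1 => //; split; first by apply: MV; rewrite gtr0_norm.
  have -> : (fun x => pi x - N^-1 * pt x) = (fun x => pi x + - N^-1 * pt x).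
    by apply/funext => x; rewrite mulNr.
  by apply: MV; rewrite normrN gtr0_norm.
(* A refined breakpoint is a translate of a point of the unit interval outside [U'], where [pt] is
   0; global Lipschitz continuity then yields both one-sided limits. *)
move=> t [w hw [l tE]]; have pt_t : pt t = 0.
  rewrite tE periodicz //.
  have w01 : 0 <= w <= 1.
    case: hw => [[/(Xset01 fp)//|/(Yset01 rf)/andP[? ?]]|[/U_sub01/andP[? ?] _]].
      by rewrite !ltW.
    by rewrite !ltW.
  apply: (notU'_zero uc supp w01) => -[_]; apply; exists w => //.
  by exists 0; rewrite addr0.
have ct : pt y @[y --> t] --> (0 : R).
  by rewrite -[X in _ --> X]pt_t; exact: lipschitz_lim K20 L.
by split=> //; [exact: cvg_at_left_filter|exact: cvg_at_right_filter].
Qed.
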